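(* Let $k\ge 2$ and let $R=\mathbb{C}[x,y]/(x^k)$ be $\mathbb{Z}$-graded with $\deg x=1$, $\deg y=-1$. The category $\mathrm{MCM}^0_{\mathbb{Z}}R$ of generically free maximal Cohen--Macaulay graded $R$-modules is stably $2$-Calabi--Yau, i.e. its stable category $\underline{\mathrm{MCM}}^0_{\mathbb{Z}}R$ is a $2$-Calabi--Yau triangulated category.
   Context: $\mathrm{gr}R$ is the category of finitely generated $\mathbb{Z}$-graded $R$-modules with degree $0$ morphisms. $\mathrm{MCM}_{\mathbb{Z}}R$ is the full subcategory of $\mathrm{gr}R$ of maximal Cohen--Macaulay modules, i.e. those $M$ with $\mathrm{Ext}^i_R(M,R)=0$ for all $i>0$ (equivalently, since $R$ is Gorenstein, $\mathrm{depth}(M_{\mathfrak p})=\dim R_{\mathfrak p}$ for all primes $\mathfrak p$ in the support of $M$). Let $\mathcal{F}=R_y=\mathbb{C}[x,y^{\pm 1}]/(x^k)$. $M\in\mathrm{gr}R$ is generically free of rank $n$ if $M\otimes_R\mathcal{F}$ is a graded free $\mathcal{F}$-module of rank $n$. $\mathrm{MCM}^0_{\mathbb{Z}}R$ is the full subcategory of $\mathrm{MCM}_{\mathbb{Z}}R$ of modules that are generically free (of some finite rank). It is a Frobenius category (with projective-injectives the graded projective $R$-modules), so its stable category $\underline{\mathrm{MCM}}^0_{\mathbb{Z}}R$ (same objects, morphisms modulo those factoring through projectives) is triangulated with suspension $\Sigma$. A $\mathbb{C}$-linear triangulated category with finite-dimensional Hom-spaces is $2$-Calabi--Yau if $\Sigma^2$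 is a Serre functor, i.e. there are isomorphisms $\mathrm{Hom}(X,Y)\cong \mathrm{Hom}_{\mathbb{C}}(\mathrm{Hom}(Y,\Sigma^2X),\mathbb{C})$ natural in $X$ and $Y$. *)

(* Defs.v *)
From HB Require Import structures.
From mathcomp Require Import all_boot all_order all_algebra.
From mathcomp Require Import boolp reals complex.

Set Implicit Arguments.
Unset Strict Implicit.
Unset Printing Implicit Defensive.

Import GRing.Theory.
Local Open Scope ring_scope.
Local Open Scope quotient_scope.

Record subspace (K : fieldType) (V : lmodType K) := Subspace {
  in_sub :> V -> Prop;
  in_sub0 : in_sub 0;
  in_subP : forall a u v, in_sub u -> in_sub v -> in_sub (a *: u + v) }.

Section QuotientSpace.
Context (K : fieldType) (V : lmodType K) (W : subspace V).

Lemma subspaceZ a u : W u -> W (a *: u).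
Proof. by move=> Wu; rewrite -[_ *: _]addr0; apply: in_subP => //; apply: in_sub0. Qed.

Lemma subspaceD u v : W u -> W v -> W (u + v).
Proof. by move=> Wu Wv; rewrite -[u]scale1r; apply: in_subP. Qed.

Lemma subspaceN u : W u -> W (- u).
Proof. by move=> Wu; rewrite -scaleN1r; apply: subspaceZ. Qed.

Definition sub_equiv (u v : V) : bool := `[< W (u - v) >].

Lemma sub_equiv_refl : reflexive sub_equiv.
Proof. by move=> u; apply/asboolP; rewrite subrr; apply: in_sub0. Qed.

Lemma sub_equiv_sym : symmetric sub_equiv.
Proof.
move=> u v; apply/asboolP/asboolP => /subspaceN; by rewrite opprB.
Qed.

Lemma sub_equiv_trans : transitive sub_equiv.
Proof.
move=> v u w /asboolP uv /asboolP vw; apply/asboolP.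
by have := subspaceD uv vw; rewrite addrA subrK.
Qed.

Canonical sub_equivRel :=
  EquivRel sub_equiv sub_equiv_refl sub_equiv_sym sub_equiv_trans.

Definition quotspace := {eq_quot sub_equiv}.
HB.instance Definition _ : EqQuotient V sub_equiv quotspace := EqQuotient.on quotspace.
HB.instance Definition _ := Choice.on quotspace.

Definition qpi (u : V) : quotspace := \pi_quotspace u.

Lemma quotspaceP u v : (qpi u = qpi v) <-> W (u - v).
Proof. by split=> [/eqmodP/asboolP|uv] //; apply/eqmodP/asboolP. Qed.

Lemma qpiW (P : quotspace -> Prop) : (forall u, P (qpi u)) -> forall x, P x.
Proof. by move=> Pu x; rewrite -[x]reprK; apply: Pu. Qed.

Definition qadd (x y : quotspace) : quotspace := qpi (repr x + repr y).
Definition qopp (x : quotspace) : quotspace := qpi (- repr x).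
Definition qscale (a : K) (x : quotspace) : quotspace := qpi (a *: repr x).

Lemma repr_piB u : W (repr (qpi u) - u).
Proof. by apply/quotspaceP; rewrite /qpi reprK. Qed.

Lemma qaddE u v : qadd (qpi u) (qpi v) = qpi (u + v).
Proof.
by apply/quotspaceP; rewrite opprD addrACA; apply: subspaceD; apply: repr_piB.
Qed.

Lemma qoppE u : qopp (qpi u) = qpi (- u).
Proof. by apply/quotspaceP; rewrite -opprD; apply/subspaceN/repr_piB. Qed.

Lemma qscaleE a u : qscale a (qpi u) = qpi (a *: u).
Proof. by apply/quotspaceP; rewrite -scalerBr; apply/subspaceZ/repr_piB. Qed.

Lemma qaddA : associative qadd.
Proof.
elim/qpiW=> u; elim/qpiW=> v; elim/qpiW=> w.
by rewrite !qaddE addrA.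
Qed.

Lemma qaddC : commutative qadd.
Proof. by elim/qpiW=> u; elim/qpiW=> v; rewrite !qaddE addrC. Qed.

Lemma qadd0 : left_id (qpi 0) qadd.
Proof. by elim/qpiW=> u; rewrite qaddE add0r. Qed.

Lemma qaddN : left_inverse (qpi 0) qopp qadd.
Proof. by elim/qpiW=> u; rewrite qoppE qaddE addNr. Qed.

HB.instance Definition _ :=
  GRing.isZmodule.Build quotspace qaddA qaddC qadd0 qaddN.

Lemma qscaleA a b x : qscale a (qscale b x) = qscale (a * b) x.
Proof. by elim/qpiW: x => u; rewrite !qscaleE scalerA. Qed.

Lemma qscale1 : left_id 1 qscale.
Proof. by elim/qpiW=> u; rewrite qscaleE scale1r. Qed.

Lemma qscaleDr : right_distributive qscale +%R.
Proof.
move=> a; elim/qpiW=> u; elim/qpiW=> v.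
by rewrite -[_ + _]/(qadd _ _) qaddE !qscaleE scalerDr -qaddE.
Qed.

Lemma qscaleDl x : {morph qscale^~ x : a b / a + b}.
Proof.
by move=> a b; elim/qpiW: x => u; rewrite !qscaleE scalerDl -qaddE.
Qed.

HB.instance Definition _ :=
  GRing.Zmodule_isLmodule.Build K quotspace qscaleA qscale1 qscaleDr qscaleDl.

Lemma quotspace_linear a u v :
  qpi (a *: u + v) = a *: qpi u + qpi v.
Proof. by rewrite -qaddE -qscaleE. Qed.

End QuotientSpace.

(* [cmp g f] is the composite g o f. *)
Record linCat (K : fieldType) := LinCat {
  ob :> Type;
  hom : ob -> ob -> lmodType K;
  idm : forall X, hom X X;
  cmp : forall X Y Z, hom Y Z -> hom X Y -> hom X Z;
  cmpA : forall X Y Z T (h : hom Z T) (g : hom Y Z) (f : hom X Y),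
    cmp h (cmp g f) = cmp (cmp h g) f;
  cmp1m : forall X Y (f : hom X Y), cmp (idm Y) f = f;
  cmpm1 : forall X Y (f : hom X Y), cmp f (idm X) = f;
  cmpPl : forall X Y Z a (g h : hom Y Z) (f : hom X Y),
    cmp (a *: g + h) f = a *: cmp g f + cmp h f;
  cmpPr : forall X Y Z a (h : hom Y Z) (f g : hom X Y),
    cmp h (a *: f + g) = a *: cmp h f + cmp h g }.

Arguments idm {K C} X : rename.
Arguments cmp {K C X Y Z} g f : rename.
Infix "\c" := cmp (at level 40, left associativity).

Record linFunctor (K : fieldType) (C D : linCat K) := LinFunctor {
  fob :> C -> D;
  fmap : forall X Y, hom X Y -> hom (fob X) (fob Y);
  fmap1 : forall X, fmap (idm X) = idm (fob X);
  fmapM : forall X Y Z (g : hom Y Z) (f : hom X Y),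
    fmap (g \c f) = fmap g \c fmap f;
  fmapP : forall X Y a (f g : hom X Y),
    fmap (a *: f + g) = a *: fmap f + fmap g }.

Arguments fmap {K C D} F {X Y} f : rename.

Section CatNotions.
Context (K : fieldType) (C : linCat K).
Implicit Types X Y Z : C.

Lemma cmp0m X Y Z (f : hom X Y) : (0 : hom Y Z) \c f = 0.
Proof. by have := cmpPl (-1) (0 : hom Y Z) 0 f; rewrite scaler0 addr0 scaleN1r addNr. Qed.

Lemma cmpm0 X Y Z (f : hom Y Z) : f \c (0 : hom X Y) = 0.
Proof. by have := cmpPr (-1) f (0 : hom X Y) 0; rewrite scaler0 addr0 scaleN1r addNr. Qed.

Lemma cmpDl X Y Z (g h : hom Y Z) (f : hom X Y) : (g + h) \c f = g \c f + h \c f.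
Proof. by have := cmpPl 1 g h f; rewrite !scale1r. Qed.

Lemma cmpDr X Y Z (h : hom Y Z) (f g : hom X Y) : h \c (f + g) = h \c f + h \c g.
Proof. by have := cmpPr 1 h f g; rewrite !scale1r. Qed.

Lemma cmpZl X Y Z a (g : hom Y Z) (f : hom X Y) : (a *: g) \c f = a *: (g \c f).
Proof. by have := cmpPl a g 0 f; rewrite cmp0m !addr0. Qed.

Lemma cmpZr X Y Z a (g : hom Y Z) (f : hom X Y) : g \c (a *: f) = a *: (g \c f).
Proof. by have := cmpPr a g f 0; rewrite cmpm0 !addr0. Qed.

Definition is_iso X Y (f : hom X Y) :=
  exists g : hom Y X, g \c f = idm X /\ f \c g = idm Y.

Definition isomorphic X Y := exists f : hom X Y, is_iso f.

Definition is_zero X := idm X = 0.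

Definition is_biproduct X Y Z (i1 : hom X Z) (i2 : hom Y Z)
    (p1 : hom Z X) (p2 : hom Z Y) :=
  [/\ p1 \c i1 = idm X, p2 \c i2 = idm Y, p2 \c i1 = 0, p1 \c i2 = 0
    & i1 \c p1 + i2 \c p2 = idm Z].

Definition additive_cat :=
  (exists Z, is_zero Z) /\
  (forall X Y, exists Z i1 i2 p1 p2, @is_biproduct X Y Z i1 i2 p1 p2).

(* The square with sides i : X -> I, u : X -> Y, q : I -> Z, v : Y -> Z. *)
Definition is_pushout X I Y Z
    (i : hom X I) (u : hom X Y) (q : hom I Z) (v : hom Y Z) :=
  q \c i = v \c u /\
  forall T (q' : hom I T) (v' : hom Y T), q' \c i = v' \c u ->
    exists! w : hom Z T, w \c q = q' /\ w \c v = v'.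

End CatNotions.

Definition autoequivalence (K : fieldType) (C : linCat K) (F : linFunctor C C) :=
  (forall X Y, bijective (@fmap K C C F X Y)) /\
  (forall Y, exists X, isomorphic (F X) Y).

Section FullSubcategory.
Context (K : fieldType) (C : linCat K) (Q : C -> Prop).

Record full_ob := FullOb { full_val :> C; full_valP : Q full_val }.

Definition full_subcat : linCat K :=
  @LinCat K full_ob (fun X Y => @hom K C X Y) (fun X => @idm K C X)
    (fun X Y Z g f => @cmp K C X Y Z g f)
    (fun X Y Z T => @cmpA K C X Y Z T) (fun X Y => @cmp1m K C X Y)
    (fun X Y => @cmpm1 K C X Y) (fun X Y Z => @cmpPl K C X Y Z)
    (fun X Y Z => @cmpPr K C X Y Z).

End FullSubcategory.

Record cat_ideal (K : fieldType) (C : linCat K) := CatIdeal {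
  in_ideal : forall X Y : C, subspace (hom X Y);
  idealMl : forall (X Y Z : C) (g : hom Y Z) (f : hom X Y),
    in_ideal X Y f -> in_ideal X Z (g \c f);
  idealMr : forall (X Y Z : C) (g : hom Y Z) (f : hom X Y),
    in_ideal Y Z g -> in_ideal X Z (g \c f) }.

Section QuotientCategory.
Context (K : fieldType) (C : linCat K) (J : cat_ideal C).

Definition quot_hom (X Y : C) : lmodType K := quotspace (in_ideal J X Y).

Definition quot_map (X Y : C) (f : hom X Y) : quot_hom X Y := qpi (in_ideal J X Y) f.

Definition quot_cmp X Y Z (g : quot_hom Y Z) (f : quot_hom X Y) : quot_hom X Z :=
  quot_map (repr g \c repr f).

Lemma quot_mapP X Y (f g : hom X Y) :
  quot_map f = quot_map g <-> in_ideal J X Y (f - g).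
Proof. exact: quotspaceP. Qed.

Lemma quot_map_linear X Y a (f g : hom X Y) :
  quot_map (a *: f + g) = a *: quot_map f + quot_map g.
Proof. exact: quotspace_linear. Qed.

Lemma quot_mapW X Y (P : quot_hom X Y -> Prop) :
  (forall f, P (quot_map f)) -> forall x, P x.
Proof. exact: qpiW. Qed.

Lemma quot_cmpE X Y Z (g : hom Y Z) (f : hom X Y) :
  quot_cmp (quot_map g) (quot_map f) = quot_map (g \c f).
Proof.
apply/quot_mapP; set g' := repr _; set f' := repr _.
have Jg : in_ideal J Y Z (g' - g) by apply: repr_piB.
have Jf : in_ideal J X Y (f' - f) by apply: repr_piB.
have -> : g' \c f' - g \c f = g' \c (f' - f) + (g' - g) \c f.
  by rewrite cmpDr cmpDl -[- f]scaleN1r -[- g]scaleN1r cmpZl cmpZr !scaleN1r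
             addrA subrK.
by apply: subspaceD; [apply: idealMl | apply: idealMr].
Qed.

Lemma quot_cmpA X Y Z T (h : quot_hom Z T) (g : quot_hom Y Z) (f : quot_hom X Y) :
  quot_cmp h (quot_cmp g f) = quot_cmp (quot_cmp h g) f.
Proof.
elim/quot_mapW: h => h; elim/quot_mapW: g => g; elim/quot_mapW: f => f.
by rewrite !quot_cmpE cmpA.
Qed.

Lemma quot_cmp1m X Y (f : quot_hom X Y) : quot_cmp (quot_map (idm Y)) f = f.
Proof. by elim/quot_mapW: f => f; rewrite quot_cmpE cmp1m. Qed.

Lemma quot_cmpm1 X Y (f : quot_hom X Y) : quot_cmp f (quot_map (idm X)) = f.
Proof. by elim/quot_mapW: f => f; rewrite quot_cmpE cmpm1. Qed.

Lemma quot_cmpPl X Y Z a (g h : quot_hom Y Z) (f : quot_hom X Y) :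
  quot_cmp (a *: g + h) f = a *: quot_cmp g f + quot_cmp h f.
Proof.
elim/quot_mapW: h => h; elim/quot_mapW: g => g; elim/quot_mapW: f => f.
by rewrite -quot_map_linear !quot_cmpE cmpPl quot_map_linear.
Qed.

Lemma quot_cmpPr X Y Z a (h : quot_hom Y Z) (f g : quot_hom X Y) :
  quot_cmp h (a *: f + g) = a *: quot_cmp h f + quot_cmp h g.
Proof.
elim/quot_mapW: h => h; elim/quot_mapW: g => g; elim/quot_mapW: f => f.
by rewrite -quot_map_linear !quot_cmpE cmpPr quot_map_linear.
Qed.

Definition quot_cat : linCat K :=
  LinCat quot_cmpA quot_cmp1m quot_cmpm1 quot_cmpPl quot_cmpPr.

End QuotientCategory.

Record triangulation (K : fieldType) (C : linCat K) := Triangulation {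
  susp : linFunctor C C;
  dist : forall X Y Z : C, hom X Y -> hom Y Z -> hom Z (susp X) -> Prop }.

Arguments dist {K C} T {X Y Z} u v w : rename.

Definition triangle_iso (K : fieldType) (C : linCat K) (S : linFunctor C C)
    (X Y Z X' Y' Z' : C)
    (u : hom X Y) (v : hom Y Z) (w : hom Z (S X))
    (u' : hom X' Y') (v' : hom Y' Z') (w' : hom Z' (S X')) :=
  exists (a : hom X X') (b : hom Y Y') (c : hom Z Z'),
    [/\ is_iso a, is_iso b & is_iso c] /\
    [/\ b \c u = u' \c a, c \c v = v' \c b & fmap S a \c w = w' \c c].

Record is_triangulated (K : fieldType) (C : linCat K) (T : triangulation C) : Prop :=
  IsTriangulated {
  tr_additive : additive_cat C;
  tr_susp : autoequivalence (susp T);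
  tr1_iso : forall (X Y Z X' Y' Z' : C)
      (u : hom X Y) (v : hom Y Z) (w : hom Z (susp T X))
      (u' : hom X' Y') (v' : hom Y' Z') (w' : hom Z' (susp T X')),
    triangle_iso u v w u' v' w' -> dist T u v w -> dist T u' v' w';
  tr1_id : forall X Z : C, is_zero Z ->
    dist T (idm X) (0 : hom X Z) (0 : hom Z (susp T X));
  tr1_cone : forall (X Y : C) (u : hom X Y),
    exists Z (v : hom Y Z) (w : hom Z (susp T X)), dist T u v w;
  tr2 : forall (X Y Z : C) (u : hom X Y) (v : hom Y Z) (w : hom Z (susp T X)),
    dist T u v w <-> dist T v w (- fmap (susp T) u);
  tr3 : forall (X Y Z X' Y' Z' : C)
      (u : hom X Y) (v : hom Y Z) (w : hom Z (susp T X))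
      (u' : hom X' Y') (v' : hom Y' Z') (w' : hom Z' (susp T X'))
      (a : hom X X') (b : hom Y Y'),
    dist T u v w -> dist T u' v' w' -> b \c u = u' \c a ->
    exists c : hom Z Z', c \c v = v' \c b /\ fmap (susp T) a \c w = w' \c c;
  tr4 : forall (X Y Z Z' X' Y' : C) (u : hom X Y) (v : hom Y Z)
      (i : hom Y Z') (i' : hom Z' (susp T X))
      (j : hom Z X') (j' : hom X' (susp T Y))
      (l : hom Z Y') (l' : hom Y' (susp T X)),
    dist T u i i' -> dist T v j j' -> dist T (v \c u) l l' ->
    exists (f : hom Z' Y') (g : hom Y' X'),
      dist T f g (fmap (susp T) i \c j') /\
      [/\ f \c i = l \c v, l' \c f = i', g \c l = j
        & j' \c g = fmap (susp T) u \c l'] }.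

Definition hom_finite (K : fieldType) (C : linCat K) :=
  forall X Y : C, exists (n : nat) (e : 'I_n -> hom X Y),
    forall f, exists c : 'I_n -> K, f = \sum_i c i *: e i.

(* S is a Serre functor: linear isomorphisms Hom(X,Y) ~ Hom(Y, S X)^* natural in
   X and Y. *)
Definition is_serre (K : fieldType) (C : linCat K) (S : C -> C)
    (Smap : forall X Y : C, hom X Y -> hom (S X) (S Y)) :=
  exists phi : forall X Y : C, hom X Y -> {linear hom Y (S X) -> K^o},
    [/\ forall X Y a (f g : hom X Y) h,
          phi X Y (a *: f + g) h = a * phi X Y f h + phi X Y g h,
        forall X Y, bijective (phi X Y),
        forall X Y Y' (f : hom X Y) (g : hom Y Y') (h : hom Y' (S X)),
          phi X Y' (g \c f) h = phi X Y f (h \c g)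
      & forall X' X Y (e : hom X' X) (f : hom X Y) (h : hom Y (S X')),
          phi X' Y (f \c e) h = phi X Y f (Smap _ _ e \c h)].

Record is_2CY_triangulated (K : fieldType) (C : linCat K) (T : triangulation C) : Prop :=
  Is2CYTriangulated {
  cy_triangulated : is_triangulated T;
  cy_hom_finite : hom_finite C;
  cy_serre : is_serre (fun X Y f => fmap (susp T) (@fmap K C C (susp T) X Y f)) }.

Definition is_surjective (A B : Type) (f : A -> B) := forall y, exists x, f x = y.

Definition projective_module (A : comNzRingType) (P : lmodType A) :=
  forall (M N : lmodType A) (g : {linear M -> N}) (f : {linear P -> N}),
    is_surjective g -> exists h : {linear P -> M}, forall p, g (h p) = f p.

Record projective_resolution (A : comNzRingType) (M : lmodType A) :=
  ProjectiveResolution {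
  res :> nat -> lmodType A;
  res_d : forall n, {linear res n.+1 -> res n};
  res_aug : {linear res 0 -> M};
  res_projective : forall n, projective_module (res n);
  res_aug_surj : is_surjective res_aug;
  res_exact0 : forall x, res_aug x = 0 <-> exists y, res_d 0 y = x;
  res_exactS : forall n x, res_d n x = 0 <-> exists y, res_d n.+1 y = x }.

(* Ext^{n+1}_A(M,N) = 0, where Ext^{n+1}_A(M,N) is the cohomology of Hom_A(P,N) at
   Hom_A(P_{n+1},N) for a projective resolution P of M. *)
Definition ext_succ_eq0 (A : comNzRingType) (n : nat) (M N : lmodType A) :=
  exists P : projective_resolution M, forall f : {linear P n.+1 -> N},
    (forall x, f (res_d P n.+1 x) = 0) ->
    exists g : {linear P n -> N}, forall x, f x = g (res_d P n x).

(* A ring A with a grading given by [dA i a] := "a is homogeneous of degree i". *)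
Record grModule (A : comNzRingType) (dA : int -> A -> Prop) := GrModule {
  grcar :> lmodType A;
  homog : int -> grcar -> Prop;
  homog0 : forall i, homog i 0;
  homogB : forall i m n, homog i m -> homog i n -> homog i (m - n);
  homogZ : forall i j a m, dA i a -> homog j m -> homog (i + j) (a *: m);
  homog_span : forall m, exists (s : seq int) (c : int -> grcar),
    [/\ uniq s, forall i, homog i (c i) & m = \sum_(i <- s) c i];
  homog_free : forall (s : seq int) (c : int -> grcar),
    uniq s -> (forall i, homog i (c i)) -> \sum_(i <- s) c i = 0 ->
    forall i, i \in s -> c i = 0 }.

Arguments homog {A dA} M i m : rename.

Definition finitely_generated (A : comNzRingType) (M : lmodType A) :=
  exists (n : nat) (e : 'I_n -> M),
    forall m, exists c : 'I_n -> A, m = \sum_i c i *: e i.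

Definition graded_free (A : comNzRingType) (dA : int -> A -> Prop) (n : nat)
    (M : grModule dA) :=
  exists (d : 'I_n -> int) (e : 'I_n -> M),
    (forall i, homog M (d i) (e i)) /\
    forall m : M, exists! c : {ffun 'I_n -> A}, m = \sum_i c i *: e i.

(* t : M -> T exhibits T as the extension of scalars of M along phi : A -> B,
   i.e. as the tensor product of M with B over A. *)
Definition is_base_change (A B : comNzRingType) (phi : {rmorphism A -> B})
    (M : lmodType A) (T : lmodType B) (t : M -> T) :=
  let semilinear (U : lmodType B) (g : M -> U) :=
    forall a m m', g (a *: m + m') = phi a *: g m + g m' in
  semilinear T t /\
  forall (U : lmodType B) (g : M -> U), semilinear U g ->
    exists! h : {linear T -> U}, forall m, h (t m) = g m.

Section GradedHom.
Context (K : fieldType) (A : comAlgType K) (dA : int -> A -> Prop).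
Hypothesis dA_scalar : forall c : K, dA 0 c%:A.
Implicit Types M N P : grModule dA.

Record grHom M N := GrHom {
  grfun :> M -> N;
  grfun_linear : linear grfun;
  grfun_homog : forall i m, homog M i m -> homog N i (grfun m) }.

Lemma grHomP M N (f g : grHom M N) : f =1 g -> f = g.
Proof.
case: f => f fl fh; case: g => g gl gh /= /funext fg; rewrite -fg in gl gh *.
by congr GrHom; apply: Prop_irrelevance.
Qed.

HB.instance Definition _ M N := gen_eqMixin (grHom M N).
HB.instance Definition _ M N := gen_choiceMixin (grHom M N).

Lemma homogD M i (m n : M) : homog M i m -> homog M i n -> homog M i (m + n).
Proof.
move=> hm hn; rewrite -[n]opprK; apply: homogB => //.
by rewrite -sub0r; apply: homogB => //; apply: homog0.
Qed.

Lemma homogK M i c (m : M) : homog M i m -> homog M i ((c%:A : A) *: m).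
Proof. by rewrite -[i in homog M i (_ *: _)]add0r; apply: homogZ. Qed.

Section Operations.
Context (M N : grModule dA).
Implicit Types f g h : grHom M N.

Lemma gr0_linear : linear (fun _ : M => 0 : N).
Proof. by move=> a u v; rewrite scaler0 addr0. Qed.
Definition gr0 := GrHom gr0_linear (fun i _ _ => homog0 N i).

Lemma grD_linear f g : linear (fun m => f m + g m).
Proof. by move=> a u v; rewrite !grfun_linear scalerDr addrACA. Qed.
Definition grD f g := GrHom (grD_linear f g)
  (fun i m hm => homogD (grfun_homog f hm) (grfun_homog g hm)).

Lemma grN_linear f : linear (fun m => 0 - f m).
Proof. by move=> a u v; rewrite !sub0r grfun_linear opprD scalerN. Qed.
Definition grN f := GrHom (grN_linear f)
  (fun i m hm => homogB (homog0 N i) (grfun_homog f hm)).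

Lemma grZ_linear (c : K) f : linear (fun m => (c%:A : A) *: f m).
Proof. by move=> a u v; rewrite grfun_linear scalerDr !scalerA mulrC. Qed.
Definition grZ c f := GrHom (grZ_linear c f)
  (fun i m hm => homogK c (grfun_homog f hm)).

Lemma grDA : associative grD.
Proof. by move=> f g h; apply: grHomP => m /=; rewrite addrA. Qed.
Lemma grDC : commutative grD.
Proof. by move=> f g; apply: grHomP => m /=; rewrite addrC. Qed.
Lemma grD0 : left_id gr0 grD.
Proof. by move=> f; apply: grHomP => m /=; rewrite add0r. Qed.
Lemma grDN : left_inverse gr0 grN grD.
Proof. by move=> f; apply: grHomP => m /=; rewrite sub0r addNr. Qed.

HB.instance Definition _ := GRing.isZmodule.Build (grHom M N) grDA grDC grD0 grDN.

Lemma grZA a b f : grZ a (grZ b f) = grZ (a * b) f.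
Proof. by apply: grHomP => m /=; rewrite !scalerA -scalerAl mul1r scalerA. Qed.
Lemma grZ1 : left_id 1 grZ.
Proof. by move=> f; apply: grHomP => m /=; rewrite !scale1r. Qed.
Lemma grZDr : right_distributive grZ +%R.
Proof. by move=> a f g; apply: grHomP => m /=; rewrite scalerDr. Qed.
Lemma grZDl f : {morph grZ^~ f : a b / a + b}.
Proof. by move=> a b; apply: grHomP => m /=; rewrite !scalerDl. Qed.

HB.instance Definition _ :=
  GRing.Zmodule_isLmodule.Build K (grHom M N) grZA grZ1 grZDr grZDl.

End Operations.

Lemma grfun0 M N (f : grHom M N) : f 0 = 0.
Proof.
by have := grfun_linear f (-1) 0 0; rewrite scaler0 addr0 scaleN1r addNr.
Qed.

Lemma grid_linear M : linear (fun m : M => m). Proof. by []. Qed.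
Definition grid M := GrHom (@grid_linear M) (fun i m hm => hm).

Lemma grcomp_linear M N P (g : grHom N P) (f : grHom M N) :
  linear (fun m => g (f m)).
Proof. by move=> a u v; rewrite !grfun_linear. Qed.
Definition grcomp M N P (g : grHom N P) (f : grHom M N) :=
  GrHom (grcomp_linear g f) (fun i m hm => grfun_homog g (grfun_homog f hm)).

Record fgGrModule := FgGrModule {
  fg_val :> grModule dA;
  fg_valP : finitely_generated fg_val }.

Lemma grcompA (M N P Q : fgGrModule) (h : grHom P Q) (g : grHom N P) (f : grHom M N) :
  grcomp h (grcomp g f) = grcomp (grcomp h g) f.
Proof. exact: grHomP. Qed.
Lemma grcomp1m (M N : fgGrModule) (f : grHom M N) : grcomp (grid N) f = f.
Proof. exact: grHomP. Qed.
Lemma grcompm1 (M N : fgGrModule) (f : grHom M N) : grcomp f (grid M) = f.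
Proof. exact: grHomP. Qed.
Lemma grcompPl (M N P : fgGrModule) a (g h : grHom N P) (f : grHom M N) :
  grcomp (a *: g + h) f = a *: grcomp g f + grcomp h f.
Proof. exact: grHomP. Qed.
Lemma grcompPr (M N P : fgGrModule) a (h : grHom N P) (f g : grHom M N) :
  grcomp h (a *: f + g) = a *: grcomp h f + grcomp h g.
Proof. by apply: grHomP => m /=; rewrite grfun_linear. Qed.

Definition gr_hom M N : lmodType K := grHom M N.

Definition gr_cat : linCat K :=
  @LinCat K fgGrModule (fun X Y => gr_hom (fg_val X) (fg_val Y))
    (fun X => grid (fg_val X))
    (fun X Y Z => @grcomp (fg_val X) (fg_val Y) (fg_val Z)) grcompA grcomp1m grcompm1 grcompPl grcompPr.

Definition gr_mod (X : gr_cat) : grModule dA := fg_val X.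
Definition gr_app (X Y : gr_cat) (f : hom X Y) : gr_mod X -> gr_mod Y :=
  grfun (f : grHom (fg_val X) (fg_val Y)).

Definition gr_projective (P : gr_cat) :=
  forall (M N : gr_cat) (g : hom M N) (f : hom P N),
    is_surjective (gr_app g) -> exists h : hom P M, g \c h = f.

Definition short_exact (X Y Z : gr_cat) (f : hom X Y) (g : hom Y Z) :=
  [/\ injective (gr_app f), is_surjective (gr_app g)
    & forall y, gr_app g y = 0 <-> exists x, gr_app f x = y].

Lemma grzero_span (m : 'rV[A]_0) : exists (s : seq int) (c : int -> 'rV[A]_0),
  [/\ uniq s, int -> True & m = \sum_(i <- s) c i].
Proof. by exists [::], (fun _ => 0); split=> //; rewrite big_nil [m]thinmx0. Qed.

Definition grzero : grModule dA :=
  @GrModule A dA 'rV[A]_0 (fun _ _ => True) (fun _ => I)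
    (fun _ _ _ _ _ => I) (fun _ _ _ _ _ _ => I)
    grzero_span (fun s c _ _ _ i _ => thinmx0 (c i)).

Lemma grzero_fg : finitely_generated grzero.
Proof.
exists 0, (fun _ => 0) => m; exists (fun _ => 0).
by rewrite big_ord0; apply: (thinmx0 (m : 'rV[A]_0)).
Qed.

Section DirectSum.
Context (M N : grModule dA).

Definition homog_sum i (m : M * N) := homog M i m.1 /\ homog N i m.2.

Lemma homog_sum0 i : homog_sum i 0.
Proof. by split; apply: homog0. Qed.

Lemma homog_sumB i m n : homog_sum i m -> homog_sum i n -> homog_sum i (m - n).
Proof. by case=> ? ? [? ?]; split; apply: homogB. Qed.

Lemma homog_sumZ i j a m : dA i a -> homog_sum j m -> homog_sum (i + j) (a *: m).
Proof. by move=> ? [? ?]; split; apply: homogZ. Qed.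

Lemma sum_pair (s : seq int) (c : int -> (M * N)%type) :
  \sum_(i <- s) c i = (\sum_(i <- s) (c i).1, \sum_(i <- s) (c i).2).
Proof. by elim: s => [|i s IH]; rewrite ?big_nil // !big_cons IH. Qed.

Lemma sum_extend (V : zmodType) (s t : seq int) (c : int -> V) :
  uniq s -> uniq t -> {subset s <= t} ->
  \sum_(i <- t) (if i \in s then c i else 0) = \sum_(i <- s) c i.
Proof.
move=> us ut st; rewrite -big_mkcond -big_filter; apply: perm_big.
apply: uniq_perm => //; first exact: filter_uniq.
by move=> i; rewrite mem_filter; case: (boolP (i \in s)) => // /st ->.
Qed.

Lemma homog_sum_span (m : M * N) :
  exists (s : seq int) (c : int -> (M * N)%type),
    [/\ uniq s, forall i, homog_sum i (c i) & m = \sum_(i <- s) c i].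
Proof.
case: m => m n.
have [s1 [c1 [u1 h1 e1]]] := homog_span m.
have [s2 [c2 [u2 h2 e2]]] := homog_span n.
exists (undup (s1 ++ s2)), (fun i => (if i \in s1 then c1 i else 0,
                                      if i \in s2 then c2 i else 0)).
split; first exact: undup_uniq.
  by move=> i; split=> /=; case: ifP => _ //; apply: homog0.
rewrite sum_pair /= !sum_extend ?undup_uniq // -?e1 -?e2 // => i si.
  by rewrite mem_undup mem_cat si orbT.
by rewrite mem_undup mem_cat si.
Qed.

Lemma homog_sum_free (s : seq int) (c : int -> (M * N)%type) :
  uniq s -> (forall i, homog_sum i (c i)) -> \sum_(i <- s) c i = 0 ->
  forall i, i \in s -> c i = 0.
Proof.
move=> us hc; rewrite sum_pair => -[e1 e2] i si.
rewrite [c i]surjective_pairing.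
rewrite (@homog_free _ _ _ s (fun i => (c i).1) us _ e1 i si); last first.
  by move=> j; case: (hc j).
rewrite (@homog_free _ _ _ s (fun i => (c i).2) us _ e2 i si) // => j.
by case: (hc j).
Qed.

Definition grsum : grModule dA :=
  GrModule homog_sum0 homog_sumB homog_sumZ homog_sum_span homog_sum_free.

Lemma grsum_fg :
  finitely_generated M -> finitely_generated N -> finitely_generated grsum.
Proof.
move=> [p [e he]] [q [d hd]].
exists (p + q)%N, (fun i => match split i with
  | inl j => (e j, 0) | inr j => (0, d j) end) => -[m n].
have [a ->] := he m; have [b ->] := hd n.
exists (fun i => match split i with inl j => a j | inr j => b j end).
rewrite big_split_ord /=.
have sl i : split (lshift q i) = inl i := unsplitK (inl i).
have sr i : split (rshift p i) = inr i := unsplitK (inr i).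
under [X in _ = X + _]eq_bigr => i _ do rewrite sl.
under [X in _ = _ + X]eq_bigr => i _ do rewrite sr.
have -> : \sum_i a i *: ((e i, 0) : M * N) = (\sum_i a i *: e i, 0).
  elim/big_rec2: _ => // i x y _ ->; congr pair; by rewrite /= scaler0 addr0.
have -> : \sum_i b i *: ((0, d i) : M * N) = (0, \sum_i b i *: d i).
  elim/big_rec2: _ => // i x y _ ->; congr pair; by rewrite /= scaler0 addr0.
by congr pair; rewrite /= ?addr0 ?add0r.
Qed.

Lemma grinl_linear : linear (fun m : M => (m, 0) : grsum).
Proof. by move=> a u v; congr pair; rewrite /= scaler0 addr0. Qed.
Lemma grinr_linear : linear (fun n : N => (0, n) : grsum).
Proof. by move=> a u v; congr pair; rewrite /= scaler0 addr0. Qed.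
Lemma grfst_linear : linear (fun x : grsum => x.1 : M). Proof. by []. Qed.
Lemma grsnd_linear : linear (fun x : grsum => x.2 : N). Proof. by []. Qed.

Definition grinl : grHom M grsum :=
  GrHom grinl_linear (fun i m hm => conj hm (homog0 N i)).
Definition grinr : grHom N grsum :=
  GrHom grinr_linear (fun i m hm => conj (homog0 M i) hm).
Definition grfst : grHom grsum M := GrHom grfst_linear (fun i m hm => proj1 hm).
Definition grsnd : grHom grsum N := GrHom grsnd_linear (fun i m hm => proj2 hm).

End DirectSum.

Lemma gr_biproduct (X Y : gr_cat) : exists Z i1 i2 p1 p2,
  @is_biproduct K gr_cat X Y Z i1 i2 p1 p2.
Proof.
exists (FgGrModule (grsum_fg (fg_valP X) (fg_valP Y))).
exists (grinl _ _), (grinr _ _), (grfst _ _), (grsnd _ _).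
split; apply: grHomP. 1-4: by move=> m.
move=> [m n].
by congr pair; rewrite /= ?addr0 ?add0r.
Qed.

Definition factors_projective (X Y : gr_cat) (f : hom X Y) :=
  exists (P : gr_cat) (b : hom P Y) (a : hom X P), gr_projective P /\ f = b \c a.

Lemma factors_projective0 X Y : @factors_projective X Y 0.
Proof.
exists (FgGrModule grzero_fg), 0, 0; split; last by rewrite cmp0m.
move=> U V g f _; exists 0; rewrite cmpm0; apply: grHomP => m.
have -> : m = 0 by apply: (thinmx0 (m : 'rV[A]_0)).
by rewrite !grfun0.
Qed.

Lemma factors_projectiveP X Y k (f g : hom X Y) :
  factors_projective f -> factors_projective g -> factors_projective (k *: f + g).
Proof.
move=> [P [b [a [pP ->]]]] [Q [d [c [pQ ->]]]].
have [S [i1 [i2 [p1 [p2 [e11 e22 e21 e12 eS]]]]]] := gr_biproduct P Q.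
exists S, (k *: (b \c p1) + d \c p2), (i1 \c a + i2 \c c); split; last first.
  rewrite cmpDr !cmpDl !cmpZl -!cmpA !(cmpA p1) !(cmpA p2) e11 e22 e12 e21.
  by rewrite !cmp0m !cmpm0 !cmp1m scaler0 addr0 add0r.
move=> U V h f' sh.
have [h1 e1] := pP U V h (f' \c i1) sh.
have [h2 e2] := pQ U V h (f' \c i2) sh.
by exists (h1 \c p1 + h2 \c p2); rewrite cmpDr !cmpA e1 e2 -!cmpA -cmpDr eS cmpm1.
Qed.

Definition projective_sub X Y : subspace (hom X Y) :=
  Subspace (@factors_projective0 X Y) (@factors_projectiveP X Y).

Lemma projective_subMl (X Y Z : gr_cat) (g : hom Y Z) (f : hom X Y) :
  projective_sub X Y f -> projective_sub X Z (g \c f).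
Proof.
move=> [P [b [a [pP ->]]]]; exists P, (g \c b), a; split=> //; exact: cmpA.
Qed.

Lemma projective_subMr (X Y Z : gr_cat) (g : hom Y Z) (f : hom X Y) :
  projective_sub Y Z g -> projective_sub X Z (g \c f).
Proof.
move=> [P [b [a [pP ->]]]]; exists P, b, (a \c f); split=> //; by rewrite cmpA.
Qed.

Definition projective_ideal : cat_ideal gr_cat :=
  CatIdeal projective_subMl projective_subMr.

End GradedHom.

Section Rings.
Context (K : fieldType) (k : nat).

(* Polynomials in x, modulo x^k, with coefficients in K[y]. *)
Definition ringR := {poly %/ ('X^k : {poly {poly K}})}.
HB.instance Definition _ := GRing.ComNzRing.on ringR.

Definition scaleR (c : K) (r : ringR) : ringR :=
  (c%:P : {poly K}) *: (r : {poly %/ ('X^k : {poly {poly K}})}).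

Lemma scaleRA a b r : scaleR a (scaleR b r) = scaleR (a * b) r.
Proof. by rewrite /scaleR scalerA polyCM. Qed.
Lemma scaleR1 : left_id 1 scaleR.
Proof. by move=> r; rewrite /scaleR scale1r. Qed.
Lemma scaleRDr : right_distributive scaleR +%R.
Proof. by move=> a r s; rewrite /scaleR scalerDr. Qed.
Lemma scaleRDl r : {morph scaleR^~ r : a b / a + b}.
Proof. by move=> a b; rewrite /scaleR polyCD scalerDl. Qed.
HB.instance Definition _ :=
  GRing.Zmodule_isLmodule.Build K ringR scaleRA scaleR1 scaleRDr scaleRDl.

Lemma scaleRAl (a : K) (r s : ringR) : a *: (r * s) = (a *: r) * s.
Proof. exact: (@qpoly_scaleAl {poly K}). Qed.
HB.instance Definition _ := GRing.Lmodule_isLalgebra.Build K ringR scaleRAl.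

Lemma scaleRAr (a : K) (r s : ringR) : a *: (r * s) = r * (a *: s).
Proof. exact: (@qpoly_scaleAr {poly K}). Qed.
HB.instance Definition _ := GRing.Lalgebra_isAlgebra.Build K ringR scaleRAr.

(* deg x = 1 and deg y = -1: only the monomials x^a y^b with a - b = d occur. *)
Definition degR (d : int) (r : ringR) :=
  forall a b : nat, ((r : {poly {poly K}})`_a)`_b != 0 -> d = a%:Z - b%:Z.

Lemma degR_scalar (c : K) : degR 0 c%:A.
Proof.
move=> a b /=; rewrite coefZ coefC.
case: a => [|a]; last by rewrite mulr0 coef0 eqxx.
by rewrite mulr1 coefC; case: b => [|b]; rewrite ?eqxx.
Qed.

(* K[y,1/y], inside the field K(y). *)
Definition laurent_pred : {pred {fraction {poly K}}} := fun f =>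
  `[< exists (n : nat) (p : {poly K}), f * (tofrac 'X) ^+ n = tofrac p >].

Lemma laurent_subring : subring_closed laurent_pred.
Proof.
split.
- by apply/asboolP; exists 0, 1; rewrite mul1r expr0 tofrac1.
- move=> f g /asboolP[n [p fp]] /asboolP[m [q gq]]; apply/asboolP.
  exists (n + m)%N, (p * 'X^m - q * 'X^n).
  rewrite tofracB !tofracM !tofracXn -fp -gq mulrBl exprD mulrA.
  by congr (_ - _); rewrite -mulrA [_ ^+ m * _]mulrC.
- move=> f g /asboolP[n [p fp]] /asboolP[m [q gq]]; apply/asboolP.
  by exists (n + m)%N, (p * q); rewrite tofracM -fp -gq exprD mulrACA.
Qed.

HB.instance Definition _ :=
  GRing.isSubringClosed.Build _ laurent_pred laurent_subring.

Record laurent := Laurent {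
  laurent_val :> {fraction {poly K}};
  laurent_valP : laurent_val \in laurent_pred }.
HB.instance Definition _ := [isSub for laurent_val].
HB.instance Definition _ := [Choice of laurent by <:].
HB.instance Definition _ := [SubChoice_isSubComNzRing of laurent by <:].

Lemma tofrac_laurent (p : {poly K}) : tofrac p \in laurent_pred.
Proof. by apply/asboolP; exists 0, p; rewrite expr0 mulr1. Qed.
Definition to_laurent p := Laurent (tofrac_laurent p).

Lemma to_laurent_zmod : zmod_morphism to_laurent.
Proof. by move=> p q; apply: val_inj; rewrite /= tofracB. Qed.
Lemma to_laurent_monoid : monoid_morphism to_laurent.
Proof. by split=> [|p q]; apply: val_inj; rewrite /= ?tofrac1 ?tofracM. Qed.
HB.instance Definition _ :=
  GRing.isZmodMorphism.Build {poly K} laurent to_laurent to_laurent_zmod.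
HB.instance Definition _ :=
  GRing.isMonoidMorphism.Build {poly K} laurent to_laurent to_laurent_monoid.

Definition ringF := {poly %/ ('X^k : {poly laurent})}.
HB.instance Definition _ := GRing.ComNzRing.on ringF.

(* The coefficient of x^a is a scalar multiple of y^(a-d). *)
Definition degF (d : int) (f : ringF) :=
  forall a : nat, exists c : K,
    laurent_val ((f : {poly laurent})`_a) =
      tofrac c%:P * (tofrac 'X : {fraction {poly K}}) ^ (a%:Z - d).

Definition locR (r : ringR) : ringF :=
  in_qpoly 'X^k (map_poly to_laurent (r : {poly {poly K}})).

Lemma locR_in (p : {poly {poly K}}) :
  locR (in_qpoly 'X^k p) = in_qpoly 'X^k (map_poly to_laurent p).
Proof.
rewrite /locR /=; set h := mk_monic _.
have hm : h \is monic by apply: monic_mk_monic.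
rewrite [in RHS](Pdiv.RingMonic.rdivp_eq hm p).
rewrite rmorphD rmorphM /= in_qpolyD in_qpolyM.
suff -> : in_qpoly 'X^k (map_poly to_laurent h) = 0 by rewrite mulr0 add0r.
rewrite /h mk_monic_Xn map_polyXn -mk_monic_Xn.
by apply: val_inj; rewrite /= Pdiv.RingMonic.rmodpp ?monic_mk_monic.
Qed.

Lemma in_qpolyK (A : comNzRingType) (h : {poly A}) (r : {poly %/ h}) :
  in_qpoly h r = r.
Proof. by apply: val_inj; rewrite /= Pdiv.Ring.rmodp_small // size_mk_monic. Qed.

Lemma locR_zmod : zmod_morphism locR.
Proof. by move=> r s; rewrite /locR !rmorphB. Qed.
Lemma locR_monoid : monoid_morphism locR.
Proof.
split=> [|r s]; first by rewrite -[1](in_qpoly1 _) locR_in !rmorph1.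
by rewrite -[r]in_qpolyK -[s]in_qpolyK -in_qpolyM !locR_in !rmorphM.
Qed.
HB.instance Definition _ :=
  GRing.isZmodMorphism.Build ringR ringF locR locR_zmod.
HB.instance Definition _ :=
  GRing.isMonoidMorphism.Build ringR ringF locR locR_monoid.

Definition grR := gr_cat degR_scalar.

Definition maximal_CM (M : grR) :=
  forall n, ext_succ_eq0 n (gr_mod M) (ringR^o).

(* The grading of T is the tensor product grading because t is a morphism of graded
   modules and T is generated by its image over F. *)
Definition generically_free_rank (M : grR) (n : nat) :=
  exists (T : grModule degF) (t : gr_mod M -> T),
    [/\ is_base_change locR t,
        forall i m, homog (gr_mod M) i m -> homog T i (t m)
      & graded_free n T].

Definition generically_free (M : grR) := exists n, generically_free_rank M n.

Definition MCM0 : linCat K :=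
  full_subcat (fun M : grR => maximal_CM M /\ generically_free M).

Definition MCM0_ideal : cat_ideal MCM0 :=
  @CatIdeal K MCM0
    (fun X Y => projective_sub (full_val X) (full_val Y))
    (fun X Y Z => @projective_subMl K ringR degR degR_scalar _ _ _)
    (fun X Y Z => @projective_subMr K ringR degR degR_scalar _ _ _).

Definition stable_MCM0 : linCat K := quot_cat MCM0_ideal.

Definition stab (X Y : MCM0) (f : hom X Y) : @hom K stable_MCM0 X Y :=
  @quot_map K MCM0 MCM0_ideal X Y f.

(* The triangulation of the stable category of the Frobenius category MCM0: Sigma X is
   the cokernel of a chosen embedding of X in a projective(-injective) object I X, and
   the distinguished triangles are those isomorphic to some X -> Y -> Z -> Sigma X
   where Z is the pushout of X -> Y along X -> I X, and Z -> Sigma X is zero on Y and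
   the projection on I X. *)
Definition is_stable_triangulation (T : triangulation stable_MCM0) :=
  exists (I : MCM0 -> MCM0) (i : forall X : MCM0, hom X (I X))
      (p : forall X : MCM0, @hom K MCM0 (I X) (susp T X)),
    [/\ forall X, gr_projective (full_val (I X)) /\
          @short_exact K ringR degR degR_scalar _ _ _ (i X) (p X),
        forall (X Y : MCM0) (f : hom X Y),
          exists (g : hom (I X) (I Y)) (h : @hom K MCM0 (susp T X) (susp T Y)),
            [/\ g \c i X = i Y \c f, h \c p X = p Y \c g
              & fmap (susp T) (stab f) = stab h]
      & forall (X Y Z : stable_MCM0)
            (u : hom X Y) (v : hom Y Z) (w : hom Z (susp T X)),
          dist T u v w <->
          exists (X' Y' Z' : MCM0) (u' : hom X' Y') (v' : hom Y' Z')
              (q : hom (I X') Z') (w' : @hom K MCM0 Z' (susp T X')),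
            [/\ is_pushout (i X') u' q v', w' \c v' = 0, w' \c q = p X'
              & triangle_iso (S := susp T) (stab u') (stab v') (stab w') u v w]].

End Rings.

(* Main.v *)
From HB Require Import structures.
From mathcomp Require Import all_boot all_order all_algebra.
From mathcomp Require Import zify ring.
From mathcomp Require Import boolp functions reals complex.
Require Import Defs.

Set Implicit Arguments.
Unset Strict Implicit.
Unset Printing Implicit Defensive.

Import Order.TTheory GRing.Theory Num.Theory.
Local Open Scope ring_scope.

(* Write K = C and B = K[y]. A graded maximal Cohen-Macaulay R-module M is free over B:
   Ext^1(M, R) = 0 makes y injective on M, and graded Nakayama gives a homogeneous
   basis. So M is a nilpotent matrix X over K (X^k = 0) together with the degrees of
   the basis vectors, which bound the degrees of the admissible matrices from one side.
   M is generically free iff some matrix e, of unrestricted degree, has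
   N(e) := \sum_j X^j e X^(k-1-j) = 1, and a map factors through a projective iff it
   is N(s) for a matrix s of admissible degree.

   The embedding of M into k shifted copies of its underlying B-module (the cofree
   object, which is also free) gives the Frobenius structure. Its cokernel S M embeds
   again in the same object, shifted, with quotient M(k); hence Sigma^2 is the shift
   by k. The Serre pairing of f : M -> M' and h : M' -> M(k) is tr(h f e), e being the
   unit matrix of M: it vanishes on null maps because tr(N(s) m) = tr(s N(m)), and the
   same identity turns its nondegeneracy into the solvability criterion of a finite
   linear system for s. *)

(** * The triangulation of a stable category *)

(** Inverting y, of degree -1, reduces a graded module to its degree 0 part, a module over
    K[X]/(X^k) with X = xy. This is why one matrix over K suffices, and N(e) = 1 is Higman's
    criterion for that module to be projective over the Frobenius algebra K[X]/(X^k), hence free.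
    The powers of y in a map are forced by the degrees of the basis vectors; all that is left of
    K[y] is that these exponents are nonnegative, a set of inequalities on entries.

    The Serre functor is the same shift as Sigma^2 because deg x + deg y = 0. The norm contains k -
    1 factors X of degree 1. Dualizing the inequalities for s under the trace negates them, and over
    the integers this costs one more unit, so the dual maps have degree k.

    The suspension is defined through a chosen matrix model of each object, and the model chosen for
    Sigma X need not be the one from which Sigma X was built. So Sigma^2 X is only isomorphic to the
    shift of X, through a map that is natural up to null maps. A map into the shift is handled as a
    matrix of degree k. *)

Section LinCatTheory.
Context (K : fieldType) (C : linCat K).
Implicit Types X Y Z : C.

Lemma cmpNl X Y Z (g : hom Y Z) (f : hom X Y) : (- g) \c f = - (g \c f).
Proof. by rewrite -scaleN1r cmpZl scaleN1r. Qed.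

Lemma cmpNr X Y Z (g : hom Y Z) (f : hom X Y) : g \c (- f) = - (g \c f).
Proof. by rewrite -scaleN1r cmpZr scaleN1r. Qed.

Lemma cmpBl X Y Z (g h : hom Y Z) (f : hom X Y) : (g - h) \c f = g \c f - h \c f.
Proof. by rewrite cmpDl cmpNl. Qed.

Lemma cmpBr X Y Z (h : hom Y Z) (f g : hom X Y) : h \c (f - g) = h \c f - h \c g.
Proof. by rewrite cmpDr cmpNr. Qed.

Lemma is_iso_id X : is_iso (idm X).
Proof. by exists (idm X); rewrite cmp1m. Qed.

Lemma is_iso_cmp X Y Z (g : hom Y Z) (f : hom X Y) :
  is_iso g -> is_iso f -> is_iso (g \c f).
Proof.
move=> [g' [g1 g2]] [f' [f1 f2]]; exists (f' \c g').
by rewrite !cmpA -[_ \c g' \c _]cmpA g1 cmpm1 f1 -[_ \c f \c _]cmpA f2 cmpm1 g2.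
Qed.

(* If (e - 1)^2 = 0 then 2 - e is inverse to e. *)
Lemma unipotent_iso X (e : hom X X) :
  (e - idm X) \c (e - idm X) = 0 -> exists e', e' \c e = idm X /\ e \c e' = idm X.
Proof.
move: (e - idm X) (subrK (idm X) e) => n <- n2; exists (idm X - n).
by rewrite cmpBl cmpBr !cmpDl !cmpDr n2 !cmpm1 !cmp1m add0r [n + _]addrC addrK.
Qed.

End LinCatTheory.

Section LinFunctorTheory.
Context (K : fieldType) (C D : linCat K) (F : linFunctor C D).

Lemma fmap_iso (X Y : C) (f : hom X Y) : is_iso f -> is_iso (fmap F f).
Proof. by move=> [g [e1 e2]]; exists (fmap F g); rewrite -!fmapM e1 e2 !fmap1. Qed.

End LinFunctorTheory.

Section TriangleIso.
Context (K : fieldType) (C : linCat K) (S : linFunctor C C).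

Lemma triangle_iso_refl (X Y Z : C) (u : hom X Y) (v : hom Y Z) (w : hom Z (S X)) :
  triangle_iso u v w u v w.
Proof.
exists (idm X), (idm Y), (idm Z); split; first by split; apply: is_iso_id.
by rewrite fmap1 !cmp1m !cmpm1.
Qed.

Lemma triangle_iso_trans (X Y Z X' Y' Z' X2 Y2 Z2 : C)
    (u : hom X Y) (v : hom Y Z) (w : hom Z (S X))
    (u' : hom X' Y') (v' : hom Y' Z') (w' : hom Z' (S X'))
    (u2 : hom X2 Y2) (v2 : hom Y2 Z2) (w2 : hom Z2 (S X2)) :
  triangle_iso u v w u' v' w' -> triangle_iso u' v' w' u2 v2 w2 ->
  triangle_iso u v w u2 v2 w2.
Proof.
move=> [a [b [c [[ia ib ic] [e1 e2 e3]]]]] [a' [b' [c' [[ia' ib' ic'] [e1' e2' e3']]]]].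
exists (a' \c a), (b' \c b), (c' \c c); split; first by split; apply: is_iso_cmp.
split; first by rewrite -cmpA e1 !cmpA e1'.
  by rewrite -cmpA e2 !cmpA e2'.
by rewrite fmapM -cmpA e3 !cmpA e3'.
Qed.

Lemma triangle_isoE (X Y Z X' Y' Z' : C)
    (u : hom X Y) (v : hom Y Z) (w : hom Z (S X))
    (u' : hom X' Y') (v' : hom Y' Z') (w' : hom Z' (S X')) :
  triangle_iso u v w u' v' w' ->
  exists a b c a' b' c',
    [/\ a' \c a = idm X /\ a \c a' = idm X', b' \c b = idm Y /\ b \c b' = idm Y',
        c' \c c = idm Z /\ c \c c' = idm Z'
      & [/\ b \c u = u' \c a, c \c v = v' \c b & fmap S a \c w = w' \c c] /\
        [/\ b' \c u' = u \c a', c' \c v' = v \c b' & fmap S a' \c w' = w \c c']].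
Proof.
move=> [a [b [c [[[a' [a1 a2]] [b' [b1 b2]] [c' [c1 c2]]] [e1 e2 e3]]]]].
exists a, b, c, a', b', c'; do !split=> //.
- by rewrite -[u']cmpm1 -a2 [u' \c _]cmpA -e1 !cmpA b1 cmp1m.
- by rewrite -[v']cmpm1 -b2 [v' \c _]cmpA -e2 !cmpA c1 cmp1m.
- by rewrite -[w']cmpm1 -c2 [w' \c _]cmpA -e3 !cmpA -fmapM a1 fmap1 cmp1m.
Qed.

Lemma triangle_iso_sym (X Y Z X' Y' Z' : C)
    (u : hom X Y) (v : hom Y Z) (w : hom Z (S X))
    (u' : hom X' Y') (v' : hom Y' Z') (w' : hom Z' (S X')) :
  triangle_iso u v w u' v' w' -> triangle_iso u' v' w' u v w.
Proof.
move=> /triangle_isoE [a [b [c [a' [b' [c' [[? ?] [? ?] [? ?] [_ [? ? ?]]]]]]]]].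
by exists a', b', c'; split=> //; split; [exists a | exists b | exists c].
Qed.

End TriangleIso.

Section StableTriangulation.
Context (K : fieldType) (C : linCat K) (J : cat_ideal C).
Local Notation D := (quot_cat J).
Local Notation "f '\inJ'" := (in_ideal J _ _ f) (at level 70).
Implicit Types X Y Z T : C.

Definition qm X Y (f : hom X Y) : @hom K D X Y := quot_map J f.

Lemma qmP X Y (f g : hom X Y) : qm f = qm g <-> (f - g) \inJ.
Proof. exact: quot_mapP. Qed.

Lemma qm_eq0 X Y (f : hom X Y) : qm f = 0 <-> f \inJ.
Proof. by have := qmP f 0; rewrite subr0. Qed.

Lemma qmM X Y Z (g : hom Y Z) (f : hom X Y) : qm (g \c f) = qm g \c qm f.
Proof. by rewrite /qm -quot_cmpE. Qed.

Lemma qm_lin X Y a (f g : hom X Y) : qm (a *: f + g) = a *: qm f + qm g.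
Proof. exact: quot_map_linear. Qed.

Lemma qm_id X : qm (idm X) = idm (X : D). Proof. by []. Qed.

Lemma qm0 X Y : qm (0 : hom X Y) = 0. Proof. by []. Qed.

Lemma qmD X Y (f g : hom X Y) : qm (f + g) = qm f + qm g.
Proof. by have := qm_lin 1 f g; rewrite !scale1r. Qed.

Lemma qmN X Y (f : hom X Y) : qm (- f) = - qm f.
Proof. by have := qm_lin (-1) f 0; rewrite qm0 !addr0 !scaleN1r. Qed.

Lemma qmW X Y (F : @hom K D X Y) : exists f, F = qm f.
Proof. by elim/quot_mapW: F => f; exists f. Qed.

(* The part of the Frobenius structure that the triangulation needs: for each X a
   sequence X -> I X -> S X which is a kernel-cokernel pair, with I X relatively
   injective and projective, and pushouts along i X. *)
Record frobenius_data (I S : C -> C) (i : forall X, hom X (I X))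
    (p : forall X, hom (I X) (S X)) : Prop := FrobeniusData {
  fr_pi : forall X, p X \c i X = 0;
  fr_mono : forall T X (f : hom T X), i X \c f = 0 -> f = 0;
  fr_ker : forall T X (f : hom T (I X)), p X \c f = 0 -> exists g, f = i X \c g;
  fr_epi : forall T X (f : hom (S X) T), f \c p X = 0 -> f = 0;
  fr_coker : forall T X (f : hom (I X) T), f \c i X = 0 -> exists g, f = g \c p X;
  fr_inj : forall X, idm (I X) \inJ;
  fr_ext : forall X T (f : hom X T), f \inJ -> exists g, f = g \c i X;
  fr_lift : forall X T (f : hom T (S X)), f \inJ -> exists g, f = p X \c g;
  fr_push : forall X Y (u : hom X Y), exists Z q (v : hom Y Z), is_pushout (i X) u q v;
  fr_add : additive_cat C;
  fr_surj : forall Y : D, exists X : C, @isomorphic K D (S X) Y }.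

Context (I S : C -> C) (i : forall X, hom X (I X)) (p : forall X, hom (I X) (S X)).
Hypothesis fr : frobenius_data i p.

Lemma fr_mono_eq T X (f g : hom T X) : i X \c f = i X \c g -> f = g.
Proof. by move=> e; apply/subr0_eq/(fr_mono fr); rewrite cmpBr e subrr. Qed.

Lemma fr_epi_eq T X (f g : hom (S X) T) : f \c p X = g \c p X -> f = g.
Proof. by move=> e; apply/subr0_eq/(fr_epi fr); rewrite cmpBl e subrr. Qed.

Lemma to_inj X T (f : hom T (I X)) : f \inJ.
Proof. by rewrite -[f]cmp1m; apply: idealMr; apply: (fr_inj fr). Qed.

Lemma from_inj X T (f : hom (I X) T) : f \inJ.
Proof. by rewrite -[f]cmpm1; apply: idealMl; apply: (fr_inj fr). Qed.

Lemma factor_inj X Y T (g : hom (I X) Y) (f : hom T (I X)) : (g \c f) \inJ.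
Proof. exact/idealMl/to_inj. Qed.

Definition sig X Y (f : hom X Y) (h : hom (S X) (S Y)) :=
  exists g : hom (I X) (I Y), g \c i X = i Y \c f /\ h \c p X = p Y \c g.

Lemma sig_ex X Y (f : hom X Y) : exists h, sig f h.
Proof.
have [g eg] := fr_ext fr (to_inj (i Y \c f)).
have : (p Y \c g) \c i X = 0 by rewrite -cmpA -eg cmpA (fr_pi fr) cmp0m.
by move=> /(fr_coker fr) [h eh]; exists h, g.
Qed.

(** Two lifts to the hulls differ, after correction by an extension of the null map, by a map that
    vanishes on [i X] and so descends to [S X]; the converse is the dual argument. Left to right
    makes the suspension well defined on stable morphisms, right to left makes it faithful. *)
Lemma sigJ X Y (f f' : hom X Y) h h' :
  sig f h -> sig f' h' -> (f - f') \inJ <-> (h - h') \inJ.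
Proof.
move=> [g [g1 g2]] [g' [g1' g2']]; split=> [/(fr_ext fr)|/(fr_lift fr)] [e ee].
- have : (g - g' - i Y \c e) \c i X = 0.
    by rewrite !cmpBl g1 g1' -!cmpA -ee cmpBr subrr.
  move=> /(fr_coker fr) [a ea].
  suff -> : h - h' = p Y \c a by apply: idealMl (to_inj _).
  apply: fr_epi_eq; rewrite cmpBl g2 g2' -cmpA -ea !cmpBr cmpA (fr_pi fr).
  by rewrite cmp0m subr0.
have : p Y \c (g - g' - e \c p X) = 0.
  by rewrite !cmpBr cmpA -ee cmpBl -g2 -g2' subrr.
move=> /(fr_ker fr) [a ea].
suff -> : f - f' = a \c i X by apply: idealMl (to_inj _).
apply: fr_mono_eq; rewrite cmpBr -g1 -g1' cmpA -ea !cmpBl -cmpA.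
by rewrite (fr_pi fr) cmpm0 subr0.
Qed.

(** Here the hull [I X] acts as a projective: every map out of it lies in the ideal, hence lifts
    along [p Y]. *)
Lemma sig_full X Y (h : hom (S X) (S Y)) : exists f, sig f h.
Proof.
have [g eg] := fr_lift fr (from_inj (h \c p X)).
have : p Y \c (g \c i X) = 0 by rewrite cmpA -eg -cmpA (fr_pi fr) cmpm0.
by move=> /(fr_ker fr) [f ef]; exists f, g.
Qed.

Lemma sig_id X : sig (idm X) (idm (S X)).
Proof. by exists (idm _); rewrite !cmp1m !cmpm1. Qed.

Lemma sigM X Y Z (f : hom X Y) (f' : hom Y Z) h h' :
  sig f h -> sig f' h' -> sig (f' \c f) (h' \c h).
Proof.
move=> [g [g1 g2]] [g' [g1' g2']]; exists (g' \c g).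
by rewrite -cmpA g1 !cmpA g1' -[_ \c h \c _]cmpA g2 !cmpA g2'.
Qed.

Lemma sig_lin X Y a (f f' : hom X Y) h h' :
  sig f h -> sig f' h' -> sig (a *: f + f') (a *: h + h').
Proof.
move=> [g [g1 g2]] [g' [g1' g2']]; exists (a *: g + g').
by rewrite !cmpPl !cmpPr g1 g1' g2 g2'.
Qed.

Definition sigm X Y (f : hom X Y) : hom (S X) (S Y) := projT1 (cid (sig_ex f)).
Lemma sigmP X Y (f : hom X Y) : sig f (sigm f). Proof. exact: projT2 (cid _). Qed.

Definition qsig (X Y : D) (F : hom X Y) : @hom K D (S X) (S Y) :=
  qm (sigm (projT1 (cid (qmW F)))).

Lemma qsigE X Y (f : hom X Y) h : sig f h -> qsig (qm f) = qm h.
Proof.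
move=> fh; rewrite /qsig; case: (cid (qmW (qm f))) => f' /= e.
by apply/qmP; rewrite -(sigJ (sigmP f') fh); apply/qmP.
Qed.

Lemma qsig1 (X : D) : qsig (idm X) = idm (S X : D).
Proof. exact: (qsigE (sig_id X)). Qed.

Lemma qsigM (X Y Z : D) (g : hom Y Z) (f : hom X Y) :
  qsig (g \c f) = qsig g \c qsig f.
Proof.
have [f' ->] := qmW f; have [g' ->] := qmW g; rewrite -qmM.
rewrite (qsigE (sigmP f')) (qsigE (sigmP g')) -qmM.
by apply/qsigE/sigM; apply: sigmP.
Qed.

Lemma qsigP (X Y : D) a (f g : hom X Y) : qsig (a *: f + g) = a *: qsig f + qsig g.
Proof.
have [f' ->] := qmW f; have [g' ->] := qmW g; rewrite -qm_lin.
rewrite (qsigE (sigmP f')) (qsigE (sigmP g')) -qm_lin.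
by apply/qsigE/sig_lin; apply: sigmP.
Qed.

Definition stable_susp : linFunctor D D :=
  @LinFunctor K D D S qsig qsig1 qsigM qsigP.

Lemma stable_suspE X Y (f : hom X Y) h : sig f h -> fmap stable_susp (qm f) = qm h.
Proof. exact: qsigE. Qed.

Lemma stable_susp_inj (X Y : D) : injective (@fmap K D D stable_susp X Y).
Proof.
move=> f g; have [f' ->] := qmW f; have [g' ->] := qmW g.
rewrite (stable_suspE (sigmP f')) (stable_suspE (sigmP g')) => /qmP.
by rewrite -(sigJ (sigmP f') (sigmP g')) => /qmP.
Qed.

Lemma stable_susp_full (X Y : D) (h : @hom K D (S X) (S Y)) :
  exists f : hom X Y, fmap stable_susp f = h.
Proof.
have [h' ->] := qmW h; have [f s] := sig_full h'.
by exists (qm f); apply: stable_suspE.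
Qed.

Lemma stable_susp_auto : autoequivalence stable_susp.
Proof.
split=> [X Y|Y]; last exact: (fr_surj fr).
pose g h := projT1 (cid (@stable_susp_full X Y h)).
have gK h : fmap stable_susp (g h) = h.
  by exact: projT2 (cid (@stable_susp_full X Y h)).
by exists g => // f; apply: stable_susp_inj; rewrite gK.
Qed.

Lemma stable_susp_iso_refl (X Y : D) (f : hom X Y) :
  is_iso (fmap stable_susp f) -> is_iso f.
Proof.
move=> [h [h1 h2]]; have [g e] := stable_susp_full h; exists g.
by split; apply: stable_susp_inj; rewrite fmapM e fmap1.
Qed.

Definition stable_dist (X Y Z : D) (u : hom X Y) (v : hom Y Z)
    (w : hom Z (stable_susp X)) : Prop :=
  exists (X' Y' Z' : C) (u' : hom X' Y') (v' : hom Y' Z')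
     (q : hom (I X') Z') (w' : hom Z' (S X')),
    [/\ is_pushout (i X') u' q v', w' \c v' = 0, w' \c q = p X'
      & triangle_iso (S := stable_susp) (qm u') (qm v') (qm w') u v w].

Definition stable_triang : triangulation D :=
  @Triangulation K D stable_susp stable_dist.

Definition cone X Y Z (u : hom X Y) (q : hom (I X) Z) (v : hom Y Z) (w : hom Z (S X)) :=
  [/\ is_pushout (i X) u q v, w \c v = 0 & w \c q = p X].

Lemma cone_ex X Y (u : hom X Y) : exists Z q v w, @cone X Y Z u q v w.
Proof.
have [Z [q [v po]]] := fr_push fr u; exists Z, q, v.
have [w [[e1 e2] _]] : exists! w : hom Z (S X), w \c q = p X /\ w \c v = 0.
  by case: po => _; apply; rewrite (fr_pi fr) cmp0m.
by exists w.
Qed.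

Lemma push_eq X Y Z (u : hom X Y) (q : hom (I X) Z) (v : hom Y Z) T (f g : hom Z T) :
  is_pushout (i X) u q v -> f \c q = g \c q -> f \c v = g \c v -> f = g.
Proof.
move=> [e /(_ T (g \c q) (g \c v))]; rewrite -!cmpA e => /(_ erefl) [h [_ u1]] e1 e2.
by rewrite -(u1 f) // -(u1 g).
Qed.

Lemma push_map X Y Z (u : hom X Y) (q : hom (I X) Z) (v : hom Y Z) T
    (q' : hom (I X) T) (v' : hom Y T) :
  is_pushout (i X) u q v -> q' \c i X = v' \c u ->
  exists f, f \c q = q' /\ f \c v = v'.
Proof. by move=> [_ /(_ T q' v')] h /h [f [? _]]; exists f. Qed.

Lemma cone_dist X Y Z (u : hom X Y) q (v : hom Y Z) w :
  cone u q v w -> stable_dist (qm u) (qm v) (qm w).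
Proof.
by case=> *; exists X, Y, Z, u, v, q, w; split => //; apply: triangle_iso_refl.
Qed.

Lemma dist_cone (X Y Z : D) (u : hom X Y) v (w : hom Z (S X)) :
  stable_dist u v w -> exists (X' Y' Z' : C) (u' : hom X' Y') q (v' : hom Y' Z') w',
    cone u' q v' w' /\ triangle_iso (S := stable_susp) (qm u') (qm v') (qm w') u v w.
Proof.
by move=> [X' [Y' [Z' [u' [v' [q [w' [? ? ? ?]]]]]]]]; exists X', Y', Z', u', q, v', w'.
Qed.

Lemma dist_iso (X Y Z X' Y' Z' : D)
      (u : hom X Y) (v : hom Y Z) (w : hom Z (stable_susp X))
      (u' : hom X' Y') (v' : hom Y' Z') (w' : hom Z' (stable_susp X')) :
  triangle_iso u v w u' v' w' -> stable_dist u v w -> stable_dist u' v' w'.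
Proof.
move=> t [A [B [E [a [b [q [c [? ? ? t']]]]]]]]; exists A, B, E, a, b, q, c; split=> //.
exact: triangle_iso_trans t' t.
Qed.

(** The null map [f \c v] extends over [I Y]. Subtracting this extension, composed with a map
    [Z -> I Y] that extends [i Y], makes [f] vanish strictly on [Y], and what is left factors
    strictly through [w]. *)
Lemma cone_wcoker X Y Z (u : hom X Y) q (v : hom Y Z) w T (f : hom Z T) :
  cone u q v w -> (f \c v) \inJ -> exists h, (f - h \c w) \inJ.
Proof.
move=> [po wv wq] /(fr_ext fr) [phi ephi].
have [g eg] := fr_ext fr (to_inj (i Y \c u)).
have [m [mq mv]] := push_map po (esym eg).
have fv : (f - phi \c m) \c v = 0 by rewrite cmpBl -cmpA mv ephi subrr.
have : (f - phi \c m) \c q \c i X = 0 by rewrite -cmpA po.1 cmpA fv cmp0m.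
move=> /(fr_coker fr) [h eh]; exists h.
have -> : f - h \c w = phi \c m; last exact: factor_inj.
apply/eqP; rewrite subr_eq addrC -subr_eq; apply/eqP.
by apply: (push_eq po); rewrite ?fv ?eh -cmpA ?wv ?wq ?cmpm0.
Qed.

Lemma dist_wcoker (X Y Z T : D) (u : hom X Y) (v : hom Y Z) (w : hom Z (stable_susp X))
   (f : hom Z T) : stable_dist u v w -> f \c v = 0 -> exists h, f = h \c w.
Proof.
move=> /dist_cone [X' [Y' [Z' [u' [q [v' [w' [cn]]]]]]]].
move=> /triangle_iso_sym [a [b [c [[_ [b' [b1 b2]] [c' [c1 c2]]] [e1 e2 e3]]]]] fv.
have [f' ef] := qmW (f \c c').
have : (f' \c v') \inJ.
  apply/qm_eq0; rewrite qmM -ef -[qm v']cmpm1 -b2 [qm v' \c _]cmpA -e2.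
  by rewrite !cmpA -[f \c c' \c c]cmpA c1 cmpm1 fv cmp0m.
move=> /(cone_wcoker cn) [h /qmP eh]; exists (qm h \c fmap stable_susp a).
by rewrite -cmpA e3 cmpA -qmM -eh -ef -cmpA c1 cmpm1.
Qed.

(** The square commutes only up to a null map; its extension [kap] to [I X] is added to the
    component of [c] on the hull, so that [c] is a strict map out of the pushout. *)
Lemma cone_map X Y Z X' Y' Z' (u : hom X Y) q (v : hom Y Z) w
   (u' : hom X' Y') q' (v' : hom Y' Z') w' (a : hom X X') (b : hom Y Y') :
  cone u q v w -> cone u' q' v' w' -> (b \c u - u' \c a) \inJ ->
  exists c : hom Z Z', [/\ c \c v = v' \c b &
    fmap stable_susp (qm a) \c (qm w : @hom K D Z (stable_susp X)) =
      (qm w' : @hom K D Z' (stable_susp X')) \c qm c].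
Proof.
move=> [po wv wq] [po' wv' wq'] /(fr_ext fr) [kap ek].
have [h [g [g1 g2]]] := sig_ex a.
have [|c [c1 c2]] := @push_map _ _ _ _ _ _ _ (q' \c g + v' \c kap) (v' \c b) po.
  rewrite cmpDl -!cmpA g1 -ek cmpBr !cmpA po'.1 addrC.
  by rewrite -[_ \c b \c _]cmpA subrK.
exists c; split=> //.
have -> : fmap stable_susp (qm a) = qm h by apply: stable_suspE; exists g.
rewrite -[LHS]qmM -[RHS]qmM; congr qm.
apply: (push_eq po); rewrite -!cmpA ?c1 ?c2 ?wv ?wq.
  by rewrite cmpDr !cmpA wv' wq' cmp0m addr0.
by rewrite cmpA wv' cmp0m cmpm0.
Qed.

Lemma dist_map (X Y Z X' Y' Z' : D)
      (u : hom X Y) (v : hom Y Z) (w : hom Z (stable_susp X))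
      (u' : hom X' Y') (v' : hom Y' Z') (w' : hom Z' (stable_susp X'))
      (a : hom X X') (b : hom Y Y') :
    stable_dist u v w -> stable_dist u' v' w' -> b \c u = u' \c a ->
    exists c : hom Z Z', c \c v = v' \c b /\ fmap stable_susp a \c w = w' \c c.
Proof.
move=> /dist_cone [A [B [E [x [q [y [z [cn t]]]]]]]].
move=> /dist_cone [A' [B' [E' [x' [q' [y' [z' [cn' t']]]]]]]] eab.
have [a1 [b1 [c1 [a1' [b1' [c1' [[_ aK] [_ bK] [_ cK] [[e1 _ _] [_ f2 f3]]]]]]]]] :=
  triangle_isoE t.
have [a2 [b2 [c2 [a2' [b2' [c2' [[_ aK'] [_ bK'] [_ cK'] [[_ e2 e3] [f1 _ _]]]]]]]]] :=
  triangle_isoE t'.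
have [a0 ea] := qmW (a2' \c a \c a1); have [b0 eb] := qmW (b2' \c b \c b1).
have : (b0 \c x - x' \c a0) \inJ.
  apply/qmP; rewrite !qmM -ea -eb -cmpA e1 !cmpA -[b2' \c b \c u]cmpA eab.
  by rewrite !cmpA f1.
move=> /(cone_map cn cn') [c0 [ec ew]].
exists (c2 \c qm c0 \c c1'); split.
  rewrite -cmpA f2 -!cmpA [qm c0 \c _]cmpA -qmM ec qmM -eb !cmpA e2.
  rewrite -[v' \c b2 \c b2']cmpA bK' cmpm1 -!cmpA bK cmpm1 //.
rewrite !cmpA -e3 -[_ \c qm z' \c qm c0]cmpA -ew -ea.
rewrite -!cmpA -f3 !cmpA -!fmapM !cmpA aK' cmp1m -[a \c _ \c _]cmpA aK cmpm1 //.
Qed.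

(** This replaces a five lemma: a self-map of a triangle that is the identity on [X] and [Y] differs
    from the identity by a map of square zero, so it is invertible. *)
Lemma dist_unique (X Y Z Z1 : D) (u : hom X Y)
    (v : hom Y Z) (w : hom Z (stable_susp X))
    (v1 : hom Y Z1) (w1 : hom Z1 (stable_susp X)) :
  stable_dist u v w -> stable_dist u v1 w1 ->
  exists c c', [/\ c' \c c = idm Z, c \c c' = idm Z1, c \c v = v1 & w1 \c c = w].
Proof.
have key (Z2 Z3 : D) (v2 : hom Y Z2) (w2 : hom Z2 (stable_susp X))
    (v3 : hom Y Z3) (w3 : hom Z3 (stable_susp X)) :
    stable_dist u v2 w2 -> stable_dist u v3 w3 ->
    exists c, [/\ c \c v2 = v3, w3 \c c = w2 & exists c', c' \c c = idm Z2].
  move=> d2 d3.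
  have [|c [e1 e2]] := @dist_map _ _ _ _ _ _ _ _ _ _ _ _ (idm X) (idm Y) d2 d3.
    by rewrite cmp1m cmpm1.
  have [|c' [e1' e2']] := @dist_map _ _ _ _ _ _ _ _ _ _ _ _ (idm X) (idm Y) d3 d2.
    by rewrite cmp1m cmpm1.
  rewrite fmap1 cmp1m cmpm1 in e1 e2; rewrite fmap1 cmp1m cmpm1 in e1' e2'.
  exists c; split=> //.
  (* The difference kills [v2], hence is [h \c w2]; and [w2] kills the difference, so its square is
     zero. *)
  have [|h eh] := dist_wcoker (f := c' \c c - idm Z2) d2.
    by rewrite cmpBl -cmpA e1 e1' cmp1m subrr.
  have [|e [ee _]] := @unipotent_iso _ _ _ (c' \c c).
    by rewrite [X in X \c _]eh -cmpA cmpBr cmpA -e2' -e2 cmpm1 subrr cmpm0.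
  by exists (e \c c'); rewrite -cmpA.
move=> d d1; have [c [e1 e2 [c' ec']]] := key _ _ _ _ _ _ d d1.
have [b [e1' e2' [b' eb']]] := key _ _ _ _ _ _ d1 d.
(* [key] provides left inverses only; a right inverse of [c] is [b \c e], obtained from the
   unipotent map [c \c b]. *)
have [|e [_ ee]] := @unipotent_iso _ _ _ (c \c b).
  have [|k ek] := dist_wcoker (f := c \c b - idm Z1) d1.
    by rewrite cmpBl -cmpA e1' e1 cmp1m subrr.
  by rewrite [X in X \c _]ek -cmpA cmpBr cmpA e2 e2' cmpm1 subrr cmpm0.
exists c, c'; split=> //.
have -> : c' = b \c e by rewrite -[c']cmpm1 -ee -!cmpA [c' \c _]cmpA ec' cmp1m.
by rewrite cmpA.
Qed.

Lemma dist_of_unique (X Y Z Z1 : D) (u : hom X Y)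
    (v : hom Y Z) (w : hom Z (stable_susp X))
    (v1 : hom Y Z1) (w1 : hom Z1 (stable_susp X)) (c : hom Z Z1) :
  is_iso c -> c \c v = v1 -> w1 \c c = w ->
  stable_dist u v w -> stable_dist u v1 w1.
Proof.
move=> ic e1 e2; apply: dist_iso; exists (idm X), (idm Y), c.
split; first by split=> //; apply: is_iso_id.
by rewrite fmap1 !cmp1m !cmpm1.
Qed.

(** The cone of [v] is compared with [S X]: the maps [z] and [c] are inverse to each other up to a
    map through [I Y], which is null. *)
Lemma cone_rotate X Y Z (u : hom X Y) q (v : hom Y Z) w h : cone u q v w -> sig u h ->
  stable_dist (qm v) (qm w : @hom K D Z (stable_susp X)) (- fmap stable_susp (qm u)).
Proof.
move=> [po wv wq] sh; rewrite (stable_suspE sh); case: sh => [g [g1 g2]].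
have [Z2 [b [a [w2 [po2 wa wb]]]]] := cone_ex v.
(* The two maps from [I X] to the cone of [v], one through [Z] and one through [I Y], agree on [X],
   so their difference descends to [S X]. The second one enters with a minus, which is the source of
   the sign in the rotated triangle. *)
have : (a \c q - b \c g) \c i X = 0.
  by rewrite cmpBl -!cmpA po.1 g1 !cmpA po2.1 subrr.
move=> /(fr_coker fr) [z ez].
have [|c [cb ca]] := @push_map _ _ _ _ _ _ _ 0 w po2; first by rewrite wv cmp0m.
have [|m [mq mv]] := @push_map _ _ _ _ _ _ _ g (i Y) po; first by rewrite g1.
have [|m' [mb ma]] := @push_map _ _ _ _ _ _ _ (idm _) m po2.
  by rewrite cmp1m mv.
have cz : c \c z = idm _.
  apply: fr_epi_eq; rewrite -cmpA -ez cmpBr !cmpA ca cb cmp0m subr0 wq.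
  by rewrite cmp1m.
have wz : w2 \c z = - h.
  apply: fr_epi_eq; rewrite -cmpA -ez cmpBr !cmpA wa wb cmp0m sub0r.
  by rewrite cmpNl g2.
have zc : idm _ - z \c c = b \c m'.
  apply: (push_eq po2); rewrite cmpBl cmp1m -!cmpA ?cb ?ca ?cmpm0 ?subr0 ?mb ?ma ?cmpm1 //.
  apply: (push_eq po); rewrite cmpBl -!cmpA.
    by rewrite wq mq -ez opprB addrC subrK.
  by rewrite wv cmpm0 subr0 mv po2.1.
have zcJ : (idm _ - z \c c) \inJ by rewrite zc; apply: factor_inj.
apply: (@dist_of_unique _ _ _ _ _ (qm a) (qm w2) _ _ (qm c)).
- exists (qm z); rewrite -!qmM cz; split=> //.
  by apply/esym/qmP.
- by rewrite -qmM ca.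
- rewrite -qmN -wz -[LHS]qmM; apply/esym/qmP.
  by rewrite -cmpA -{1}[w2]cmpm1 -cmpBr; apply: idealMl.
exact: (cone_dist (And3 po2 wa wb)).
Qed.

Lemma dist_rotate (X Y Z : D) (u : hom X Y) (v : hom Y Z) (w : hom Z (stable_susp X)) :
  stable_dist u v w -> stable_dist v w (- fmap stable_susp u).
Proof.
move=> /dist_cone [X' [Y' [Z' [u' [q [v' [w' [cn t]]]]]]]].
have [h s] := sig_ex u'.
apply: dist_iso (cone_rotate cn s).
case: t => [a [b [c [[ia ib ic] [e1 e2 e3]]]]].
exists b, c, (fmap stable_susp a); split; first by split=> //; apply: fmap_iso.
split=> //.
by rewrite cmpNl cmpNr -!fmapM e1.
Qed.

Lemma dist_cone_ex (X Y : D) (u : hom X Y) :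
  exists (Z : D) (v : hom Y Z) (w : hom Z (stable_susp X)), stable_dist u v w.
Proof.
have [u' ->] := qmW u; have [Z [q [v [w cn]]]] := cone_ex u'.
by exists Z, (qm v), (qm w); apply: cone_dist cn.
Qed.

(** After two rotations of the given triangle and three of a cone of [u], both start with
    [- fmap stable_susp u], so uniqueness of cones compares them. The comparison is pulled back
    along the fully faithful suspension, where the signs cancel. *)
Lemma dist_unrotate (X Y Z : D) (u : hom X Y) (v : hom Y Z) (w : hom Z (stable_susp X)) :
  stable_dist v w (- fmap stable_susp u) -> stable_dist u v w.
Proof.
move=> d; have [Z1 [v1 [w1 d1]]] := dist_cone_ex u.
have d3 := dist_rotate (dist_rotate d).
have d13 := dist_rotate (dist_rotate (dist_rotate d1)).
have [c [c' [c1 c2 cv cw]]] := dist_unique d3 d13.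
have [b eb] := stable_susp_full c; rewrite -eb in cv cw c1 c2.
have ib : is_iso b by apply: stable_susp_iso_refl; exists c'.
have bv : b \c v = v1.
  by apply: stable_susp_inj; apply: oppr_inj; rewrite -cv fmapM cmpNr.
have wb : w1 \c b = w.
  by apply: stable_susp_inj; apply: oppr_inj; rewrite -cw fmapM cmpNl.
case: ib => b' [b1 b2].
apply: (@dist_of_unique _ _ _ _ _ v1 w1 _ _ b') d1; first by exists b.
  by rewrite -bv cmpA b1 cmp1m.
by rewrite -wb -cmpA b2 cmpm1.
Qed.

(** The object [X'] is taken to be the cone of [f], which makes the new triangle distinguished by
    construction. What has to be shown is that [X'] is also a cone of [v]: it is compared with the
    pushout cone [W] by maps [c] and [d], inverse to each other modulo maps through hulls. *)
Lemma cone_octahedron X Y Z (u : hom X Y) (v : hom Y Z) :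
  exists (Z' Y' X' : C) (i1 : hom Y Z') (i1' : hom Z' (S X)) (l : hom Z Y')
     (l' : hom Y' (S X)) (j : hom Z X') (j' : hom X' (S Y))
     (f : hom Z' Y') (g : hom Y' X'),
    [/\ stable_dist (qm u) (qm i1) (qm i1'), stable_dist (qm v) (qm j) (qm j'),
        stable_dist (qm (v \c u)) (qm l) (qm l'),
        stable_dist (qm f) (qm g) (fmap stable_susp (qm i1) \c (qm j' : @hom K D X' (stable_susp Y)))
      & [/\ f \c i1 = l \c v, l' \c f = i1', g \c l = j &
         (qm j' : @hom K D X' (stable_susp Y)) \c qm g =
         fmap stable_susp (qm u) \c (qm l' : @hom K D Y' (stable_susp X))]].
Proof.
have [Z' [q1 [i1 [i1' c1]]]] := cone_ex u.
have [Y' [q2 [l [l' c2]]]] := cone_ex (v \c u).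
have [W [q3 [v3 [w3 c3]]]] := cone_ex v.
have [po1 i1'i i1'q] := c1; have [po2 l'l l'q] := c2; have [po3 w3v w3q] := c3.
have [|f [fq fi]] := @push_map _ _ _ _ _ _ _ q2 (l \c v) po1.
  by rewrite po2.1 cmpA.
have l'f : l' \c f = i1'.
  apply: (push_eq po1); rewrite -cmpA ?fq ?fi ?l'q ?i1'q //.
  by rewrite cmpA l'l cmp0m i1'i.
have [X' [b [g [h3 cf]]]] := cone_ex f.
have [pof h3g h3b] := cf.
(* [S'] is the pushout of [I Z'] along [i1'], an auxiliary object through which [j'] is built and
   two of the error terms below factor. *)
have [S' [pi' [a poS]]] := fr_push fr i1'.
have [G eG] := fr_ext fr (to_inj (i Y \c u)).
have : (p Y \c G) \c i X = 0 by rewrite -cmpA -eG cmpA (fr_pi fr) cmp0m.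
move=> /(fr_coker fr) [h eh].
have sh : sig u h by exists G.
have [|m [mq mi]] := @push_map _ _ _ _ _ _ _ G (i Y) po1; first by rewrite eG.
have [g0 eg0] := fr_ext fr (to_inj m).
have pm : p Y \c m = h \c i1'.
  apply: (push_eq po1); rewrite -!cmpA ?mq ?mi ?i1'q ?i1'i ?(fr_pi fr) ?cmpm0 //.
have [|ep [epp epa]] := @push_map _ _ _ _ _ _ _ (p Y \c g0) h poS.
  by rewrite -cmpA -eg0.
have [|w' [w'b w'g]] := @push_map _ _ _ _ _ _ _ pi' (a \c l') pof.
  by rewrite poS.1 -cmpA l'f.
pose j := g \c l; pose j' := ep \c w'.
have j'b : j' \c b = p Y \c g0 by rewrite /j' -cmpA w'b epp.
have j'g : j' \c g = h \c l' by rewrite /j' -cmpA w'g cmpA epa.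
clearbody j'.
have [g1 eg1] := fr_ext fr (to_inj (i Z' \c i1)).
have [|n [nq nl]] := @push_map _ _ _ _ _ _ _ (q3 \c G) v3 po2.
  by rewrite -cmpA -eG cmpA po3.1 cmpA.
have [|d [dq dv]] := @push_map _ _ _ _ _ _ _ (b \c g1) j po3.
  by rewrite -cmpA -eg1 cmpA pof.1 /j -!cmpA fi.
have [|c [cb cg]] := @push_map _ _ _ _ _ _ _ (q3 \c g0) n pof.
  rewrite -cmpA -eg0; apply: (push_eq po1).
    by rewrite -!cmpA mq fq nq.
  by rewrite -!cmpA mi fi cmpA nl po3.1.
have w3c : w3 \c c = j'.
  apply: (push_eq pof); rewrite -!cmpA ?cb ?cg ?j'b ?j'g.
    by rewrite cmpA w3q.
  apply: (push_eq po2); rewrite -!cmpA ?nq ?nl ?l'q ?l'l ?cmpm0 ?w3v //.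
  by rewrite cmpA w3q eh.
have cd : (c \c d - idm W) \inJ.
  have : (g0 \c g1 - idm _) \c i Y = 0.
    by rewrite cmpBl -cmpA -eg1 cmpA -eg0 mi cmp1m subrr.
  move=> /(fr_coker fr) [bb ebb].
  suff -> : c \c d - idm W = q3 \c (bb \c w3) by apply: factor_inj.
  apply: (push_eq po3); rewrite cmpBl cmp1m -!cmpA ?dq ?dv ?w3q ?w3v ?cmpm0.
    by rewrite -ebb cmpBr cmpm1 !cmpA cb.
  by rewrite /j cmpA cg nl subrr.
have : (g1 \c g0 - idm _) \c i Z' \c i1 = 0.
  by rewrite -cmpA cmpBl -!cmpA [g0 \c _]cmpA -eg0 mi -eg1 cmp1m subrr.
(* [nu] measures how far the lifts [g0] and [g1] between [I Y] and [I Z'] are from being inverse. It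
   vanishes on the image of [Y], so on [Z'] it factors through [i1'], which yields the map [b'] on
   [S']. *)
set nu := g1 \c g0 - idm _ => nui.
have [|k ek] := @fr_coker _ _ _ _ fr _ X (nu \c i Z' \c q1).
  by rewrite -cmpA po1.1 cmpA nui cmp0m.
have nuk : nu \c i Z' = k \c i1'.
  by apply: (push_eq po1); rewrite -?cmpA ?i1'q ?i1'i ?cmpm0 // cmpA.
have [b' [b'p b'a]] := push_map poS nuk.
have dc : (d \c c - idm _) \inJ.
  suff -> : d \c c - idm _ = b \c (b' \c w') by apply: factor_inj.
  apply: (push_eq pof); rewrite cmpBl cmp1m -!cmpA ?cb ?cg ?w'b ?w'g.
    by rewrite b'p /nu cmpBr cmpm1 !cmpA dq.
  apply: (push_eq po2); rewrite cmpBl -!cmpA ?nq ?nl ?l'q ?l'l ?cmpm0; last first.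
    by rewrite dv subrr.
  rewrite -fq [g \c _]cmpA -pof.1 -[X in _ = b \c (b' \c (a \c X))]i1'q.
  rewrite [a \c _]cmpA -poS.1 [b' \c _]cmpA [b' \c _]cmpA b'p /nu -!cmpA cmpBl cmp1m cmpBr -mq eg0.
  by rewrite [d \c _]cmpA dq -!cmpA.
pose hi := p Z' \c g1.
have : hi \c i Y = 0 by rewrite /hi -cmpA -eg1 cmpA (fr_pi fr) cmp0m.
move=> /(fr_coker fr) [s es].
have ss : sig i1 s by exists g1.
have sj : (s \c j' - h3) \inJ.
  suff -> : s \c j' - h3 = p Z' \c (b' \c w') by apply: factor_inj.
  apply: (push_eq pof); rewrite cmpBl -!cmpA ?j'b ?j'g ?h3b ?h3g ?w'b ?w'g ?subr0.
    by rewrite b'p /nu cmpBr cmpm1 cmpA -es /hi -cmpA.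
  apply: (push_eq po2); rewrite -!cmpA ?l'l ?cmpm0 // l'q.
  rewrite -eh cmpA -es /hi -[in RHS]i1'q [a \c _]cmpA -poS.1 [b' \c _]cmpA [b' \c _]cmpA b'p.
  rewrite -cmpA /nu !cmpBl cmp1m cmpBr [p Z' \c (i Z' \c q1)]cmpA (fr_pi fr) cmp0m subr0.
  by rewrite -mq eg0 -!cmpA.
exists Z', Y', X', i1, i1', l, l', j, j', f, g; split.
- exact: cone_dist c1.
- apply: (@dist_of_unique _ _ _ _ _ (qm v3) (qm w3) _ _ (qm d)).
  + exists (qm c); rewrite -!qmM; split; exact/qmP.
  + by rewrite -qmM dv.
  + rewrite -w3c -[LHS]qmM -cmpA; apply/qmP.
    by rewrite -[X in _ - X]cmpm1 -cmpBr; apply: idealMl.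
  exact: cone_dist c3.
- exact: cone_dist c2.
- have -> : fmap stable_susp (qm i1) \c (qm j' : @hom K D X' (stable_susp Y)) = qm h3.
    by rewrite (stable_suspE ss) -[LHS]qmM; apply/qmP.
  exact: cone_dist cf.
split=> //.
by rewrite (stable_suspE sh) -[LHS]qmM -[RHS]qmM j'g.
Qed.

Lemma dist_octahedron (X Y Z Z' X' Y' : D) (u : hom X Y) (v : hom Y Z)
      (i1 : hom Y Z') (i1' : hom Z' (stable_susp X))
      (j : hom Z X') (j' : hom X' (stable_susp Y))
      (l : hom Z Y') (l' : hom Y' (stable_susp X)) :
    stable_dist u i1 i1' -> stable_dist v j j' -> stable_dist (v \c u) l l' ->
    exists (f : hom Z' Y') (g : hom Y' X'),
      stable_dist f g (fmap stable_susp i1 \c j') /\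
      [/\ f \c i1 = l \c v, l' \c f = i1', g \c l = j
        & j' \c g = fmap stable_susp u \c l'].
Proof.
have [u0 ->] := qmW u; have [v0 ->] := qmW v; rewrite -qmM => du dv dvu.
have [Z0 [Y0 [X0 [i0 [i0' [l0 [l0' [j0 [j0' [f0 [g0]]]]]]]]]]] := cone_octahedron u0 v0.
move=> [du0 dv0 dvu0 d0 [e1 e2 e3 e4]].
have [a [a' [a1 a2 av aw]]] := dist_unique du du0.
have [b [b' [b1 b2 bv bw]]] := dist_unique dv dv0.
have [c [c' [c1 c2 cv cw]]] := dist_unique dvu dvu0.
have c'v : c' \c qm l0 = l by rewrite -cv cmpA c1 cmp1m.
have b'v : b' \c qm j0 = j by rewrite -bv cmpA b1 cmp1m.
exists (c' \c qm f0 \c a), (b' \c qm g0 \c c); split.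
  apply: dist_iso d0; exists a', c', b'; split.
    by split; [exists a | exists c | exists b].
  split.
  - by rewrite -!cmpA a2 cmpm1.
  - by rewrite -!cmpA c2 cmpm1.
  rewrite cmpA -fmapM -av cmpA a1 cmp1m -bw -!cmpA b2 cmpm1 //.
split.
- by rewrite -!cmpA av -qmM e1 qmM cmpA c'v.
- rewrite -cw !cmpA -[_ \c c \c c']cmpA c2 cmpm1 -aw; congr (_ \c _).
  by rewrite -e2 qmM.
- by rewrite -!cmpA cv -qmM e3.
- rewrite -bw !cmpA -[_ \c b \c b']cmpA b2 cmpm1 e4 -cmpA cw //.
Qed.

Lemma is_zero_inj X : @is_zero K D (I X).
Proof. exact/qm_eq0/(fr_inj fr). Qed.

Lemma stable_additive : additive_cat D.
Proof.
have [[Z0 z0] bi] := fr_add fr; split.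
  by exists Z0; rewrite /is_zero -qm_id z0.
move=> X Y; have [Z [i1 [i2 [p1 [p2 [e11 e22 e21 e12 e]]]]]] := bi X Y.
exists Z, (qm i1), (qm i2), (qm p1), (qm p2).
by split; rewrite -!qmM ?e11 ?e22 ?e21 ?e12 // -qmD e.
Qed.

Lemma dist_id (X Z : D) : is_zero Z ->
  stable_dist (idm X) (0 : hom X Z) (0 : hom Z (stable_susp X)).
Proof.
move=> z; exists X, X, (I X), (idm _), (i X), (idm _), (p X).
split; rewrite ?cmp1m ?cmpm1 ?(fr_pi fr) //.
  split; first by rewrite cmp1m cmpm1.
  move=> T q' v' e; exists q'; split; first by rewrite cmpm1 e cmpm1.
  by move=> f [<- _]; rewrite cmpm1.
have zI := is_zero_inj X.
exists (idm _), (idm _), 0; split.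
  by split; [exact: is_iso_id | exact: is_iso_id | exists 0; rewrite !cmp0m zI z].
rewrite !cmp1m !cmp0m fmap1 cmp1m; split=> //.
by rewrite -[qm (p X)]cmpm1 zI cmpm0.
Qed.

Lemma stable_triangulated : is_triangulated stable_triang.
Proof.
split.
- exact: stable_additive.
- exact: stable_susp_auto.
- exact: dist_iso.
- exact: dist_id.
- exact: dist_cone_ex.
- by move=> *; split; [exact: dist_rotate | exact: dist_unrotate].
- exact: dist_map.
- exact: dist_octahedron.
Qed.

End StableTriangulation.

Arguments cmp : simpl never.
Arguments hom : simpl never.
Arguments idm : simpl never.

(** * The norm map of the Frobenius extension K[x]/(x^k) of K *)

Section NormMap.
Context (K : fieldType) (G : linCat K).
Implicit Types A B C : G.

Lemma cmp_sumr A B C (I : Type) (r : seq I) P (g : hom B C) (F : I -> hom A B) :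
  g \c (\sum_(i <- r | P i) F i) = \sum_(i <- r | P i) g \c F i.
Proof. by apply: (big_morph (cmp g)) => [x y|]; rewrite ?cmpDr ?cmpm0. Qed.

Lemma cmp_suml A B C (I : Type) (r : seq I) P (F : I -> hom B C) (f : hom A B) :
  (\sum_(i <- r | P i) F i) \c f = \sum_(i <- r | P i) F i \c f.
Proof. by apply: (big_morph (cmp^~ f)) => [x y|]; rewrite ?cmpDl ?cmp0m. Qed.

Definition pw A (X : hom A A) n : hom A A := iter n (cmp X) (idm A).

Lemma pwS A (X : hom A A) n : pw X n.+1 = X \c pw X n. Proof. by []. Qed.
Lemma pw0 A (X : hom A A) : pw X 0 = idm A. Proof. by []. Qed.

Lemma pw_comm A B (X : hom A A) (Y : hom B B) (f : hom A B) n :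
  f \c X = Y \c f -> f \c pw X n = pw Y n \c f.
Proof.
move=> e; elim: n => [|n IH]; first by rewrite cmp1m cmpm1.
by rewrite !pwS cmpA e -cmpA IH cmpA.
Qed.

Lemma pwSr A (X : hom A A) n : pw X n.+1 = pw X n \c X.
Proof. by rewrite pwS (pw_comm n (erefl (X \c X))). Qed.

Lemma pwD A (X : hom A A) m n : pw X (m + n) = pw X m \c pw X n.
Proof. by elim: m => [|m IH]; rewrite ?cmp1m // addSn !pwS IH cmpA. Qed.

Context (k : nat).

(* The trace map s |-> \sum_j Y^j s X^(k-1-j) of the Frobenius extension
   K[x]/(x^k) of K. *)
Definition nrm A B (X : hom A A) (Y : hom B B) (s : hom A B) : hom A B :=
  \sum_(j < k) pw Y j \c s \c pw X (k.-1 - j).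

Lemma nrm_l A B B' (X : hom A A) (Y : hom B B) (Y' : hom B' B') (f : hom B B') s :
  f \c Y = Y' \c f -> f \c nrm X Y s = nrm X Y' (f \c s).
Proof.
move=> e; rewrite cmp_sumr; apply: eq_bigr => j _.
by rewrite !cmpA (pw_comm _ e).
Qed.

Lemma nrm_r A A' B (X : hom A A) (X' : hom A' A') (Y : hom B B) (f : hom A' A) s :
  f \c X' = X \c f -> nrm X Y s \c f = nrm X' Y (s \c f).
Proof.
move=> e; rewrite cmp_suml; apply: eq_bigr => j _.
by rewrite -!cmpA (pw_comm _ e).
Qed.

Lemma nrmD A B (X : hom A A) (Y : hom B B) s t : nrm X Y (s + t) = nrm X Y s + nrm X Y t.
Proof. by rewrite -big_split; apply: eq_bigr => j _; rewrite cmpDr cmpDl. Qed.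

Lemma nrmZ A B (X : hom A A) (Y : hom B B) a s : nrm X Y (a *: s) = a *: nrm X Y s.
Proof. by rewrite scaler_sumr; apply: eq_bigr => j _; rewrite cmpZr cmpZl. Qed.

Lemma nrm0 A B (X : hom A A) (Y : hom B B) : nrm X Y 0 = 0.
Proof. by have := nrmZ X Y 0 0; rewrite !scale0r. Qed.

(** Composing with the operator shifts the index by one on either side; the two boundary terms carry
    [pw X k] and [pw Y k]. *)
Lemma nrm_comm A B (X : hom A A) (Y : hom B B) s :
  pw X k = 0 -> pw Y k = 0 -> nrm X Y s \c X = Y \c nrm X Y s.
Proof.
rewrite /nrm; case: k => [|n] X0 Y0; first by rewrite !big_ord0 cmp0m cmpm0.
rewrite cmp_sumr cmp_suml big_ord_recl big_ord_recr /=.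
rewrite subn0 subnn pw0 cmpm1 -!cmpA -pwSr X0 !cmpm0 add0r.
rewrite [Y \c (_ \c s)]cmpA -pwS Y0 cmp0m addr0; apply: eq_bigr => j _.
by rewrite /bump leq0n add1n -!cmpA -pwSr subnSK // [RHS]cmpA -pwS.
Qed.

(** For [pw X k = 0] this is Higman's criterion for [A] to be projective, hence free, over
    K[X]/(X^k). *)
Definition has_unit A (X : hom A A) := exists e, nrm X X e = idm A.

(** A splitting in the underlying category: [r] and [s] are not asked to commute with operators.
    That [r \c s] vanishes follows, see [split_rs]. *)
Definition split_seq A B C (i : hom A B) (p : hom B C) (r : hom B A) (s : hom C B) :=
  [/\ p \c i = 0, r \c i = idm A, p \c s = idm C & i \c r + s \c p = idm B].

Section Split.
Context (A B C : G) (i : hom A B) (p : hom B C) (r : hom B A) (s : hom C B).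
Hypothesis sp : split_seq i p r s.

Lemma split_rs : r \c s = 0.
Proof.
have [pi ri ps e] := sp.
have: r \c s \c (p \c s) = 0.
  have: r \c (i \c r + s \c p) \c s = r \c s by rewrite e cmpm1.
  rewrite cmpDr cmpDl !cmpA ri cmp1m.
  by move/(canRL (addKr _)); rewrite addNr.
by rewrite ps cmpm1.
Qed.

Lemma split_mono T (f g : hom T A) : i \c f = i \c g -> f = g.
Proof. by have [_ ri _ _] := sp; move=> /(congr1 (cmp r)); rewrite !cmpA ri !cmp1m. Qed.

Lemma split_epi T (f g : hom C T) : f \c p = g \c p -> f = g.
Proof. by have [_ _ ps _] := sp; move=> /(congr1 (cmp^~ s)); rewrite -!cmpA ps !cmpm1. Qed.

Lemma split_ker T (f : hom T B) : p \c f = 0 -> f = i \c (r \c f).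
Proof.
have [_ _ _ e] := sp; move=> pf.
by rewrite -{1}[f]cmp1m -e cmpDl -!cmpA pf cmpm0 addr0.
Qed.

Lemma split_coker T (f : hom B T) : f \c i = 0 -> f = f \c s \c p.
Proof.
have [_ _ _ e] := sp; move=> fi.
by rewrite -{1}[f]cmpm1 -e cmpDr !cmpA fi cmp0m add0r.
Qed.

Context (X : hom A A) (Y : hom B B) (Z : hom C C).
Hypotheses (iX : i \c X = Y \c i) (pY : p \c Y = Z \c p).

Lemma split_ker_comm T (W : hom T T) (f : hom T A) :
  (i \c f) \c W = Y \c (i \c f) -> f \c W = X \c f.
Proof. by move=> e; apply: split_mono; rewrite !cmpA iX -!cmpA -e !cmpA. Qed.

Lemma split_coker_comm T (W : hom T T) (f : hom C T) :
  (f \c p) \c Y = W \c (f \c p) -> f \c Z = W \c f.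
Proof. by move=> e; apply: split_epi; rewrite -!cmpA -pY !cmpA e !cmpA. Qed.

(** A mere matrix [t] extends along [i] as [t \c r], and norms are compatible with the commuting map
    [i]; this is relative injectivity. *)
Lemma split_ext T (W : hom T T) (t : hom A T) :
  nrm X W t = nrm Y W (t \c r) \c i.
Proof. by have [_ ri _ _] := sp; rewrite (nrm_r W _ iX) -cmpA ri cmpm1. Qed.

Lemma split_lift T (W : hom T T) (t : hom T C) :
  nrm W Z t = p \c nrm W Y (s \c t).
Proof. by have [_ _ ps _] := sp; rewrite (nrm_l W _ pY) cmpA ps cmp1m. Qed.

Hypotheses (Y0 : pw Y k = 0).

Lemma split_nil_quo : pw Z k = 0.
Proof. by apply: split_epi; rewrite -(pw_comm _ pY) Y0 cmpm0 cmp0m. Qed.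

Lemma split_nil_sub : pw X k = 0.
Proof. by apply: split_mono; rewrite (pw_comm _ iX) Y0 cmpm0 cmp0m. Qed.

(** The obvious candidate, glued from the units of the two ends, leaves a defect [d] that kills [i].
    Then [d] factors through [p] by the commuting map [d \c s], and the unit of [Z] writes it as a
    norm, which is added as a correction. *)
Lemma has_unit_ext : has_unit X -> has_unit Z -> has_unit Y.
Proof.
move=> [eX hX] [eZ hZ]; have [pi ri ps e] := sp.
pose d := idm B - nrm Y Y (i \c eX \c r + s \c eZ \c p).
have Ni t : nrm Y Y (i \c t) = i \c nrm Y X t by rewrite (nrm_l Y _ iX).
have Np t : nrm Y Y (t \c p) = nrm Z Y t \c p by rewrite (nrm_r Y _ pY).
have di : d \c i = 0.
  rewrite cmpBl cmp1m nrmD -cmpA Ni Np cmpDl -!cmpA pi cmpm0 addr0.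
  by rewrite -split_ext hX cmpm1 subrr.
have pd : p \c d = 0.
  rewrite cmpBr cmpm1 nrmD cmpDr -[i \c _ \c _]cmpA Ni cmpA pi cmp0m add0r.
  by rewrite Np cmpA -split_lift hZ cmp1m subrr.
have ed := split_coker di.
have dY : d \c Y = Y \c d.
  by rewrite cmpBl cmpBr cmp1m cmpm1 nrm_comm.
have cds : (d \c s) \c Z = Y \c (d \c s).
  by apply: split_coker_comm; rewrite -ed.
exists (i \c eX \c r + s \c eZ \c p + d \c s \c eZ \c p).
rewrite nrmD Np -(nrm_l _ _ cds) hZ cmpm1 -ed /d.
by rewrite addrC subrK.
Qed.

(** The unit of [X] gives a commuting retraction [R] of [i], so [C] is a direct summand of [B]
    compatibly with the operators, and the unit of [Y] is cut down to this summand. *)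
Lemma has_unit_quo : has_unit X -> has_unit Y -> has_unit Z.
Proof.
move=> [eX hX] [eY hY]; have [pi ri ps e] := sp.
pose R := nrm Y X (eX \c r).
have Ri : R \c i = idm A by rewrite -split_ext.
have RY : R \c Y = X \c R by apply: nrm_comm => //; apply: split_nil_sub.
have q : (idm B - i \c R) \c i = 0 by rewrite cmpBl cmp1m -cmpA Ri cmpm1 subrr.
have ec := split_coker q; set c := _ \c s in ec.
have cZ : c \c Z = Y \c c.
  apply: split_coker_comm; rewrite -ec cmpBl cmpBr cmp1m cmpm1 -cmpA RY.
  by rewrite !cmpA iX.
have pc : p \c c = idm C.
  apply: split_epi; rewrite -cmpA -ec cmpBr cmpm1 cmpA pi cmp0m subr0 cmp1m //.
exists (p \c (eY \c c)).
by rewrite -(nrm_l _ _ pY) -(nrm_r _ _ cZ) hY cmp1m.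
Qed.

End Split.
End NormMap.

(** * Matrices with degree bounds *)

Section Matrices.
Context (K : fieldType).

Definition mx_hom (A B : finType) : lmodType K := B -> A -> K^o.
Definition mx_id (A : finType) : mx_hom A A := fun a b => (a == b)%:R.
Definition mx_cmp (A B C : finType) (g : mx_hom B C) (f : mx_hom A B) : mx_hom A C :=
  fun c a => \sum_b g c b * f b a.

Lemma mxP (A B : finType) (f g : mx_hom A B) : (forall b a, f b a = g b a) -> f = g.
Proof. by move=> e; apply/funext => b; apply/funext => a. Qed.

Lemma mx_cmpA A B C D (h : mx_hom C D) (g : mx_hom B C) (f : mx_hom A B) :
  mx_cmp h (mx_cmp g f) = mx_cmp (mx_cmp h g) f.
Proof.
apply: mxP => d a; rewrite /mx_cmp.
under eq_bigr do rewrite mulr_sumr.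
rewrite exchange_big /=; apply: eq_bigr => b _; rewrite mulr_suml.
by apply: eq_bigr => c _; rewrite mulrA.
Qed.

Lemma mx_cmp1m A B (f : mx_hom A B) : mx_cmp (@mx_id B) f = f.
Proof.
apply: mxP => b a; rewrite /mx_cmp /mx_id (bigD1 b) //= eqxx mul1r big1 ?addr0 //.
by move=> c /negbTE; rewrite eq_sym => ->; rewrite mul0r.
Qed.

Lemma mx_cmpm1 A B (f : mx_hom A B) : mx_cmp f (@mx_id A) = f.
Proof.
apply: mxP => b a; rewrite /mx_cmp /mx_id (bigD1 a) //= eqxx mulr1 big1 ?addr0 //.
by move=> c /negbTE ->; rewrite mulr0.
Qed.

Lemma mx_cmpPl A B C a (g h : mx_hom B C) (f : mx_hom A B) :
  mx_cmp (a *: g + h) f = a *: mx_cmp g f + mx_cmp h f.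
Proof.
apply: mxP => c x; rewrite /mx_cmp /= !fctE scaler_sumr -big_split; apply: eq_bigr => b _.
by rewrite /= mulrDl scalerAl.
Qed.

Lemma mx_cmpPr A B C a (h : mx_hom B C) (f g : mx_hom A B) :
  mx_cmp h (a *: f + g) = a *: mx_cmp h f + mx_cmp h g.
Proof.
apply: mxP => c x; rewrite /mx_cmp /= !fctE scaler_sumr -big_split; apply: eq_bigr => b _.
by rewrite /= mulrDr scalerAr.
Qed.

Definition mx_cat : linCat K :=
  @LinCat K finType mx_hom mx_id mx_cmp mx_cmpA mx_cmp1m mx_cmpm1 mx_cmpPl mx_cmpPr.

Implicit Types A B C : finType.
Notation mhom := (@hom K mx_cat).

Lemma mx_cmpE A B C (g : mhom B C) (f : mhom A B) c a :
  (g \c f) c a = \sum_b g c b * f b a.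
Proof. by []. Qed.
Lemma mx_idE A a b : (idm (A : mx_cat)) a b = (a == b)%:R. Proof. by []. Qed.
Lemma mx_addE A B (f g : mhom A B) b a : (f + g) b a = f b a + g b a.
Proof. by []. Qed.
Lemma mx_scaleE A B x (f : mhom A B) b a : (x *: f) b a = x * f b a.
Proof. by []. Qed.
Lemma mx_0E A B b a : (0 : mhom A B) b a = 0. Proof. by []. Qed.
Lemma mx_sumE A B (I : Type) (r : seq I) P (F : I -> mhom A B) b a :
  (\sum_(i <- r | P i) F i) b a = \sum_(i <- r | P i) F i b a.
Proof. by elim/big_rec2: _ => // i x y _ <-. Qed.

Definition mtr A (f : mhom A A) := \sum_a f a a.

Lemma mtrC A B (g : mhom B A) (f : mhom A B) : mtr (g \c f) = mtr (f \c g).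
Proof.
rewrite /mtr; under eq_bigr do rewrite mx_cmpE.
rewrite exchange_big /=; apply: eq_bigr => b _; apply: eq_bigr => a _.
by rewrite mulrC.
Qed.

Lemma mtrD A (f g : mhom A A) : mtr (f + g) = mtr f + mtr g.
Proof. by rewrite -big_split. Qed.
Lemma mtrZ A x (f : mhom A A) : mtr (x *: f) = x * mtr f.
Proof. by rewrite mulr_sumr. Qed.
Lemma mtr0 A : mtr (0 : mhom A A) = 0.
Proof. by rewrite /mtr big1. Qed.
Lemma mtr_sum A (I : Type) (r : seq I) P (F : I -> mhom A A) :
  mtr (\sum_(i <- r | P i) F i) = \sum_(i <- r | P i) mtr (F i).
Proof. by apply: (big_morph (@mtr A)) => [x y|]; rewrite ?mtrD ?mtr0. Qed.

(** By cyclicity the powers of [Y] move to the other side, and reversing the index exchanges [j]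
    with [k - 1 - j]: the norm is its own adjoint for the trace form. *)
Lemma mtr_nrm k A B (X : mhom A A) (Y : mhom B B) s m :
  mtr (nrm k X Y s \c m) = mtr (s \c nrm k Y X m).
Proof.
rewrite cmp_suml cmp_sumr !mtr_sum (reindex_inj rev_ord_inj) /=.
apply: eq_bigr => j _; rewrite -!cmpA mtrC -!cmpA.
have -> : (k - j.+1 = k.-1 - j)%N by case: (k) j.
have -> // : (k.-1 - (k.-1 - j) = j)%N by case: (k) j => [[]//|n] j /=; rewrite subKn // -ltnS.
Qed.

Section Degrees.
Implicit Types (dA dB dC : int).

(** The entry from [a] to [b] of a degree [r] map of graded K[y]-modules is a scalar times y^(dB b -
    dA a - r); the condition is that this exponent is nonnegative wherever the scalar is nonzero. *)
Definition mdeg A B (dA : A -> int) (dB : B -> int) (r : int) (f : mhom A B) :=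
  forall b a, f b a != 0 -> dA a + r <= dB b.

Context (A B C : finType) (dA : A -> int) (dB : B -> int) (dC : C -> int).

Lemma mdeg_eq r r' (f : mhom A B) : mdeg dA dB r f -> r = r' -> mdeg dA dB r' f.
Proof. by move=> h <-. Qed.

Lemma mdeg0 r : mdeg dA dB r (0 : mhom A B).
Proof. by move=> b a; rewrite mx_0E eqxx. Qed.

Lemma mdegP r x (f g : mhom A B) :
  mdeg dA dB r f -> mdeg dA dB r g -> mdeg dA dB r (x *: f + g).
Proof.
move=> hf hg b a; rewrite mx_addE mx_scaleE => n.
have [f0|/hf //] := eqVneq (f b a) 0.
by apply: hg; rewrite f0 mulr0 add0r in n.
Qed.

Lemma mdegD r (f g : mhom A B) :
  mdeg dA dB r f -> mdeg dA dB r g -> mdeg dA dB r (f + g).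
Proof. by move=> hf hg; rewrite -[f]scale1r; apply: mdegP. Qed.

Lemma mdegZ r x (f : mhom A B) : mdeg dA dB r f -> mdeg dA dB r (x *: f).
Proof. by move=> hf; rewrite -[_ *: _]addr0; apply/mdegP/mdeg0. Qed.

Lemma mdegN r (f : mhom A B) : mdeg dA dB r f -> mdeg dA dB r (- f).
Proof. by rewrite -scaleN1r; apply: mdegZ. Qed.

Lemma mdegB r (f g : mhom A B) :
  mdeg dA dB r f -> mdeg dA dB r g -> mdeg dA dB r (f - g).
Proof. by move=> hf hg; apply/mdegD/mdegN. Qed.

Lemma mdeg_sum r (I : Type) (s : seq I) (P : pred I) (F : I -> mhom A B) :
  (forall i, P i -> mdeg dA dB r (F i)) -> mdeg dA dB r (\sum_(i <- s | P i) F i).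
Proof.
by move=> h; apply: (big_ind (mdeg dA dB r)) => //; [apply: mdeg0 | apply: mdegD].
Qed.

Lemma mdeg_id : mdeg dA dA 0 (idm (A : mx_cat)).
Proof.
move=> a b; rewrite mx_idE addr0; have [->//|] := eqVneq a b; by rewrite eqxx.
Qed.

Lemma mdegM r s (g : mhom B C) (f : mhom A B) :
  mdeg dB dC r g -> mdeg dA dB s f -> mdeg dA dC (r + s) (g \c f).
Proof.
move=> hg hf c a; rewrite mx_cmpE => n.
have [b] : exists b, g c b * f b a != 0.
  by apply/existsP; apply: contra_neqT n; rewrite negb_exists => /forallP n; apply: big1 => b _; apply/eqP; rewrite -[_ == _]negbK.
rewrite mulf_eq0 negb_or => /andP[/hg h1 /hf h2].
by rewrite addrA -addrA [r + s]addrC addrA (le_trans _ h1) // lerD2r.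
Qed.

End Degrees.

Lemma mdeg_pw A (d : A -> int) (X : mhom A A) n : mdeg d d 1 X -> mdeg d d n%:Z (pw X n).
Proof.
move=> hX; elim: n => [|n IH]; first exact: mdeg_id.
by rewrite pwS; apply: (mdeg_eq (mdegM hX IH)); rewrite -intS.
Qed.

Lemma mdeg_nrm k A B (dA : A -> int) (dB : B -> int) (X : mhom A A) (Y : mhom B B) r s :
  mdeg dA dA 1 X -> mdeg dB dB 1 Y -> mdeg dA dB r s ->
  mdeg dA dB (r + k%:Z - 1) (nrm k X Y s).
Proof.
move=> hX hY hs; apply: mdeg_sum => j _.
apply: (mdeg_eq (mdegM (mdegM (mdeg_pw hY) hs) (mdeg_pw hX))).
by case: j => j /=; lia.
Qed.

Lemma sum_enum_val (T : finType) (F : T -> K) :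
  \sum_x F x = \sum_(i < #|T|) F (enum_val i).
Proof. exact: (reindex _ (onW_bij _ (@enum_val_bij T))). Qed.

(** The columns of the cokernel matrix of [L] serve as test vectors: a row that annihilates them
    lies in the row space. *)
Lemma fredholm (P Q : finType) (L : P -> Q -> K) (f : Q -> K) :
  (forall m : Q -> K, (forall p, \sum_q L p q * m q = 0) -> \sum_q f q * m q = 0) ->
  exists s : P -> K, forall q, f q = \sum_p s p * L p q.
Proof.
move=> h; pose M := \matrix_(i < #|P|, j < #|Q|) L (enum_val i) (enum_val j).
pose v := \row_(j < #|Q|) f (enum_val j).
have /submxP[D eD] : (v <= M)%MS.
  rewrite submxE; apply/eqP/rowP => j; rewrite mxE [RHS]mxE.
  pose m q := cokermx M (enum_rank q) j.
  have := h m; rewrite sum_enum_val => hm.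
  have vE i : v ord0 i * cokermx M i j = f (enum_val i) * m (enum_val i).
    by rewrite mxE /m enum_valK.
  rewrite (eq_bigr _ (fun i _ => vE i)); apply: hm.
  move=> p; have /matrixP/(_ (enum_rank p) j) := mulmx_coker M.
  rewrite mxE [RHS]mxE => e; rewrite -[RHS]e [LHS]sum_enum_val; apply: eq_bigr => i _.
  by rewrite /m enum_valK [M _ _]mxE enum_rankK.
exists (fun p => D ord0 (enum_rank p)) => q.
have /rowP/(_ (enum_rank q)) := eD; rewrite !mxE enum_rankK => ->.
rewrite [RHS]sum_enum_val; apply: eq_bigr => i _.
by rewrite mxE enum_valK enum_rankK.
Qed.

(* A linear system on the coordinates of s allowed by the degree bound: its
   solvability is dual to the vanishing of the trace form on commuting maps. *)
Lemma nrm_nondeg k A B (dA : A -> int) (dB : B -> int) (X : mhom A A) (Y : mhom B B)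
    e r (f : mhom A B) :
  pw X k = 0 -> pw Y k = 0 -> nrm k X X e = idm _ -> f \c X = Y \c f ->
  (forall h : mhom B A, h \c Y = X \c h -> mdeg dB dA (k%:Z - r) h ->
     mtr (h \c f \c e) = 0) ->
  exists2 s, mdeg dA dB (r + 1 - k%:Z) s & f = nrm k X Y s.
Proof.
move=> X0 Y0 e1 fX H.
(* Elementary matrices, replaced by zero at the positions that the degree bound forbids: their span
   is the space of admissible [s]. *)
pose E (p : A * B) : mhom A B := fun b a => ((p == (a, b)) && (dA a + (r + 1 - k%:Z) <= dB b))%:R.
have [m Hm|x ex] := @fredholm (A * B)%type (A * B)%type
    (fun p q => nrm k X Y (E p) q.2 q.1) (fun q => f q.2 q.1).
  pose M : mhom B A := fun a b => m (a, b).
  have trM (g : mhom A B) : \sum_q g q.2 q.1 * m q = mtr (g \c M).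
    rewrite /mtr; under [RHS]eq_bigr do rewrite mx_cmpE.
    by rewrite exchange_big pair_big /=; apply: eq_bigr => -[a b].
  rewrite trM mtrC -[f]cmpm1 -e1 cmpA -mtr_nrm.
  rewrite -(nrm_r k X M fX).
  apply: (H (nrm k Y X M)); first exact: nrm_comm.
  (* A position that violates the bound wanted for the norm of [M] is one that is allowed for [s],
     because negating an integer inequality gains 1; there [Hm] makes the entry vanish. *)
  move=> a b; apply: contraNT => nab; apply/eqP.
  have := Hm (a, b); rewrite trM mtr_nrm mtrC /mtr.
  rewrite (bigD1 a) //= mx_cmpE (bigD1 b) //= {1}/E eqxx.
  have -> : dA a + (r + 1 - k%:Z) <= dB b by rewrite -ltNge in nab; lia.
  rewrite mulr1 !big1 ?addr0 //.
    by move=> a' na; rewrite mx_cmpE big1 // => b' _; rewrite /E xpair_eqE eq_sym (negbTE na) mulr0.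
  by move=> b' nb; rewrite /E xpair_eqE [b == _]eq_sym (negbTE nb) andbF mulr0.
exists (\sum_p x p *: E p).
  apply: mdeg_sum => p _; apply: mdegZ => b a; rewrite /E.
  by case: (_ <= _); rewrite ?andbF ?eqxx.
apply: mxP => b a; rewrite (ex (a, b)) /=.
have -> : nrm k X Y (\sum_p x p *: E p) = \sum_p x p *: nrm k X Y (E p).
  by rewrite (big_morph (nrm k X Y) (@nrmD _ _ _ _ _ _ _) (@nrm0 _ _ _ _ _ _ _)); apply: eq_bigr => p _; rewrite nrmZ.
by rewrite mx_sumE.
Qed.

End Matrices.

Section Blocks.
Context (K : fieldType).
Notation mhom := (@hom K (mx_cat K)).
Implicit Types A B C : finType.

Section Power.
Context (n : nat) (A : finType).

Definition blk : mx_cat K := ('I_n * A)%type : finType.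
(** Indices are natural numbers rather than ordinals: out of range [bpr] is the zero map, so the
    formulas below encode truncation by themselves. *)
Definition bpr (j : nat) : mhom blk A := fun a x => ((x.1 == j :> nat) && (a == x.2))%:R.
Definition bin (j : nat) : mhom A blk := fun x a => ((x.1 == j :> nat) && (x.2 == a))%:R.
Definition bcol B (F : nat -> mhom B A) : mhom B blk := fun x b => F x.1 x.2 b.

Lemma bpr_cmp B (f : mhom B blk) (j : 'I_n) a b : (bpr j \c f) a b = f (j, a) b.
Proof.
rewrite mx_cmpE (bigD1 (j, a)) //= /bpr !eqxx mul1r big1 ?addr0 // => -[l c] /=.
rewrite xpair_eqE negb_and -val_eqE [a == c]eq_sym.
by case: (nat_of_ord l == j); case: (c == a) => //= _; rewrite mul0r.
Qed.

Lemma bpr_ge j : (n <= j)%N -> bpr j = 0.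
Proof.
move=> h; apply: mxP => a [l c]; rewrite /bpr mx_0E /=.
by case: eqP => // e; move: (ltn_ord l); rewrite e ltnNge h.
Qed.

Lemma bpr_mono B (f g : mhom B blk) :
  (forall j, (j < n)%N -> bpr j \c f = bpr j \c g) -> f = g.
Proof.
move=> h; apply: mxP => -[j a] b; rewrite -!bpr_cmp.
by rewrite h.
Qed.

Lemma bpr_col B (F : nat -> mhom B A) j : (j < n)%N -> bpr j \c bcol F = F j.
Proof. by move=> h; apply: mxP => a b; rewrite (bpr_cmp _ (Ordinal h)). Qed.

Lemma bpr_in i j : (j < n)%N -> bpr i \c bin j = if i == j then idm (A : mx_cat K) else 0.
Proof.
move=> h; have [hi|hi] := ltnP i n; last first.
  rewrite bpr_ge // cmp0m; case: eqP => // e.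
  by rewrite -e ltnNge hi in h.
apply: mxP => a b; rewrite (bpr_cmp _ (Ordinal hi)) /bin /=.
by case: eqP => //=.
Qed.

Context (d : A -> int) (c : int).
(** In the cofree object the coordinate [j] of [m] is x^j m, whose degree is [j] more than that of
    [m]; so the degrees of block [j] are lowered by [j]. The offset [c] is 0 for the hull and 1 for
    the cosyzygy. *)
Definition bdeg (x : blk) : int := d x.2 - x.1%:Z - c.

Lemma mdeg_bpr j : mdeg bdeg d (j%:Z + c) (bpr j).
Proof.
move=> a [l b]; rewrite /bpr /bdeg /=; have [e|_] := eqVneq (l : nat) j; last by rewrite eqxx.
by have [->|_] := eqVneq a b; [move=> _; lia | rewrite eqxx].
Qed.

Lemma mdeg_bin j : mdeg d bdeg (- j%:Z - c) (bin j).
Proof.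
move=> [l b] a; rewrite /bin /bdeg /=; have [e|_] := eqVneq (l : nat) j; last by rewrite eqxx.
by have [->|_] := eqVneq b a; [move=> _; lia | rewrite eqxx].
Qed.

Lemma mdeg_to_blk B (dB : B -> int) r (f : mhom B blk) :
  (forall j, (j < n)%N -> mdeg dB d (r + j%:Z + c) (bpr j \c f)) -> mdeg dB bdeg r f.
Proof.
move=> h [j a] b; rewrite -bpr_cmp => /(h _ (ltn_ord j)); rewrite /bdeg /=; lia.
Qed.

End Power.
Arguments bpr n A j : clear implicits.
Arguments bin n A j : clear implicits.
Arguments bcol n {A B} F.

(* [shift] is multiplication by x on the cofree object, (m_j)_j |-> (m_(j+1))_j. *)
Definition shift n A : mhom (blk n A) (blk n A) := bcol n (fun j => bpr n A j.+1).
Arguments shift n A : clear implicits.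

Lemma bpr_shift n A j : bpr n A j \c shift n A = bpr n A j.+1.
Proof.
have [h|h] := ltnP j n; first by rewrite bpr_col.
by rewrite !bpr_ge ?cmp0m // ltnW.
Qed.

Lemma bpr_shift_pw n A j m : bpr n A j \c pw (shift n A) m = bpr n A (j + m).
Proof.
elim: m j => [|m IH] j; first by rewrite cmpm1 addn0.
by rewrite pwS cmpA bpr_shift IH addSnnS.
Qed.

Section Cofree.
Context (k : nat) (A : finType) (d : A -> int).
Hypothesis k0 : (0 < k)%N.

Lemma shift_nil : pw (shift k A) k = 0.
Proof.
apply: bpr_mono => j _; rewrite bpr_shift_pw cmpm0 bpr_ge //; exact: leq_addl.
Qed.

Lemma mdeg_shift c : mdeg (bdeg (n := k) d c) (bdeg (n := k) d c) 1 (shift k A).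
Proof.
apply: mdeg_to_blk => j _; rewrite bpr_shift.
by apply: (mdeg_eq (@mdeg_bpr k A d c j.+1)); lia.
Qed.

(** Coordinate 0 is sent to the top block. In the norm, only the term with left exponent [k - 1 - j]
    contributes to block [j], and it returns coordinate [j]. *)
Definition shift_unit : mhom (blk k A) (blk k A) := bin k A k.-1 \c bpr k A 0.

Lemma nrm_shift_unit : nrm k (shift k A) (shift k A) shift_unit = idm _.
Proof.
apply: bpr_mono => j hj; rewrite cmpm1 cmp_sumr.
have hj' : (k.-1 - j < k)%N by apply: leq_ltn_trans (leq_subr _ _) _; rewrite prednK.
have k1 : (k.-1 < k)%N by rewrite prednK.
have jk : (j <= k.-1)%N by rewrite -ltnS prednK.
rewrite (bigD1 (Ordinal hj')) //= big1 => [|t nt].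
  rewrite addr0 /shift_unit !cmpA bpr_shift_pw bpr_in // subnKC // eqxx cmp1m.
  by rewrite bpr_shift_pw subKn.
rewrite /shift_unit !cmpA bpr_shift_pw bpr_in // ifN ?cmp0m //.
apply: contraNneq nt => e; apply/eqP/val_inj => /=; lia.
Qed.

Lemma mdeg_shift_unit c : mdeg (bdeg (n := k) d c) (bdeg (n := k) d c) (1 - k%:Z) shift_unit.
Proof.
apply: (mdeg_eq (mdegM (@mdeg_bin k A d c k.-1) (@mdeg_bpr k A d c 0))).
lia.
Qed.

End Cofree.

Section Sum.
Context (A B : finType).
Definition sidx : mx_cat K := (A + B)%type : finType.
Definition sinl : mhom A sidx := fun x a => if x is inl b then (b == a)%:R else 0.
Definition sinr : mhom B sidx := fun x a => if x is inr b then (b == a)%:R else 0.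
Definition sprl : mhom sidx A := fun a x => if x is inl b then (a == b)%:R else 0.
Definition sprr : mhom sidx B := fun a x => if x is inr b then (a == b)%:R else 0.

Lemma sum_biproduct : is_biproduct sinl sinr sprl sprr.
Proof.
split; apply: mxP => x y; rewrite ?mx_addE ?mx_cmpE ?mx_idE ?mx_0E.
- rewrite big_sumType /= [X in _ + X]big1 ?addr0; last by move=> i _; rewrite mul0r.
  rewrite (bigD1 x) //= eqxx mul1r big1 ?addr0 // => i /negbTE.
  by rewrite eq_sym => ->; rewrite mul0r.
- rewrite big_sumType /= [X in X + _]big1 ?add0r; last by move=> i _; rewrite mul0r.
  rewrite (bigD1 x) //= eqxx mul1r big1 ?addr0 // => i /negbTE.
  by rewrite eq_sym => ->; rewrite mul0r.
- by rewrite big_sumType /= !big1 ?addr0 // => i _; rewrite ?mul0r ?mulr0.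
- by rewrite big_sumType /= !big1 ?addr0 // => i _; rewrite ?mul0r ?mulr0.
- case: x => x; case: y => y /=.
  + rewrite [X in _ + X]big1 ?addr0; last by move=> i _; rewrite mul0r.
    rewrite (bigD1 x) //= eqxx mul1r big1 ?addr0 // => i /negbTE.
    by rewrite eq_sym => ->; rewrite mul0r.
  + rewrite !big1 ?addr0 // => i _; by rewrite ?mul0r ?mulr0.
  + rewrite !big1 ?addr0 // => i _; by rewrite ?mul0r ?mulr0.
  + rewrite [X in X + _]big1 ?add0r; last by move=> i _; rewrite mul0r.
    rewrite (bigD1 x) //= eqxx mul1r big1 ?addr0 // => i /negbTE.
    by rewrite eq_sym => ->; rewrite mul0r.
Qed.

Context (dA : A -> int) (dB : B -> int).
Definition sdeg (x : sidx) : int := match x with inl a => dA a | inr b => dB b end.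

Lemma mdeg_sinl : mdeg dA sdeg 0 sinl.
Proof.
move=> [b|b] a /=; rewrite /sinl addr0; last by rewrite eqxx.
by have [->|_] := eqVneq b a; rewrite ?eqxx.
Qed.
Lemma mdeg_sinr : mdeg dB sdeg 0 sinr.
Proof.
move=> [b|b] a /=; rewrite /sinr addr0; first by rewrite eqxx.
by have [->|_] := eqVneq b a; rewrite ?eqxx.
Qed.
Lemma mdeg_sprl : mdeg sdeg dA 0 sprl.
Proof.
move=> a [b|b] /=; rewrite /sprl addr0; last by rewrite eqxx.
by have [->|_] := eqVneq a b; rewrite ?eqxx.
Qed.
Lemma mdeg_sprr : mdeg sdeg dB 0 sprr.
Proof.
move=> a [b|b] /=; rewrite /sprr addr0; first by rewrite eqxx.
by have [->|_] := eqVneq a b; rewrite ?eqxx.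
Qed.

End Sum.
End Blocks.
Arguments bpr {K} n A j.
Arguments bin {K} n A j.
Arguments bcol {K} n {A B} F.
Arguments shift {K} n A.
Arguments shift_unit {K} k A.
Arguments sinl {K} A B.
Arguments sinr {K} A B.
Arguments sprl {K} A B.
Arguments sprr {K} A B.
Arguments mdeg_bpr {K n A} d c j.
Arguments mdeg_bin {K n A} d c j.

(** * The graded matrix category *)

Section MatrixObjects.
Context (K : fieldType) (k : nat).
Notation mhom := (@hom K (mx_cat K)).

(* A generically free graded module, in a homogeneous basis over K[y]: the basis
   element a has degree [md a], and x maps b to \sum_a mX a b y^(md a - md b - 1) a. *)
Record mobj := MObj {
  mi : finType;
  md : mi -> int;
  mX : mhom mi mi;
  mX_deg : mdeg md md 1 mX;
  mX_nil : pw mX k = 0;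
  mX_unit : has_unit k mX }.
Arguments md V : clear implicits, rename.
Arguments mX V : clear implicits, rename.
Arguments mX_nil V : clear implicits, rename.
Arguments mX_deg V : clear implicits, rename.
Arguments mX_unit V : clear implicits, rename.

Definition is_mor (V W : mobj) (r : int) (f : mhom (mi V) (mi W)) :=
  f \c mX V = mX W \c f /\ mdeg (md V) (md W) r f.

(** The norm raises the degree by [k - 1], whence the bound on [s]. In degree 0 these are the maps
    that factor through a projective, by [ideal_null]. *)
Definition is_null (V W : mobj) (r : int) (f : mhom (mi V) (mi W)) :=
  exists2 s, mdeg (md V) (md W) (r + 1 - k%:Z) s & f = nrm k (mX V) (mX W) s.

Implicit Types U V W : mobj.

Lemma is_morM U V W r s (g : mhom (mi V) (mi W)) (f : mhom (mi U) (mi V)) :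
  is_mor r g -> is_mor s f -> is_mor (r + s) (g \c f).
Proof.
move=> [cg dg] [cf df]; split; last exact: (mdegM dg df).
by rewrite -cmpA cf !cmpA cg.
Qed.

Lemma is_mor_id V : is_mor (V := V) (W := V) 0 (idm _).
Proof. by split; [rewrite cmp1m cmpm1 | apply: mdeg_id]. Qed.

Lemma is_mor_lin V W r a (f g : mhom (mi V) (mi W)) :
  is_mor r f -> is_mor r g -> is_mor r (a *: f + g).
Proof. by move=> [cf df] [cg dg]; split; [rewrite cmpPl cmpPr cf cg | apply: mdegP]. Qed.

Lemma is_mor0 V W r : is_mor r (0 : mhom (mi V) (mi W)).
Proof. by split; [rewrite cmp0m cmpm0 | apply: mdeg0]. Qed.

Lemma is_morD V W r (f g : mhom (mi V) (mi W)) :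
  is_mor r f -> is_mor r g -> is_mor r (f + g).
Proof. by move=> hf hg; rewrite -[f]scale1r; apply: is_mor_lin. Qed.

Lemma is_morN V W r (f : mhom (mi V) (mi W)) : is_mor r f -> is_mor r (- f).
Proof.
by move=> hf; rewrite -scaleN1r -[_ *: _]addr0; apply: is_mor_lin => //; apply: is_mor0.
Qed.

Lemma is_mor_eq V W r r' (f : mhom (mi V) (mi W)) : is_mor r f -> r = r' -> is_mor r' f.
Proof. by move=> h <-. Qed.

Lemma is_null_mor V W r (f : mhom (mi V) (mi W)) : is_null r f -> is_mor r f.
Proof.
move=> [s ds ->]; split; first by apply: nrm_comm; apply: mX_nil.
by apply: (mdeg_eq (mdeg_nrm (mX_deg V) (mX_deg W) ds)); lia.
Qed.

Lemma is_null_l U V W r s (g : mhom (mi V) (mi W)) (f : mhom (mi U) (mi V)) :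
  is_mor r g -> is_null s f -> is_null (r + s) (g \c f).
Proof.
move=> [cg dg] [t dt ->]; exists (g \c t); last by rewrite (nrm_l _ _ _ cg).
by apply: (mdeg_eq (mdegM dg dt)); lia.
Qed.

Lemma is_null_r U V W r s (g : mhom (mi V) (mi W)) (f : mhom (mi U) (mi V)) :
  is_null r g -> is_mor s f -> is_null (r + s) (g \c f).
Proof.
move=> [t dt ->] [cf df]; exists (t \c f); last by rewrite (nrm_r _ _ _ cf).
by apply: (mdeg_eq (mdegM dt df)); lia.
Qed.

(* [conflation a b i p r s]: i and p are morphisms of degrees a and b, and r, s split
   them in the category of graded K[y]-modules. *)
Record conflation U V W (a b : int) (i : mhom (mi U) (mi V)) (p : mhom (mi V) (mi W))
    (r : mhom (mi V) (mi U)) (s : mhom (mi W) (mi V)) : Prop := Conflation {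
  cf_i : is_mor a i;
  cf_p : is_mor b p;
  cf_r : mdeg (md V) (md U) (- a) r;
  cf_s : mdeg (md W) (md V) (- b) s;
  cf_split : split_seq i p r s }.

Section Conflation.
Context (U V W : mobj) (a b : int) (i : mhom (mi U) (mi V)) (p : mhom (mi V) (mi W))
    (r : mhom (mi V) (mi U)) (s : mhom (mi W) (mi V)) (cf : conflation a b i p r s).

Lemma conf_ker T c (f : mhom (mi T) (mi V)) : is_mor c f -> p \c f = 0 ->
  exists2 g, is_mor (c - a) g & f = i \c g.
Proof.
move=> [cff df] pf; have e := split_ker (cf_split cf) pf.
exists (r \c f) => //; split; last first.
  by apply: (mdeg_eq (mdegM (cf_r cf) df)); rewrite addrC.
by apply: (split_ker_comm (cf_split cf) (cf_i cf).1); rewrite -e.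
Qed.

Lemma conf_coker T c (f : mhom (mi V) (mi T)) : is_mor c f -> f \c i = 0 ->
  exists2 g, is_mor (c - b) g & f = g \c p.
Proof.
move=> [cff df] fi; have e := split_coker (cf_split cf) fi.
exists (f \c s) => //; split; last exact: (mdegM df (cf_s cf)).
by apply: (split_coker_comm (cf_split cf) (cf_p cf).1); rewrite -e.
Qed.

Lemma conf_ext T c (f : mhom (mi U) (mi T)) : is_null c f ->
  exists2 g, is_null (c - a) g & f = g \c i.
Proof.
move=> [t dt ->]; exists (nrm k (mX V) (mX T) (t \c r)); last first.
  exact: (split_ext _ (cf_split cf) (cf_i cf).1).
exists (t \c r) => //; apply: (mdeg_eq (mdegM dt (cf_r cf))); lia.
Qed.

Lemma conf_lift T c (f : mhom (mi T) (mi W)) : is_null c f ->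
  exists2 g, is_null (c - b) g & f = p \c g.
Proof.
move=> [t dt ->]; exists (nrm k (mX T) (mX V) (s \c t)); last first.
  exact: (split_lift _ (cf_split cf) (cf_p cf).1).
exists (s \c t) => //; apply: (mdeg_eq (mdegM (cf_s cf) dt)); lia.
Qed.

End Conflation.

Section ConflationMaps.
Context (U V W U' V' W' : mobj) (a b a' b' : int)
  (i : mhom (mi U) (mi V)) (p : mhom (mi V) (mi W))
  (r : mhom (mi V) (mi U)) (s : mhom (mi W) (mi V)) (cf : conflation a b i p r s)
  (i' : mhom (mi U') (mi V')) (p' : mhom (mi V') (mi W'))
  (r' : mhom (mi V') (mi U')) (s' : mhom (mi W') (mi V')) (cf' : conflation a' b' i' p' r' s').

Definition conf_map (f : mhom (mi U) (mi U')) (g : mhom (mi V) (mi V'))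
  (h : mhom (mi W) (mi W')) := g \c i = i' \c f /\ h \c p = p' \c g.

Hypothesis inj : is_null (V := V') (W := V') 0 (idm _).

(** The middle term [V'] is relatively injective since its identity is null, so [f] extends to the
    middle terms and then induces a map of cokernels. *)
Lemma conf_map_ex c (f : mhom (mi U) (mi U')) : is_mor c f ->
  exists g h, [/\ is_mor (c + a' - a) g, is_mor (c + a' - a + b' - b) h & conf_map f g h].
Proof.
move=> hf; have hif : is_mor (c + a') (i' \c f).
  by apply: (is_mor_eq (is_morM (cf_i cf') hf)); rewrite addrC.
have nif : is_null (c + a') (i' \c f).
  by have := is_null_r inj hif; rewrite cmp1m add0r.
have [g /is_null_mor hg eg] := conf_ext cf nif.
have hpg : is_mor (c + a' - a + b') (p' \c g).
  by apply: (is_mor_eq (is_morM (cf_p cf') hg)); rewrite addrC.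
have [h hh eh] : exists2 h, is_mor (c + a' - a + b' - b) h & p' \c g = h \c p.
  apply: (conf_coker cf hpg); have [pi _ _ _] := cf_split cf'.
  by rewrite -cmpA -eg cmpA pi cmp0m.
by exists g, h; split=> //; split.
Qed.

Lemma conf_map_null c (f : mhom (mi U) (mi U')) g h :
  is_null c f -> is_mor (c + a' - a) g -> conf_map f g h ->
  is_null (c + a' - a + b' - b) h.
Proof.
move=> nf hg [e1 e2]; have [e ne ee] := conf_ext cf nf.
have hie : is_mor (c + a' - a) (i' \c e).
  by apply: (is_mor_eq (is_morM (cf_i cf') (is_null_mor ne))); lia.
have : (g - i' \c e) \c i = 0 by rewrite cmpBl e1 -cmpA -ee subrr.
move/(conf_coker cf (is_morD hg (is_morN hie))) => [t ht et].
have -> : h = p' \c (idm _ \c t).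
  apply: (split_epi (cf_split cf)); rewrite cmp1m e2 -[RHS]cmpA -et cmpBr.
  by have [pi _ _ _] := cf_split cf'; rewrite cmpA pi cmp0m subr0.
have -> : c + a' - a + b' - b = b' + (0 + (c + a' - a - b)) by lia.
apply: is_null_l; first exact: cf_p cf'.
exact: is_null_r inj ht.
Qed.

End ConflationMaps.

Definition mor_iso V W (v : mhom (mi V) (mi W)) (v' : mhom (mi W) (mi V)) :=
  [/\ is_mor 0 v, is_mor 0 v', v' \c v = idm _ & v \c v' = idm _].

Section Triangular.
Context (V W : mobj) (c : mhom (mi W) (mi V)).
Notation A := (mi V).
Notation B := (mi W).

(** The extension of [W] by [V] with cocycle [c], in block triangular form. Nilpotency of the
    diagonal blocks only bounds the order of nilpotency by [2k], so the vanishing of the [k]-th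
    power is a condition on [c], the hypothesis [nil] below. *)
Definition tri_X : mhom (sidx K A B) (sidx K A B) :=
  sinl A B \c mX V \c sprl A B + sinl A B \c c \c sprr A B
    + sinr A B \c mX W \c sprr A B.

Lemma tri_split : split_seq (sinl (K := K) A B) (sprr A B) (sprl A B) (sinr A B).
Proof. by have [*] := sum_biproduct K A B; split. Qed.

Lemma tri_inl : sinl A B \c mX V = tri_X \c sinl A B.
Proof.
have [e11 e22 e21 e12 e] := sum_biproduct K A B.
by rewrite !cmpDl -!cmpA e21 e11 !cmpm0 !addr0 cmpm1.
Qed.

Lemma tri_prr : sprr A B \c tri_X = mX W \c sprr A B.
Proof.
have [e11 e22 e21 e12 e] := sum_biproduct K A B.
by rewrite !cmpDr !cmpA e21 e22 !cmp0m !add0r cmp1m.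
Qed.

Lemma tri_inr : tri_X \c sinr A B = sinl A B \c c + sinr A B \c mX W.
Proof.
have [e11 e22 e21 e12 e] := sum_biproduct K A B.
by rewrite !cmpDl -!cmpA e12 e22 !cmpm1 !cmpm0 add0r.
Qed.

Hypothesis dc : mdeg (md W) (md V) 1 c.
Hypothesis nil : pw tri_X k = 0.

Lemma tri_deg : mdeg (sdeg (K := K) (md V) (md W)) (sdeg (K := K) (md V) (md W)) 1 tri_X.
Proof.
have l1 := mdeg_sinl (K := K) (md V) (md W). have l2 := mdeg_sinr (K := K) (md V) (md W).
have l3 := mdeg_sprl (K := K) (md V) (md W). have l4 := mdeg_sprr (K := K) (md V) (md W).
apply: mdegD; first apply: mdegD.
- by apply: (mdeg_eq (mdegM (mdegM l1 (mX_deg V)) l3)); lia.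
- by apply: (mdeg_eq (mdegM (mdegM l1 dc) l4)); lia.
- by apply: (mdeg_eq (mdegM (mdegM l2 (mX_deg W)) l4)); lia.
Qed.

Definition mtri := MObj tri_deg nil
  (has_unit_ext tri_split tri_inl tri_prr nil (mX_unit V) (mX_unit W)).

Lemma tri_conf : conflation (V := mtri) 0 0 (sinl A B) (sprr A B) (sprl A B) (sinr A B).
Proof.
split; rewrite ?oppr0.
- by split; [exact: tri_inl | exact: mdeg_sinl].
- by split; [exact: tri_prr | exact: mdeg_sprr].
- exact: mdeg_sprl.
- exact: mdeg_sinr.
- exact: tri_split.
Qed.

End Triangular.

Lemma msum_ex V W : exists Z i1 i2 p1 p2,
  [/\ @is_biproduct K (mx_cat K) (mi V) (mi W) (mi Z) i1 i2 p1 p2,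
      is_mor 0 i1, is_mor 0 i2, is_mor 0 p1 & is_mor 0 p2].
Proof.
have bp := sum_biproduct K (mi V) (mi W); have [_ _ _ _ e] := bp.
have d0 : mdeg (md W) (md V) 1 (0 : mhom (mi W) (mi V)) by move=> b a; rewrite mx_0E eqxx.
have xr : sinr (mi V) (mi W) \c mX W = tri_X (V := V) (W := W) 0 \c sinr (mi V) (mi W).
  by rewrite tri_inr cmpm0 add0r.
have xl := tri_inl (V := V) (W := W) 0.
have n0 : pw (tri_X (V := V) (W := W) 0) k = 0.
  rewrite -[LHS]cmpm1 -e cmpDr !cmpA -(pw_comm _ xl) -(pw_comm _ xr) !mX_nil.
  by rewrite !cmpm0 !cmp0m addr0.
have cf := tri_conf d0 n0.
exists (mtri d0 n0), (sinl _ _), (sinr _ _), (sprl _ _), (sprr _ _).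
split=> //; [exact: cf_i cf | | | exact: cf_p cf].
- by split; [exact: xr | exact: mdeg_sinr].
- split; last exact: mdeg_sprl.
  have [e11 e22 e21 e12 _] := bp.
  by rewrite /= /tri_X cmpm0 cmp0m addr0 cmpDr !cmpA e11 e12 !cmp0m addr0 cmp1m.
Qed.

(** The given sequence splits over K[y], so the pushout lives on the sum of [Y] and [W], with the
    operator twisted by the cocycle [c]. *)
Lemma mpush_ex U V W Y (i : mhom (mi U) (mi V)) (p : mhom (mi V) (mi W)) r s
    (u : mhom (mi U) (mi Y)) :
  conflation 0 0 i p r s -> is_mor 0 u ->
  exists Z (q : mhom (mi V) (mi Z)) (v : mhom (mi Y) (mi Z)),
    [/\ is_mor 0 q, is_mor 0 v, q \c i = v \c u &
     forall T (q' : mhom (mi V) (mi T)) (v' : mhom (mi Y) (mi T)),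
       is_mor 0 q' -> is_mor 0 v' -> q' \c i = v' \c u ->
       exists! w, is_mor 0 w /\ (w \c q = q' /\ w \c v = v')].
Proof.
move=> cf hu; have [pi ri ps e] := cf_split cf.
have rs := split_rs (cf_split cf).
have [e11 e22 e21 e12 eS] := sum_biproduct K (mi Y) (mi W).
pose c := u \c r \c mX V \c s.
have dr : mdeg (md V) (md U) 0 r by rewrite -[0]oppr0; apply: cf_r cf.
have ds : mdeg (md W) (md V) 0 s by rewrite -[0]oppr0; apply: cf_s cf.
have dc : mdeg (md W) (md Y) 1 c.
  by apply: (mdeg_eq (mdegM (mdegM (mdegM hu.2 dr) (mX_deg V)) ds)); lia.
pose v := sinl (K := K) (mi Y) (mi W).
pose q : mhom (mi V) (sidx K (mi Y) (mi W)) := v \c u \c r + sinr _ _ \c p.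
have xl : v \c mX Y = tri_X c \c v := tri_inl c.
(* The cocycle measures the failure of [u \c r] to commute with the operators. *)
have key : c \c p = u \c r \c mX V - mX Y \c u \c r.
  rewrite /c -cmpA (canRL (addKr _) e) cmpDr cmpm1 cmpNr addrC; congr (_ - _).
  rewrite -hu.1 -!cmpA [mX V \c (i \c r)]cmpA -(cf_i cf).1.
  by rewrite -[i \c _ \c r]cmpA [r \c (i \c _)]cmpA ri cmp1m.
have qc : q \c mX V = tri_X c \c q.
  rewrite /q cmpDl cmpDr [tri_X c \c (v \c u \c r)]cmpA [tri_X c \c (v \c u)]cmpA -xl.
  rewrite [tri_X c \c (_ \c p)]cmpA tri_inr cmpDl -(cmpA _ c p) key.
  rewrite -(cmpA _ p) (cf_p cf).1 !cmpA addrA; congr (_ + _).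
  by rewrite cmpBr !cmpA addrC subrK.
have inrE : sinr (mi Y) (mi W) = q \c s.
  by rewrite /q cmpDl -!cmpA rs !cmpm0 ps cmpm1 add0r.
(* [v] and [q] commute with the operators and are jointly onto, so nilpotency is inherited from [Y]
   and [V]. *)
have n0 : pw (tri_X c) k = 0.
  rewrite -[LHS]cmpm1 -eS inrE cmpDr !cmpA -(pw_comm _ xl) -(pw_comm _ qc) !mX_nil.
  by rewrite !cmpm0 !cmp0m addr0.
have cfZ := tri_conf dc n0.
have dq : mdeg (md V) (md (mtri dc n0)) 0 q.
  apply: mdegD.
    by apply: (mdeg_eq (mdegM (mdegM (cf_i cfZ).2 hu.2) dr)); lia.
  by apply: (mdeg_eq (mdegM (mdeg_sinr _ _) (cf_p cf).2)); lia.
have joint T (f g : mhom (sidx K (mi Y) (mi W)) T) :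
    f \c q = g \c q -> f \c v = g \c v -> f = g.
  move=> fq fv; rewrite -[f]cmpm1 -[g]cmpm1 -eS inrE !cmpDr !cmpA.
  by rewrite fv fq.
exists (mtri dc n0), q, v; split.
- by split.
- exact: cf_i cfZ.
- by rewrite /q cmpDl -!cmpA ri pi cmpm1 cmpm0 addr0.
move=> T q' v' hq' hv' e'.
pose w := v' \c sprl _ _ + q' \c s \c sprr _ _.
have wv : w \c v = v' by rewrite /w cmpDl -!cmpA e11 e21 !cmpm0 addr0 cmpm1.
have wr : w \c sinr _ _ = q' \c s by rewrite /w cmpDl -!cmpA e12 e22 !cmpm0 add0r cmpm1.
have wq : w \c q = q'.
  by rewrite {1}/q cmpDr !cmpA wv wr -e' -!cmpA -cmpDr e cmpm1.
exists w; split; last first.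
  by move=> w1 [_ [e1 e2]]; apply: joint; rewrite ?e1 ?e2.
split=> //; split.
  apply: joint; rewrite -!cmpA.
    by rewrite -/(mX (mtri dc n0)) /= -qc cmpA wq hq'.1 //.
  by rewrite /= -xl cmpA wv hv'.1.
apply: mdegD.
  by apply: (mdeg_eq (mdegM hv'.2 (mdeg_sprl _ _))); lia.
by apply: (mdeg_eq (mdegM (mdegM hq'.2 ds) (mdeg_sprr _ _))); lia.
Qed.

Lemma mshift_deg c V : mdeg (fun a => md V a + c) (fun a => md V a + c) 1 (mX V).
Proof. by move=> b a /(mX_deg V b a) ?; lia. Qed.

Definition mshift (c : int) (V : mobj) : mobj :=
  MObj (@mshift_deg c V) (mX_nil V) (mX_unit V).

(** Shifting leaves matrices alone and moves only the degrees, so a morphism of degree [r] can stand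
    for a degree 0 morphism with shifted source or target. *)
Lemma mshift_mor c V : is_mor (V := V) (W := mshift c V) c (idm _) /\
  is_mor (V := mshift c V) (W := V) (- c) (idm _).
Proof.
split; split; rewrite ?cmp1m ?cmpm1 // => b a; rewrite mx_idE.
  by have [->|] := eqVneq b a; rewrite ?eqxx.
by have [->|] := eqVneq b a; rewrite ?eqxx //= addrK.
Qed.

Hypothesis k2 : (2 <= k)%N.
Let k0 : (0 < k)%N. Proof. exact: ltnW. Qed.

Lemma shift_has_unit A : has_unit k (shift (K := K) k A).
Proof. by exists (shift_unit k A); apply: nrm_shift_unit. Qed.

Definition mfree (A : finType) (d : A -> int) : mobj :=
  MObj (mdeg_shift (K := K) d k0 0) (shift_nil K k A) (shift_has_unit A).

Lemma mfree_null (A : finType) (d : A -> int) : is_null (V := mfree d) (W := mfree d) 0 (idm _).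
Proof.
exists (shift_unit k A); last by rewrite nrm_shift_unit.
by apply: (mdeg_eq (mdeg_shift_unit d k0 0)); rewrite add0r.
Qed.

Section Cosyzygy.
Context (V : mobj).
Notation A := (mi V).
Notation X := (mX V).
Notation pr := (bpr (K := K) k A).
Notation pr' := (bpr (K := K) k.-1 A).

Definition mI := mfree (md V).
(** The hull is the coinduced module Hom_K(K[x]/(x^k), M). [co_i] sends [m] to the sequence (x^j
    m)_j, and [co_p] records by how much a sequence fails to be of this form. *)
Definition co_i : mhom A (mi mI) := bcol k (fun j => pw X j).
Definition co_p : mhom (mi mI) (blk K k.-1 A) := bcol k.-1 (fun j => pr j.+1 - X \c pr j).
Definition co_r : mhom (mi mI) A := pr 0.
(** The solution of the recursion m_(j+1) = X m_j + n_j with m_0 = 0, hence a section of [co_p] that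
    [co_r] kills. *)
Definition co_s : mhom (blk K k.-1 A) (mi mI) :=
  bcol k (fun j => \sum_(l < j) pw X (j - l.+1) \c pr' l).

Lemma pr_i j : (j < k)%N -> pr j \c co_i = pw X j.
Proof. by move=> h; rewrite bpr_col. Qed.

Lemma pr_p j : (j < k.-1)%N -> pr' j \c co_p = pr j.+1 - X \c pr j.
Proof. by move=> h; rewrite bpr_col. Qed.

Lemma pr_s j : (j < k)%N -> pr j \c co_s = \sum_(l < j) pw X (j - l.+1) \c pr' l.
Proof. by move=> h; rewrite bpr_col. Qed.

Lemma pr_sS j : (j.+1 < k)%N -> pr j.+1 \c co_s = pr' j + X \c (pr j \c co_s).
Proof.
move=> h; rewrite !pr_s ?(ltnW h) // big_ord_recr /= subnn cmp1m addrC; congr (_ + _).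
rewrite cmp_sumr; apply: eq_bigr => l _.
by rewrite [RHS]cmpA -pwS -subSn.
Qed.

Lemma ltk1 j : (j < k.-1)%N -> (j.+1 < k)%N. Proof. by lia. Qed.

Lemma co_split : split_seq co_i co_p co_r co_s.
Proof.
have ri : co_r \c co_i = idm _ by rewrite pr_i.
split=> //.
- apply: bpr_mono => j hj; rewrite cmpm0 cmpA pr_p // cmpBl -cmpA !pr_i ?ltk1 //.
    by rewrite -pwS subrr.
  exact: ltnW (ltk1 hj).
- apply: bpr_mono => j hj; rewrite cmpm1 cmpA pr_p // cmpBl -cmpA pr_sS ?ltk1 //.
  by rewrite addrK.
apply: bpr_mono; elim=> [|j IH] hj; rewrite cmpm1 cmpDr !cmpA pr_i ?(ltnW hj) //.
  by rewrite cmp1m pr_s // big_ord0 cmp0m addr0.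
have e : pw X j \c co_r + pr j \c (co_s \c co_p) = pr j.
  have := IH (ltnW hj); rewrite cmpm1 cmpDr !cmpA pr_i ?(ltnW hj) //.
rewrite pr_sS // cmpDl pr_p; last by lia.
by rewrite pwS -!cmpA addrCA -cmpDr e subrK.
Qed.

Lemma co_i_comm : co_i \c X = mX mI \c co_i.
Proof.
apply: bpr_mono => j hj; rewrite !cmpA bpr_shift pr_i // -pwSr.
have [h|h] := ltnP j.+1 k; first by rewrite pr_i.
rewrite bpr_ge // cmp0m; have -> : j.+1 = k by apply/eqP; rewrite eqn_leq hj h.
exact: mX_nil.
Qed.

Definition co_X := co_p \c mX mI \c co_s.

Lemma co_p_comm : co_p \c mX mI = co_X \c co_p.
Proof.
have [pi _ _ e] := co_split.
rewrite /co_X -[RHS]cmpA (canRL (addKr _) e) cmpDr cmpm1 cmpNr !cmpA -[co_p \c _ \c co_i]cmpA.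
by rewrite -co_i_comm !cmpA pi !cmp0m oppr0 add0r.
Qed.

Notation dS := (bdeg (n := k.-1) (md V) 1).

Lemma co_i_mor : mdeg (md V) (md mI) 0 co_i.
Proof.
apply: mdeg_to_blk => j hj; rewrite pr_i //.
by apply: (mdeg_eq (mdeg_pw (mX_deg V))); rewrite addr0 add0r.
Qed.

Lemma mdeg_pr j : mdeg (md mI) (md V) j%:Z (pr j).
Proof. by apply: (mdeg_eq (mdeg_bpr _ _ _)); rewrite addr0. Qed.

Arguments mdeg_pr j : clear implicits.

Lemma co_p_deg : mdeg (md mI) dS 0 co_p.
Proof.
apply: mdeg_to_blk => j hj; rewrite pr_p //; apply: mdegB.
  by apply: (mdeg_eq (mdeg_pr _)); lia.
by apply: (mdeg_eq (mdegM (mX_deg V) (mdeg_pr _))); lia.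
Qed.

Lemma co_s_deg : mdeg dS (md mI) 0 co_s.
Proof.
apply: mdeg_to_blk => j hj; rewrite pr_s //; apply: mdeg_sum => l _.
apply: (mdeg_eq (mdegM (mdeg_pw (mX_deg V)) (mdeg_bpr _ _ _))).
by case: l => l /=; lia.
Qed.

Lemma co_X_deg : mdeg dS dS 1 co_X.
Proof.
by apply: (mdeg_eq (mdegM (mdegM co_p_deg (mX_deg mI)) co_s_deg)); lia.
Qed.

Definition mS : mobj := MObj co_X_deg
  (split_nil_quo co_split co_p_comm (mX_nil mI))
  (has_unit_quo co_split co_i_comm co_p_comm (mX_nil mI) (mX_unit V) (mX_unit mI)).

Lemma co_conf : conflation (W := mS) 0 0 co_i co_p co_r co_s.
Proof.
split.
- by split; [exact: co_i_comm | exact: co_i_mor].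
- by split; [exact: co_p_comm | exact: co_p_deg].
- by rewrite oppr0; apply: mdeg_pr.
- by rewrite oppr0; apply: co_s_deg.
- exact: co_split.
Qed.

(* The cosyzygy is also a syzygy of V, shifted by k: x - V's own x on the cofree object
   induces the embedding [sy_a], and [sy_b] is evaluation of T at x. *)
Definition sy_D : mhom (mi mI) (mi mI) := bcol k (fun j => pr j.+1 - X \c pr j).
Definition sy_a : mhom (mi mS) (mi mI) := sy_D \c co_s.
Definition sy_b : mhom (mi mI) A := \sum_(j < k) pw X (k.-1 - j) \c pr j.
Definition sy_r : mhom (mi mI) (mi mS) := bcol k.-1 (fun j => pr j).
Definition sy_s : mhom A (mi mI) := bin k A k.-1.

Lemma pr_D j : (j < k)%N -> pr j \c sy_D = pr j.+1 - X \c pr j.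
Proof. by move=> h; rewrite bpr_col. Qed.

Lemma sy_Di : sy_D \c co_i = 0.
Proof.
apply: bpr_mono => j hj; rewrite cmpm0 cmpA pr_D // cmpBl -cmpA (pr_i hj) -pwS.
have [h|h] := ltnP j.+1 k; first by rewrite pr_i // subrr.
rewrite bpr_ge // cmp0m; have -> : j.+1 = k by apply/eqP; rewrite eqn_leq hj h.
by rewrite mX_nil subrr.
Qed.

Lemma sy_ap : sy_a \c co_p = sy_D.
Proof.
have [_ _ _ e] := co_split.
rewrite /sy_a -cmpA (canRL (addKr _) e) cmpDr cmpm1 cmpNr cmpA sy_Di cmp0m oppr0.
by rewrite add0r.
Qed.

(** The partial sums up to [n] telescope to [pw X (k - n) \c pr n], and for [n = k] this projection
    is out of range, hence zero. *)
Lemma sy_bD : sy_b \c sy_D = 0.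
Proof.
rewrite cmp_suml; have : forall n, (n <= k)%N ->
    \sum_(j < n) pw X (k.-1 - j) \c pr j \c sy_D = pw X (k - n) \c pr n.
  elim=> [_|n IH hn].
    by rewrite big_ord0 subn0 mX_nil cmp0m.
  rewrite big_ord_recr /= IH ?(ltnW hn) // -cmpA pr_D // cmpBr.
  rewrite cmpA -pwSr -subSn; last by lia.
  have -> : (k.-1.+1 - n = k - n)%N by lia.
  by rewrite addrC subrK; have -> : (k.-1 - n = k - n.+1)%N by lia.
by move/(_ k (leqnn k)) => ->; rewrite bpr_ge // cmpm0.
Qed.

Lemma sy_ba : sy_b \c sy_a = 0.
Proof. by rewrite cmpA sy_bD cmp0m. Qed.

Lemma pr_r j : (j < k.-1)%N -> pr' j \c sy_r = pr j.
Proof. by move=> h; rewrite bpr_col. Qed.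

Lemma sy_ra : sy_r \c sy_a = idm _.
Proof.
have [_ _ ps _] := co_split.
apply: bpr_mono => j hj; rewrite cmpm1 cmpA pr_r // cmpA pr_D; last by lia.
by rewrite -pr_p // -cmpA ps cmpm1.
Qed.

Lemma sy_bs : sy_b \c sy_s = idm _.
Proof.
have hk : (k.-1 < k)%N by lia.
rewrite cmp_suml (bigD1 (Ordinal hk)) //= -cmpA bpr_in // eqxx subnn cmp1m.
rewrite big1 ?addr0 // => j nj; rewrite -cmpA bpr_in // ifN ?cmpm0 //.
Qed.

Lemma sy_split : split_seq sy_a sy_b sy_r sy_s.
Proof.
split; [exact: sy_ba | exact: sy_ra | exact: sy_bs |].
have hk : (k.-1 < k)%N by lia.
have lt j : (j < k.-1)%N -> pr j \c (sy_a \c sy_r + sy_s \c sy_b) = pr j.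
  move=> hj; rewrite cmpDr !cmpA bpr_in // ifN; last by rewrite ltn_eqF.
  rewrite cmp0m addr0 pr_D; last by lia.
  have [_ _ ps _] := co_split.
  by rewrite -pr_p // -[_ \c co_s]cmpA ps cmpm1 pr_r.
apply: bpr_mono => j hj; rewrite cmpm1.
have [h|h] := ltnP j k.-1; first exact: lt.
have -> : j = k.-1 by lia.
(* the top coordinate is determined by the vanishing of [sy_b] *)
have e : sy_b \c (sy_a \c sy_r + sy_s \c sy_b) = sy_b.
  rewrite cmpDr [sy_b \c (sy_a \c _)]cmpA sy_ba [sy_b \c (sy_s \c _)]cmpA sy_bs.
  by rewrite cmp0m add0r cmp1m.
move: (sy_a \c sy_r + sy_s \c sy_b) lt e => E lt; rewrite /sy_b.
have recr T (F : nat -> mhom T A) : \sum_(i < k) F i = \sum_(i < k.-1) F i + F k.-1.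
  by rewrite -[in LHS](prednK k0) big_ord_recr.
rewrite cmp_suml (recr _ (fun i => pw X (k.-1 - i) \c pr i \c E)).
rewrite (recr _ (fun i => pw X (k.-1 - i) \c pr i)) subnn !cmp1m.
rewrite (eq_bigr (fun i : 'I_k.-1 => pw X (k.-1 - i) \c pr i)); first exact: addrI.
by move=> i _; rewrite -cmpA lt.
Qed.

Lemma sy_D_comm : sy_D \c mX mI = mX mI \c sy_D.
Proof.
apply: bpr_mono => j hj; rewrite !cmpA bpr_shift pr_D // cmpBl -cmpA !bpr_shift.
have [h|h] := ltnP j.+1 k; first by rewrite pr_D.
by rewrite !bpr_ge ?cmpm0 ?cmp0m ?subrr // ltnW.
Qed.

Lemma sy_a_comm : sy_a \c mX mS = mX mI \c sy_a.
Proof.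
have pc : co_p \c mX mI = mX mS \c co_p := co_p_comm.
apply: (split_epi co_split).
by rewrite -[LHS]cmpA -pc [LHS]cmpA sy_ap -[RHS]cmpA sy_ap sy_D_comm.
Qed.

Lemma sy_b_comm : sy_b \c mX mI = X \c sy_b.
Proof.
apply/eqP; rewrite -subr_eq0; apply/eqP; rewrite -[RHS]sy_bD.
rewrite cmp_sumr !cmp_suml -sumrB; apply: eq_bigr => j _.
rewrite -!cmpA bpr_shift pr_D // cmpBr; congr (_ - _).
by rewrite !cmpA -pwS -pwSr.
Qed.

(** The degrees 1 and [k - 1] are what makes Sigma^2 a shift by [k]: splicing with [co_conf], whose
    degrees are 0, gives a total of [k]. *)
Lemma sy_conf : conflation (U := mS) (V := mI) (W := V) 1 (k%:Z - 1) sy_a sy_b sy_r sy_s.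
Proof.
split.
- split; first exact: sy_a_comm.
  have dD : mdeg (md mI) (md mI) 1 sy_D.
    apply: mdeg_to_blk => j hj; rewrite pr_D //; apply: mdegB.
      by apply: (mdeg_eq (mdeg_pr _)); lia.
    by apply: (mdeg_eq (mdegM (mX_deg V) (mdeg_pr _))); lia.
  by apply: (mdeg_eq (mdegM dD co_s_deg)); lia.
- split; first exact: sy_b_comm.
  apply: mdeg_sum => j _; apply: (mdeg_eq (mdegM (mdeg_pw (mX_deg V)) (mdeg_pr _))).
  by case: j => j /=; lia.
- apply: mdeg_to_blk => j hj; rewrite pr_r //.
  by apply: (mdeg_eq (mdeg_pr _)); lia.
- by apply: (mdeg_eq (mdeg_bin _ _ _)); lia.
- exact: sy_split.
Qed.

End Cosyzygy.
Arguments co_i V : clear implicits.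
Arguments co_p V : clear implicits.
Arguments co_r V : clear implicits.
Arguments co_s V : clear implicits.
Arguments sy_D V : clear implicits.
Arguments sy_a V : clear implicits.
Arguments sy_b V : clear implicits.
Arguments sy_r V : clear implicits.
Arguments sy_s V : clear implicits.
Arguments mdeg_pr V j : clear implicits.
Arguments co_p_deg V : clear implicits.
Arguments co_s_deg V : clear implicits.

(** A canonical lift of [f] to the hulls, compatible with [co_conf] and with [sy_conf] at once. The
    naturality of the comparison of Sigma^2 with the shift is checked on it. *)
Definition co_map (V W : mobj) (f : mhom (mi V) (mi W)) : mhom (mi (mI V)) (mi (mI W)) :=
  bcol k (fun j => f \c bpr k (mi V) j).
Definition co_susp (V W : mobj) (f : mhom (mi V) (mi W)) : mhom (mi (mS V)) (mi (mS W)) :=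
  co_p W \c co_map f \c co_s V.

Section CosyzygyMap.
Context (V W : mobj) (f : mhom (mi V) (mi W)) (hf : is_mor 0 f).

Lemma pr_map j : bpr k (mi W) j \c co_map f = f \c bpr k (mi V) j.
Proof.
have [h|h] := ltnP j k; first by rewrite bpr_col.
by rewrite !bpr_ge // cmp0m cmpm0.
Qed.

Lemma co_map_mor : is_mor (V := mI V) (W := mI W) 0 (co_map f).
Proof.
split.
  apply: bpr_mono => j hj.
  by rewrite !cmpA pr_map bpr_shift pr_map -cmpA bpr_shift.
apply: mdeg_to_blk => j hj; rewrite pr_map.
by apply: (mdeg_eq (mdegM hf.2 (mdeg_pr V j))); rewrite addr0.
Qed.

Lemma co_map_i : co_map f \c co_i V = co_i W \c f.
Proof.
apply: bpr_mono => j hj; rewrite !cmpA pr_map -[LHS]cmpA !pr_i //.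
exact: (pw_comm _ hf.1).
Qed.

Lemma co_map_p : co_susp f \c co_p V = co_p W \c co_map f.
Proof.
have [_ _ _ e] := co_split V.
rewrite /co_susp -!cmpA (canRL (addKr _) e) cmpDr cmpm1 cmpNr cmpA co_map_i.
have [pi _ _ _] := co_split W.
by rewrite cmpDr cmpNr !cmpA pi !cmp0m oppr0 add0r.
Qed.

Lemma co_map_D : co_map f \c sy_D V = sy_D W \c co_map f.
Proof.
apply: bpr_mono => j hj; rewrite !cmpA pr_map -[LHS]cmpA !pr_D // cmpBl cmpBr.
by rewrite pr_map -[X in _ = _ - X]cmpA pr_map !cmpA hf.1.
Qed.

Lemma co_map_a : co_map f \c sy_a V = sy_a W \c co_susp f.
Proof.
apply: (split_epi (co_split V)); rewrite -[LHS]cmpA sy_ap co_map_D.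
by rewrite -[RHS]cmpA co_map_p [RHS]cmpA sy_ap.
Qed.

Lemma co_map_b : f \c sy_b V = sy_b W \c co_map f.
Proof.
rewrite cmp_sumr cmp_suml; apply: eq_bigr => j _.
by rewrite -[RHS]cmpA pr_map !cmpA (pw_comm _ hf.1).
Qed.

End CosyzygyMap.

End MatrixObjects.
Arguments md {K k} V a : rename.
Arguments mX {K k} V : rename.
Arguments mX_deg {K k} V : rename.
Arguments mX_nil {K k} V : rename.
Arguments mX_unit {K k} V : rename.
Arguments mfree {K k} k2 {A} d.
Arguments mI {K k} k2 V.
Arguments mS {K k} k2 V.
Arguments co_i {K k} k2 V.
Arguments co_p {K k} k2 V.
Arguments co_r {K k} k2 V.
Arguments co_s {K k} k2 V.
Arguments sy_a {K k} k2 V.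
Arguments sy_b {K k} k2 V.
Arguments sy_r {K k} k2 V.
Arguments sy_s {K k} k2 V.
Arguments mshift {K k} c V.

(** * Modules over B[x]/(x^k) *)

Section TruncatedPolynomials.
Context (B : comNzRingType) (k : nat).
Hypothesis k0 : (0 < k)%N.
Notation Q := {poly %/ ('X^k : {poly B})}.

Lemma coef_in_qpoly (p : {poly B}) j :
  (in_qpoly 'X^k p : {poly B})`_j = if (j < k)%N then p`_j else 0.
Proof.
rewrite /= mk_monic_Xn prednK // -Pdiv.RingMonic.take_poly_rmodp.
exact: coef_take_poly.
Qed.

Lemma coef_qpoly_ge (r : Q) j : (k <= j)%N -> (r : {poly B})`_j = 0.
Proof.
move=> h; apply/nth_default/(leq_trans _ h).
have e : size (mk_monic ('X^k : {poly B})) = k.+1.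
  by rewrite mk_monic_Xn prednK // size_polyXn.
by rewrite -ltnS -e size_mk_monic.
Qed.

Lemma qpolyP (r s : Q) :
  (forall j, (j < k)%N -> (r : {poly B})`_j = (s : {poly B})`_j) -> r = s.
Proof.
move=> h; apply/val_inj/polyP => j; have [/h //|hj] := ltnP j k.
by rewrite !coef_qpoly_ge.
Qed.

Definition qc (b : B) : Q := in_qpoly 'X^k b%:P.
Definition qx : Q := in_qpoly 'X^k 'X.

Arguments qc : simpl never.
Arguments qx : simpl never.

Lemma coef_qc b j : (qc b : {poly B})`_j = if j == 0 then b else 0.
Proof. by rewrite coef_in_qpoly coefC; case: j => [|j]; rewrite ?k0 ?if_same. Qed.

Lemma coef_qxM (r : Q) j : (qx * r : {poly B})`_j =
  if (j < k)%N then (if j is j'.+1 then (r : {poly B})`_j' else 0) else 0.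
Proof.
have -> : qx * r = in_qpoly 'X^k ('X * r) by rewrite in_qpolyM in_qpolyK.
by rewrite coef_in_qpoly coefXM; case: j.
Qed.

Lemma coef_qcM b (r : Q) j : (qc b * r : {poly B})`_j = b * (r : {poly B})`_j.
Proof.
have -> : qc b * r = in_qpoly 'X^k (b%:P * r) by rewrite in_qpolyM in_qpolyK.
rewrite coef_in_qpoly coefCM; case: ltnP => // h.
by rewrite coef_qpoly_ge ?mulr0.
Qed.

Lemma qx_exp n : qx ^+ n = in_qpoly 'X^k 'X^n.
Proof.
elim: n => [|n IH]; first by rewrite !expr0 in_qpoly1.
by rewrite !exprS IH -in_qpolyM.
Qed.

Lemma coef_qx_exp n j : (n < k)%N -> (qx ^+ n : {poly B})`_j = (j == n)%:R.
Proof.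
move=> h; rewrite qx_exp coef_in_qpoly coefXn; case: ltnP => // hj.
by rewrite gtn_eqF // (leq_trans h).
Qed.

Lemma qx_nil : qx ^+ k = 0.
Proof.
apply: qpolyP => j hj; rewrite qx_exp coef_in_qpoly coefXn hj coef0.
by rewrite ltn_eqF.
Qed.

Lemma qc_zmod : zmod_morphism qc.
Proof. by move=> a b; rewrite /qc polyCB linearB. Qed.
Lemma qc_monoid : monoid_morphism qc.
Proof.
split=> [|a b]; last by rewrite /qc polyCM in_qpolyM.
by apply: qpolyP => j hj; rewrite coef_in_qpoly hj.
Qed.
HB.instance Definition _ := GRing.isZmodMorphism.Build B Q qc qc_zmod.
HB.instance Definition _ := GRing.isMonoidMorphism.Build B Q qc qc_monoid.

Lemma coef_qpoly_sum (I : Type) (s : seq I) (P : pred I) (F : I -> Q) j :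
  ((\sum_(i <- s | P i) F i : Q) : {poly B})`_j = \sum_(i <- s | P i) (F i : {poly B})`_j.
Proof. exact: coefn_sum. Qed.

Lemma qpoly_decomp (r : Q) : r = \sum_(j < k) qc (r : {poly B})`_j * qx ^+ j.
Proof.
apply: qpolyP => j hj; rewrite coef_qpoly_sum (bigD1 (Ordinal hj)) //=.
rewrite coef_qcM coef_qx_exp // eqxx mulr1 big1 ?addr0 // => i ni.
rewrite coef_qcM coef_qx_exp //.
by rewrite -val_eqE /= eq_sym in ni; rewrite (negbTE ni) mulr0.
Qed.

Lemma qlinear (U V : lmodType Q) (f : U -> V) :
  (forall u v, f (u + v) = f u + f v) -> (forall b u, f (qc b *: u) = qc b *: f u) ->
  (forall u, f (qx *: u) = qx *: f u) -> linear f.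
Proof.
move=> fD fc fx r u v; rewrite fD; congr (_ + _).
have f0 : f 0 = 0 by apply: (addIr (f 0)); rewrite -fD !add0r.
have fX n w : f (qx ^+ n *: w) = qx ^+ n *: f w.
  by elim: n => [|n IH]; rewrite ?expr0 ?scale1r // exprS -!scalerA fx IH.
rewrite [r]qpoly_decomp !scaler_suml (big_morph f fD f0).
by apply: eq_bigr => j _; rewrite -!scalerA fc fX.
Qed.

Section NilpotentAction.
Context (V : lmodType B) (x : {linear V -> V}).
Hypothesis x_nil : forall v, iter k x v = 0.

Definition qact (p : {poly B}) (v : V) : V := \sum_(j < size p) p`_j *: iter j x v.

Lemma qact_wide n (p : {poly B}) v : (size p <= n)%N ->
  qact p v = \sum_(j < n) p`_j *: iter j x v.
Proof.
move=> h; rewrite /qact (big_ord_widen _ (fun j => p`_j *: iter j x v) h) big_mkcond.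
by apply: eq_bigr => j _; case: ltnP => // hj; rewrite nth_default // scale0r.
Qed.

Lemma iter_linear n : linear (iter n x).
Proof. by elim: n => [//|n IH] a u v; rewrite !iterS IH linearP. Qed.

Lemma qactD p q v : qact (p + q) v = qact p v + qact q v.
Proof.
pose n := maxn (size p) (size q).
rewrite !(@qact_wide n) ?leq_maxl ?leq_maxr //; last exact: size_polyD.
by rewrite -big_split; apply: eq_bigr => j _; rewrite coefD scalerDl.
Qed.

Lemma qact_linear p : linear (qact p).
Proof.
move=> a u v; rewrite scaler_sumr -big_split; apply: eq_bigr => j _.
by rewrite /= iter_linear scalerDr !scalerA mulrC.
Qed.

Lemma qact_mulX p v : qact (p * 'X) v = x (qact p v).
Proof.
rewrite (@qact_wide (size p).+1); last first.
  by have [->|/size_mulX -> //] := eqVneq p 0; rewrite mul0r size_poly0.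
rewrite big_ord_recl coefMX /= scale0r add0r linear_sum; apply: eq_bigr => j _.
by rewrite coefMX /= linearZ.
Qed.

Lemma qactC b v : qact b%:P v = b *: v.
Proof.
by rewrite (@qact_wide 1) ?size_polyC_leq1 // big_ord1 coefC.
Qed.

Lemma qactM p q v : qact (p * q) v = qact p (qact q v).
Proof.
elim/poly_ind: p v => [|p c IH] v.
  by rewrite mul0r /qact size_poly0 !big_ord0.
rewrite mulrDl !qactD -mulrA [X in p * X]mulrC mulrA !qact_mulX IH; congr (_ + _).
rewrite qactC -[c *: _]scale1r -[RHS]scale1r.
rewrite mul_polyC (@qact_wide (size q)) ?size_scale_leq //.
rewrite !scale1r scaler_sumr; apply: eq_bigr => j _.
by rewrite coefZ scalerA.
Qed.

Lemma qact_Xk v : qact 'X^k v = 0.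
Proof.
suff h n : qact 'X^n v = iter n x v by rewrite h x_nil.
elim: n => [|n IH]; first by rewrite expr0 -polyC1 qactC scale1r.
by rewrite exprSr qact_mulX IH.
Qed.

Lemma qact_in (p : {poly B}) v : qact (in_qpoly 'X^k p : Q) v = qact p v.
Proof.
have mX : ('X^k : {poly B}) \is monic by exact: monicXn.
rewrite [in RHS](Pdiv.RingMonic.rdivp_eq mX p) qactD qactM.
have q0 q : qact q 0 = 0.
  by have := qact_linear q (-1) 0 0; rewrite scaler0 addr0 scaleN1r addNr.
rewrite qact_Xk q0 add0r.
by rewrite /= mk_monic_Xn prednK.
Qed.

End NilpotentAction.
End TruncatedPolynomials.

Definition mk_linear (R : pzRingType) (U V : lmodType R) (f : U -> V) (lf : linear f) :
  {linear U -> V} := HB.pack f (GRing.isLinear.Build R U V *:%R f lf).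

Section NilpotentModule.
Context (B : comNzRingType) (k : nat) (k0 : (0 < k)%N).
Context (V : lmodType B) (x : V -> V) (lx : linear x) (x_nil : forall v, iter k x v = 0).
Notation Q := {poly %/ ('X^k : {poly B})}.

(** The carrier is [V] itself; the [let]s make the type depend on the operator and its nilpotency,
    so that the module structure over B[x]/(x^k) can be attached to it. *)
Definition nilmod : Type := let _ := k0 in let _ := lx in let _ := x_nil in V.
HB.instance Definition _ := GRing.Zmodule.copy nilmod V.

Let xn v : iter k (mk_linear lx) v = 0. Proof. exact: x_nil. Qed.

Definition nil_scale (r : Q) (v : nilmod) : nilmod := qact (mk_linear lx) r v.

Lemma nil_scaleA a b v : nil_scale a (nil_scale b v) = nil_scale (a * b) v.
Proof.
rewrite /nil_scale -(qactM (mk_linear lx)) -(qact_in k0 xn).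
congr (qact _ (polyn _) _).
Qed.
Lemma nil_scale1 : left_id 1 nil_scale.
Proof. by move=> v; rewrite /nil_scale /= polyC1 -polyC1 qactC scale1r. Qed.
Lemma nil_scaleDr : right_distributive nil_scale +%R.
Proof.
move=> a u v; rewrite /nil_scale -[u in u + v]scale1r.
by have := qact_linear (mk_linear lx) a 1 u v; rewrite !scale1r => ->.
Qed.
Lemma nil_scaleDl v : {morph nil_scale^~ v : a b / a + b}.
Proof. by move=> a b; rewrite /nil_scale -qactD. Qed.
HB.instance Definition _ :=
  GRing.Zmodule_isLmodule.Build Q nilmod nil_scaleA nil_scale1 nil_scaleDr nil_scaleDl.

Lemma nilmod_qc (b : B) (v : nilmod) : qc k b *: v = (b *: (v : V)) :> nilmod.
Proof. by rewrite -[LHS]/(qact _ _ _) (qact_in k0 xn) qactC. Qed.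

Lemma nilmod_qx (v : nilmod) : qx B k *: v = x v.
Proof.
rewrite -[LHS]/(qact _ _ _) (qact_in k0 xn) -[X in qact _ X]mul1r qact_mulX -polyC1 qactC.
by rewrite scale1r.
Qed.

End NilpotentModule.
Arguments qc : simpl never.
Arguments qx : simpl never.

Section HomogeneousVectors.
Context (K : fieldType).
Notation mhom := (@hom K (mx_cat K)).
Notation pK := {poly K}.

Definition pvec (A : finType) : lmodType pK := A -> pK^o.

Section HomogeneousMatrix.
Implicit Types (A B C : finType).

(** The absolute value is a default: where the exponent would be negative, [mdeg] makes the
    coefficient zero. In every case the entries determine [f], as [hmap_inj] shows. *)
Definition hmx A B (dA : A -> int) (dB : B -> int) (r : int) (f : mhom A B) b a : pK :=
  f b a *: 'X^(absz (dB b - dA a - r)%R).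

Definition hmap A B (dA : A -> int) (dB : B -> int) (r : int) (f : mhom A B) (v : pvec A) : pvec B :=
  fun b => \sum_a hmx dA dB r f b a * v a.

Definition pvE A (v : pvec A) (a : A) : pK := v a.
Definition pbasis A (a : A) : pvec A := fun b => (b == a)%:R.

Lemma pvecP A (u v : pvec A) : (forall a, pvE u a = pvE v a) -> u = v.
Proof. by move=> h; apply/funext => a; apply: h. Qed.

Lemma pvec_basis A (v : pvec A) : v = \sum_a (v a : pK) *: pbasis a.
Proof.
apply: pvecP => a; rewrite /pvE fct_sumE (bigD1 a) //= big1 ?addr0.
  by rewrite -[RHS]/((v a : pK) * (a == a)%:R) eqxx mulr1.
move=> b nb; rewrite -[LHS]/((v b : pK) * (a == b)%:R).
by rewrite eq_sym (negbTE nb) mulr0.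
Qed.

Context (A B C : finType) (dA : A -> int) (dB : B -> int) (dC : C -> int).

Lemma hmap_linear r (f : mhom A B) : linear (hmap dA dB r f).
Proof.
move=> c u v; apply: pvecP => b.
rewrite -[RHS]/(c * pvE (hmap dA dB r f u) b + pvE (hmap dA dB r f v) b) /pvE /hmap.
rewrite mulr_sumr -big_split; apply: eq_bigr => a _.
by rewrite -[(c *: u + v) a]/(c * u a + v a) mulrDr mulrCA.
Qed.

Lemma hmap_basis r (f : mhom A B) a b : hmap dA dB r f (pbasis a) b = hmx dA dB r f b a.
Proof.
rewrite /hmap (bigD1 a) //= big1 ?addr0; first by rewrite /pbasis eqxx mulr1.
by move=> c nc; rewrite /pbasis (negbTE nc) mulr0.
Qed.

Lemma hmap_id : hmap dA dA 0 (idm _) =1 id.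
Proof.
move=> v; apply: pvecP => a; rewrite /pvE /hmap (bigD1 a) //= big1 ?addr0.
  by rewrite /hmx mx_idE eqxx subr0 subrr expr0 scale1r mul1r.
by move=> b nb; rewrite /hmx mx_idE eq_sym (negbTE nb) scale0r mul0r.
Qed.

Lemma hmapP r c (f g : mhom A B) v :
  hmap dA dB r (c *: f + g) v = (c%:P : pK) *: hmap dA dB r f v + hmap dA dB r g v.
Proof.
apply: pvecP => b.
rewrite -[RHS]/(c%:P * hmap dA dB r f v b + hmap dA dB r g v b) /pvE /hmap.
rewrite mulr_sumr -big_split; apply: eq_bigr => a _.
by rewrite /hmx mx_addE mx_scaleE scalerDl -scalerA -mul_polyC mulrDl !mulrA.
Qed.

Lemma hmap0 r v : hmap dA dB r 0 v = 0.
Proof.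
apply: pvecP => b; rewrite /pvE /hmap big1 // => a _.
by rewrite /hmx mx_0E scale0r mul0r.
Qed.

Lemma hmap_at0 r (f : mhom A B) : hmap dA dB r f 0 = 0.
Proof. by have := hmap_linear r f (-1) 0 0; rewrite scaler0 addr0 scaleN1r addNr. Qed.

Lemma hmap_addv r (f : mhom A B) u v :
  hmap dA dB r f (u + v) = hmap dA dB r f u + hmap dA dB r f v.
Proof. by have := hmap_linear r f 1 u v; rewrite !scale1r. Qed.

Lemma hmap_scalev r (f : mhom A B) p u : hmap dA dB r f (p *: u) = p *: hmap dA dB r f u.
Proof. by have := hmap_linear r f p u 0; rewrite hmap_at0 !addr0. Qed.

Lemma hmap_sumv r (f : mhom A B) (I : Type) (s : seq I) (P : pred I) (F : I -> pvec A) :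
  hmap dA dB r f (\sum_(i <- s | P i) F i) = \sum_(i <- s | P i) hmap dA dB r f (F i).
Proof. exact: (big_morph _ (hmap_addv r f) (hmap_at0 r f)). Qed.

Lemma hmap_inj r (f g : mhom A B) : hmap dA dB r f =1 hmap dA dB r g -> f = g.
Proof.
move=> h; apply: mxP => b a.
have := congr1 (fun v : pvec B => v b) (h (pbasis a)); rewrite !hmap_basis /hmx.
move/(congr1 (fun p : pK => p`_(absz (dB b - dA a - r)%R))).
by rewrite !coefZ coefXn eqxx !mulr1.
Qed.

End HomogeneousMatrix.

Lemma hmapM (A B C : finType) (dA : A -> int) (dB : B -> int) (dC : C -> int) r s
    (g : mhom B C) (f : mhom A B) v :
  mdeg dB dC r g -> mdeg dA dB s f ->
  hmap dA dC (r + s) (g \c f) v = hmap dB dC r g (hmap dA dB s f v).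
Proof.
move=> dg df; apply: pvecP => c; rewrite /pvE /hmap.
under [RHS]eq_bigr do rewrite mulr_sumr.
rewrite [RHS]exchange_big /=; apply: eq_bigr => a _.
under [RHS]eq_bigr do rewrite mulrA.
rewrite -mulr_suml; congr (_ * _); rewrite /hmx mx_cmpE scaler_suml.
apply: eq_bigr => b _.
have [->|/dg hg] := eqVneq (g c b) 0; first by rewrite mul0r !scale0r mul0r.
have [->|/df hf] := eqVneq (f b a) 0; first by rewrite mulr0 !scale0r mulr0.
rewrite -scalerAl -scalerAr scalerA -exprD; congr (_ *: 'X^ _).
lia.
Qed.

Section HomogeneousPart.
Context (A : finType) (d : A -> int).

(** The sign comes from deg y = -1: a term y^n at the basis vector [a] has degree [d a - n]. *)
Definition hpart (i : int) (v : pvec A) : Prop :=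
  forall a n, (v a : pK)`_n != 0 -> i = d a - n%:Z.

Lemma hpart0 i : hpart i 0.
Proof. by move=> a n; rewrite coef0 eqxx. Qed.

Lemma hpartB i u v : hpart i u -> hpart i v -> hpart i (u - v).
Proof.
move=> hu hv a n; rewrite -[(u - v) a]/((u a : pK) - v a) coefB => h.
have [e|/hu //] := eqVneq (u a : pK)`_n 0.
by apply: hv; apply: contraNneq h => e'; rewrite e e' subr0.
Qed.

Lemma hpartD i u v : hpart i u -> hpart i v -> hpart i (u + v).
Proof.
move=> hu hv; rewrite -[v]opprK; apply: hpartB => //.
by rewrite -sub0r; apply: hpartB => //; apply: hpart0.
Qed.

Lemma hpart_sum i (I : Type) (s : seq I) (P : pred I) F :
  (forall j, P j -> hpart i (F j)) -> hpart i (\sum_(j <- s | P j) F j).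
Proof. by move=> h; apply: (big_ind (hpart i)) => //; [apply: hpart0 | apply: hpartD]. Qed.

Lemma hpart_monomial i c n v : hpart i v -> hpart (i - n%:Z) ((c *: 'X^n : pK) *: v).
Proof.
move=> hv a m.
rewrite -[((c *: 'X^n : pK) *: v) a]/((c *: 'X^n : pK) * v a) -scalerAl coefZ coefXnM.
case: ltnP => [_|h]; first by rewrite mulr0 eqxx.
rewrite mulf_eq0 negb_or => /andP[_ /hv ->]; lia.
Qed.

Lemma hpart_basis a : hpart (d a) (pbasis a).
Proof.
move=> b n; rewrite /pbasis; have [->|] := eqVneq b a; last by rewrite coef0 eqxx.
by rewrite coef1; case: n => [_|n]; [rewrite subr0 | rewrite eqxx].
Qed.

Definition comp (i : int) (v : pvec A) : pvec A :=
  fun a => if (i <= d a)%R then (v a : pK)`_(absz (d a - i)%R) *: 'X^(absz (d a - i)%R) else 0.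

Lemma comp_hpart i v : hpart i (comp i v).
Proof.
move=> a n; rewrite /comp; case: ifP => h; last by rewrite coef0 eqxx.
rewrite coefZ coefXn; have [->|_] := eqVneq n _; last by rewrite mulr0 eqxx.
by move=> _; lia.
Qed.

Lemma comp_id i v : hpart i v -> comp i v = v.
Proof.
move=> h; apply: pvecP => a; rewrite /pvE /comp; apply/polyP => n.
have [e|ne] := eqVneq (v a : pK)`_n 0.
  case: ifP => hi; last by rewrite coef0.
  by rewrite coefZ coefXn; case: eqP => [<-|_]; rewrite ?e ?mul0r ?mulr0.
have e := h a n ne; have -> : i <= d a by lia.
have -> : absz (d a - i)%R = n by lia.
by rewrite coefZ coefXn eqxx mulr1.
Qed.

Lemma comp_ne i j v : hpart i v -> i != j -> comp j v = 0.
Proof.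
move=> h nij; apply: pvecP => a; rewrite /pvE /comp; case: ifP => hj //.
have [->|/h e] := eqVneq (v a : pK)`_(absz (d a - j)%R) 0; first by rewrite scale0r.
by move: nij; rewrite e; lia.
Qed.

Lemma compB i u v : comp i (u - v) = comp i u - comp i v.
Proof.
apply: pvecP => a; rewrite /pvE -[RHS]/((comp i u a : pK) - comp i v a) /comp.
case: ifP => _; last by rewrite subr0.
by rewrite -[(u - v) a]/((u a : pK) - v a) coefB scalerBl.
Qed.

Lemma comp0 i : comp i 0 = 0.
Proof. by have := compB i 0 0; rewrite !subrr. Qed.

Lemma comp_sum i (I : Type) (s : seq I) (F : I -> pvec A) :
  comp i (\sum_(j <- s) F j) = \sum_(j <- s) comp i (F j).
Proof.
have cD u v : comp i (u + v) = comp i u + comp i v.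
  by rewrite -{1}[v]opprK compB -[- v]sub0r compB comp0 sub0r opprK.
exact: (big_morph _ cD (comp0 i)).
Qed.

Lemma hpart_span (v : pvec A) : exists (s : seq int) (c : int -> pvec A),
  [/\ uniq s, forall i, hpart i (c i) & v = \sum_(i <- s) c i].
Proof.
pose s := undup (flatten [seq [seq d a - n%:Z | n <- iota 0 (size (v a : pK))] | a <- enum A]).
exists s, (comp^~ v); split; [exact: undup_uniq | by move=> i; apply: comp_hpart |].
apply: pvecP => a; rewrite /pvE fct_sumE.
apply/polyP => n; rewrite coef_sum.
have z i : i \in s -> i != d a - n%:Z -> (comp i v a : pK)`_n = 0.
  move=> _ ni; apply/eqP; apply: contraNT ni => /comp_hpart ->; exact: eqxx.
have e1 : (comp (d a - n%:Z) v a : pK)`_n = (v a : pK)`_n.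
  rewrite /comp; have -> : d a - n%:Z <= d a by lia.
  have -> : absz (d a - (d a - n%:Z))%R = n by lia.
  by rewrite coefZ coefXn eqxx mulr1.
have [hs|hs] := boolP (d a - n%:Z \in s).
  rewrite (bigD1_seq _ hs (undup_uniq _)) /= e1 big_seq_cond big1 ?addr0 //.
  by move=> i /andP[hi ni]; apply: z.
rewrite big_seq big1; last first.
  by move=> i hi; apply: z => //; apply: contraNneq hs => <-.
apply: nth_default; rewrite leqNgt; apply: contra hs => hn.
rewrite mem_undup; apply/flatten_mapP; exists a; first by rewrite mem_enum.
by apply/mapP; exists n => //; rewrite mem_iota.
Qed.

Lemma hpart_free (s : seq int) (c : int -> pvec A) :
  uniq s -> (forall i, hpart i (c i)) -> \sum_(i <- s) c i = 0 ->
  forall i, i \in s -> c i = 0.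
Proof.
move=> us hc e i si; have := congr1 (comp i) e.
rewrite comp0 comp_sum (bigD1_seq _ si us) /= comp_id // big1 ?addr0 //.
by move=> j nj; apply: comp_ne (hc j) nj.
Qed.

End HomogeneousPart.

Lemma hpart_hmap (A B : finType) (dA : A -> int) (dB : B -> int) r (f : mhom A B) i v :
  mdeg dA dB r f -> hpart dA i v -> hpart dB (i + r) (hmap dA dB r f v).
Proof.
move=> df hv; rewrite [v]pvec_basis /hmap => b n h.
have [a] : exists a, ((hmx dA dB r f b a : pK) * v a)`_n != 0.
  apply: contra_neqP h => h; rewrite -pvec_basis coef_sum big1 // => a _.
  by apply/eqP; apply: contra_notT h => ?; exists a.
rewrite /hmx -scalerAl coefZ coefXnM; case: ltnP => [_|hn]; first by rewrite mulr0 eqxx.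
rewrite mulf_eq0 negb_or => /andP[/df h1 /hv h2]; lia.
Qed.

End HomogeneousVectors.

Section EModule.
Context (K : fieldType) (k : nat) (k2 : (2 <= k)%N) (V : mobj K k).
Notation pK := {poly K}.
Notation pvec := (pvec K).
Notation pbasis := (pbasis K).
Let k0 : (0 < k)%N. Proof. exact: ltnW. Qed.
Notation A := (mi V).

Definition xact : pvec A -> pvec A := hmap (md V) (md V) 1 (mX V).

Lemma xact_linear : linear xact. Proof. exact: hmap_linear. Qed.

Lemma iter_xact n v : iter n xact v = hmap (md V) (md V) n%:Z (pw (mX V) n) v.
Proof.
elim: n => [|n IH]; first by rewrite hmap_id.
rewrite iterS IH /xact pwS intS; apply/esym/hmapM; first exact: mX_deg.
exact: (mdeg_pw (mX_deg V)).
Qed.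

Lemma xact_nil v : iter k xact v = 0.
Proof. by rewrite iter_xact mX_nil hmap0. Qed.

Definition emod : lmodType (ringR K k) := nilmod k0 xact_linear xact_nil.

Lemma emod_qc (p : pK) (v : emod) : (qc k p : ringR K k) *: v = (p *: (v : pvec A)) :> pvec A.
Proof. exact: (@nilmod_qc _ k k0 _ _ xact_linear xact_nil). Qed.

Lemma emod_qx (v : emod) : (qx pK k : ringR K k) *: v = xact v.
Proof. exact: (@nilmod_qx _ k k0 _ _ xact_linear xact_nil). Qed.

Lemma emod_qxn n (v : emod) : (qx pK k : ringR K k) ^+ n *: v = iter n xact v.
Proof.
elim: n v => [|n IH] v; first by rewrite expr0 scale1r.
by rewrite exprS -scalerA IH emod_qx.
Qed.

Lemma emod_homogZ i j (r : ringR K k) (v : emod) :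
  degR i r -> hpart (md V) j v -> hpart (md V) (i + j) (r *: v).
Proof.
move=> hr hv; rewrite [r](qpoly_decomp k0) scaler_suml.
apply: hpart_sum => l _; rewrite -scalerA emod_qxn iter_xact emod_qc.
rewrite -[X in X *: _]coefK poly_def scaler_suml; apply: hpart_sum => n _.
have [->|/hr ->] := eqVneq ((r : {poly pK})`_l)`_n 0.
  by rewrite !scale0r; apply: hpart0.
have := @hpart_monomial _ _ _ _ ((r : {poly pK})`_l)`_n n _ (hpart_hmap (mdeg_pw (n := l) (mX_deg V)) hv).
by congr hpart; lia.
Qed.

Definition egr : grModule (@degR K k) :=
  @GrModule _ (@degR K k) emod (hpart (md V)) (@hpart0 K _ (md V)) (@hpartB K _ (md V))
    emod_homogZ (@hpart_span K _ (md V)) (@hpart_free K _ (md V)).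

Lemma egr_fg : finitely_generated egr.
Proof.
exists #|A|, (fun i => pbasis (enum_val i) : egr) => m.
exists (fun i => qc k ((m : pvec A) (enum_val i))).
rewrite {1}[m]pvec_basis (reindex _ (onW_bij _ (@enum_val_bij A))).
by apply: eq_bigr => i _; apply/esym/emod_qc.
Qed.

End EModule.

(** * From matrices to graded modules *)

Section GradedModules.
Context (K : fieldType) (k : nat) (k2 : (2 <= k)%N).
Notation mhom := (@hom K (mx_cat K)).
Notation mobj := (mobj K k).
Notation pK := {poly K}.
Notation R := (ringR K k).
Notation grMod := (grModule (@degR K k)).
Let k0 : (0 < k)%N. Proof. exact: ltnW. Qed.

Section GrHom.
Context (M N : grMod) (f : grHom M N).
Implicit Types (u v : M).

Lemma grfunD u v : f (u + v) = f u + f v.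
Proof. by have := grfun_linear f 1 u v; rewrite !scale1r. Qed.
Lemma grfunZ a u : f (a *: u) = a *: f u.
Proof. by have := grfun_linear f a u 0; rewrite grfun0 !addr0. Qed.
Lemma grfun_sum (I : Type) (s : seq I) (P : pred I) (F : I -> M) :
  f (\sum_(i <- s | P i) F i) = \sum_(i <- s | P i) f (F i).
Proof. exact: (big_morph _ grfunD (grfun0 f)). Qed.
End GrHom.

Lemma homog_sum (M : grMod) i (I : Type) (s : seq I) (P : pred I) (F : I -> M) :
  (forall j, P j -> homog M i (F j)) -> homog M i (\sum_(j <- s | P j) F j).
Proof.
by move=> h; apply: (big_ind (homog M i)) => //; [apply: homog0 | move=> *; apply: homogD].
Qed.

Lemma homog_component (M : grMod) i (m : M) (s : seq int) (c : int -> M) :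
  homog M i m -> uniq s -> (forall j, homog M j (c j)) -> m = \sum_(j <- s) c j ->
  m = if i \in s then c i else 0.
Proof.
move=> hm us hc em.
(* The difference of two homogeneous decompositions of [m]: the given one, and the trivial one with
   [m] itself in degree [i]. *)
pose c' j := (if j \in s then c j else 0) - (if j == i then m else 0).
have hc' j : homog M j (c' j).
  apply: homogB; first by case: ifP => _; rewrite ?hc //; apply: homog0.
  by case: eqP => [->|_] //; apply: homog0.
have [t [ut it st]] : exists t : seq int, [/\ uniq t, i \in t & {subset s <= t}].
  exists (undup (i :: s)); split; [exact: undup_uniq | by rewrite mem_undup inE eqxx |].
  by move=> j js; rewrite mem_undup inE js orbT.
have : \sum_(j <- t) c' j = 0.
  rewrite sumrB sum_extend // -em (bigD1_seq i) //=.
  by rewrite eqxx big1 ?addr0 ?subrr // => j /negbTE ->.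
move/(homog_free ut hc')/(_ i it).
by rewrite /c' eqxx => /subr0_eq.
Qed.

(** Lets a surjection be inverted inside one degree: the component of degree [i] of any preimage
    will do. *)
Lemma homog_lift (M N : grMod) (g : grHom M N) i (m : M) :
  homog N i (g m) -> exists2 m', homog M i m' & g m' = g m.
Proof.
move=> h; have [s [c [us hc em]]] := homog_span m.
have := homog_component h us (fun j => grfun_homog g (hc j)).
rewrite em grfun_sum => /(_ erefl) ->.
case: ifP => _; first by exists (c i).
by exists 0; [apply: homog0 | rewrite grfun0].
Qed.

Lemma degR_qx : degR 1 (qx pK k : R).
Proof.
move=> a b; rewrite (coef_in_qpoly k0) coefX.
case: ifP => _; last by rewrite coef0 eqxx.
case: a => [|[|a]]; rewrite ?coef0 ?eqxx // coef1.
by case: b => [|b] //; rewrite eqxx.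
Qed.

Lemma degR_monomial c n : degR (- n%:Z) (qc k (c *: 'X^n : pK) : R).
Proof.
move=> a b; rewrite (coef_qc k0); case: a => [|a]; last by rewrite coef0 eqxx.
rewrite coefZ coefXn; have [->|_] := eqVneq b n; last by rewrite mulr0 eqxx.
by rewrite sub0r.
Qed.

Lemma homog_qxn (M : grMod) n i (m : M) :
  homog M i m -> homog M (i + n%:Z) ((qx pK k : R) ^+ n *: m).
Proof.
move=> h; elim: n => [|n IH]; first by rewrite expr0 scale1r addr0.
rewrite exprS -scalerA; have -> : i + n.+1%:Z = 1 + (i + n%:Z) by lia.
exact: homogZ degR_qx IH.
Qed.

Lemma homog_qc (M : grMod) (p : pK) i j (m : M) :
  (forall n, p`_n != 0 -> j = i - n%:Z) -> homog M i m -> homog M j ((qc k p : R) *: m).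
Proof.
move=> hp hm; rewrite -[p]coefK poly_def rmorph_sum scaler_suml /=.
apply: homog_sum => n _.
have [->|/hp ->] := eqVneq p`_n 0.
  by rewrite scale0r [qc k 0]raddf0 scale0r; apply: homog0.
by rewrite addrC; have := homogZ (@degR_monomial p`_n n) hm.
Qed.

Lemma homog_generators (M : grMod) : finitely_generated M ->
  exists (A : finType) (d : A -> int) (e : A -> M),
    (forall a, homog M (d a) (e a)) /\ (forall m, exists c : A -> R, m = \sum_a c a *: e a).
Proof.
move=> [n [e he]].
have /choice[s hs] := fun i => homog_span (e i).
have /choice[c hc] := hs.
pose N := \max_i size (s i).
exists ('I_n * 'I_N)%type, (fun x : 'I_n * 'I_N => nth 0 (s x.1) x.2),
  (fun x : 'I_n * 'I_N => if (x.2 < size (s x.1))%N then c x.1 (nth 0 (s x.1) x.2) else 0); split.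
  by move=> [i j] /=; case: ifP => _; [have [_ h _] := hc i; apply: h | apply: homog0].
move=> m; have [a ->] := he m; exists (fun x => a x.1).
rewrite -(pair_bigA _ (fun i (j : 'I_N) => a i *: (if (j < size (s i))%N then c i (nth 0 (s i) j) else 0))) /=.
apply: eq_bigr => i _; rewrite -scaler_sumr; congr (_ *: _).
have [_ _ {1}->] := hc i.
have hN : (size (s i) <= N)%N by exact: (leq_bigmax i).
rewrite (big_nth 0) big_mkord (big_ord_widen _ (fun j => c i (nth 0 (s i) j)) hN).
by rewrite big_mkcond.
Qed.

Lemma egr_linear (V : mobj) (U : lmodType R) (f : emod k2 V -> U) :
  (forall u v, f (u + v) = f u + f v) ->
  (forall p (u : pvec K (mi V)), f (p *: u) = (qc k p : R) *: f u) ->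
  (forall a, f (xact (pbasis K a)) = (qx pK k : R) *: f (pbasis K a)) -> linear f.
Proof.
move=> fD fc fx.
have f0 : f 0 = 0 by apply: (addIr (f 0)); rewrite -fD !add0r.
apply: (@qlinear pK k k0 (emod k2 V) U f fD).
  by move=> b u; rewrite [X in f X]emod_qc fc.
move=> u; rewrite [X in f X]emod_qx [u]pvec_basis.
rewrite /xact hmap_sumv !(big_morph f fD f0) scaler_sumr.
apply: eq_bigr => a _; rewrite hmap_scalev !fc [X in _ *: X]fx !scalerA.
by rewrite mulrC.
Qed.

Lemma emap_linear (V W : mobj) (f : mhom (mi V) (mi W)) : is_mor 0 f ->
  linear (hmap (md V) (md W) 0 f : egr k2 V -> egr k2 W).
Proof.
move=> [cf df].
apply: (@egr_linear V (emod k2 W)).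
- by move=> u v; apply: hmap_addv.
- by move=> p u; rewrite [RHS]emod_qc; apply: hmap_scalev.
move=> a; rewrite [RHS]emod_qx /xact.
rewrite -!hmapM ?addr0 ?add0r ?cf //; exact: mX_deg.
Qed.

Lemma emap_homog (V W : mobj) (f : mhom (mi V) (mi W)) : is_mor 0 f ->
  forall i (m : egr k2 V), homog (egr k2 V) i m ->
    homog (egr k2 W) i (hmap (md V) (md W) 0 f m).
Proof. by move=> hf i m hm; have := hpart_hmap hf.2 hm; rewrite addr0. Qed.

Definition emap (V W : mobj) (f : mhom (mi V) (mi W)) (hf : is_mor 0 f) :
    grHom (egr k2 V) (egr k2 W) :=
  GrHom (emap_linear hf) (emap_homog hf).

(** The image of a basis vector is homogeneous, so each of its coordinates is a single monomial,
    whose coefficient is the matrix entry. *)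
Lemma egr_full (V W : mobj) (f : grHom (egr k2 V) (egr k2 W)) :
  exists2 m : mhom (mi V) (mi W), is_mor 0 m & forall v, f v = hmap (md V) (md W) 0 m v.
Proof.
pose fb b : pvec K (mi W) := f (pbasis K b : egr k2 V).
have hfb b : hpart (md W) (md V b) (fb b).
  exact: (grfun_homog f (@hpart_basis K _ (md V) b)).
pose m : mhom (mi V) (mi W) := fun a b => if md V b <= md W a then (fb b a : pK)`_(absz (md W a - md V b)%R) else 0.
have dm : mdeg (md V) (md W) 0 m.
  by move=> a b; rewrite /m addr0; case: ifP => //; rewrite eqxx.
have fbE b : fb b = hmap (md V) (md W) 0 m (pbasis K b).
  apply: pvecP => a; rewrite {1}/pvE -[fb b](comp_id (hfb b)).
  rewrite /pvE hmap_basis /hmx subr0 /comp /m.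
  by case: ifP => // _; rewrite scale0r.
have fm v : f v = hmap (md V) (md W) 0 m v.
  rewrite [v in LHS]pvec_basis [v in RHS]pvec_basis.
  rewrite hmap_sumv [LHS]grfun_sum.
  apply: eq_bigr => b _; rewrite hmap_scalev.
  rewrite -[(v b : pK) *: _](@emod_qc _ _ k2 V (v b : pK) (pbasis K b)) grfunZ.
  by rewrite [LHS]emod_qc -/(fb b) fbE.
exists m => //; split=> //.
apply: (@hmap_inj _ _ _ (md V) (md W) 1) => v.
have e1 := hmapM v dm (mX_deg V); have e2 := hmapM v (mX_deg W) dm.
rewrite add0r in e1; rewrite addr0 in e2; rewrite e1 e2.
have := grfunZ f (qx pK k : R) (v : egr k2 V).
by rewrite [X in f X]emod_qx [RHS]emod_qx !fm.
Qed.

Section FreeHom.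
Context (A : finType) (d : A -> int).
(* The free module with generators of degrees d, which sit in the last of the k blocks
   of the cofree object. *)
Definition lfree : mobj := mfree k2 (fun a => d a + (k.-1)%:Z).
Lemma lgen_lt n : (k.-1 - n < k)%N. Proof. by rewrite (leq_ltn_trans (leq_subr _ _)) ?prednK. Qed.
(** This is x^n times a generator for [n < k], by [lbasisE]: multiplication by x lowers the block
    index, so the [n]-th power sits in block [k - 1 - n]. *)
Definition lbasis n (a : A) : egr k2 lfree := pbasis K ((Ordinal (lgen_lt n), a) : mi lfree).
Definition lgen a := lbasis 0 a.

Lemma xact_lbasis n a :
  xact (lbasis n a) = if (n < k.-1)%N then lbasis n.+1 a else 0.
Proof.
apply: pvecP => -[j b]; rewrite /pvE /xact /lbasis hmap_basis /hmx /= /shift /bcol /bpr /bdeg /=.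
case: ltnP => hn; last first.
  have -> : (k.-1 - n = 0)%N by apply/eqP.
  by rewrite scale0r.
rewrite /lbasis /pbasis xpair_eqE -val_eqE /=.
have -> : ((k.-1 - n)%N == j.+1) = (nat_of_ord j == k.-1 - n.+1)%N by lia.
have [e|ne] := eqVneq (nat_of_ord j) (k.-1 - n.+1)%N; last by rewrite scale0r.
have [->|nb] := eqVneq b a; last by rewrite scale0r.
rewrite scale1r; have -> : absz (d a + k.-1%:Z - j%:Z - 0 - (d a + k.-1%:Z - (k.-1 - n)%N%:Z - 0) - 1)%R = 0%N by lia.
by rewrite expr0.
Qed.

Lemma lbasisE n a : (n < k)%N -> lbasis n a = (qx pK k : R) ^+ n *: lgen a.
Proof.
elim: n => [|n IH] hn; first by rewrite expr0 scale1r.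
rewrite exprS -scalerA -IH ?(ltnW hn) // [RHS]emod_qx xact_lbasis.
by have -> : (n < k.-1)%N by lia.
Qed.

Lemma pbasis_lbasis (x : mi lfree) : pbasis K x = lbasis (k.-1 - x.1) x.2.
Proof.
rewrite /lbasis; congr (pbasis K _); apply/eqP; case: x => j b.
by rewrite xpair_eqE eqxx andbT -val_eqE /=; have := ltn_ord j; lia.
Qed.

Lemma lgen_homog a : homog (egr k2 lfree) (d a) (lgen a).
Proof.
have := @hpart_basis K _ (md lfree) (Ordinal (lgen_lt 0), a).
by congr (hpart _ _ _); rewrite /= /bdeg /=; lia.
Qed.

Lemma lfree_span (v : egr k2 lfree) : exists c : A -> R, v = \sum_a c a *: lgen a.
Proof.
exists (fun a => \sum_(j < k) qc k ((v : pvec K (mi lfree)) (j, a)) * (qx pK k) ^+ (k.-1 - j)).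
under eq_bigr do rewrite scaler_suml.
rewrite exchange_big pair_bigA {1}[v]pvec_basis /=; apply: eq_bigr => -[j a] _ /=.
rewrite -scalerA -lbasisE ?lgen_lt // [RHS]emod_qc pbasis_lbasis //.
Qed.

Lemma lfree_eq (N : grMod) (f g : grHom (egr k2 lfree) N) :
  (forall a, f (lgen a) = g (lgen a)) -> f = g.
Proof.
move=> h; apply: grHomP => v; have [c ->] := lfree_span v.
by rewrite !grfun_sum; apply: eq_bigr => a _; rewrite !grfunZ h.
Qed.

Section LfreeHom.
Context (N : grMod) (e : A -> N) (he : forall a, homog N (d a) (e a)).

Definition lfree_fun (v : egr k2 lfree) : N :=
  \sum_x (qc k ((v : pvec K (mi lfree)) x) : R) *: ((qx pK k : R) ^+ (k.-1 - x.1) *: e x.2).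

Lemma lfree_fun_basis n a : (n < k)%N -> lfree_fun (lbasis n a) = (qx pK k : R) ^+ n *: e a.
Proof.
move=> hn; rewrite /lfree_fun (bigD1 (Ordinal (lgen_lt n), a)) //= big1 => [|x nx].
  have -> : lbasis n a (Ordinal (lgen_lt n), a) = 1 by rewrite /lbasis /pbasis eqxx.
  have -> : (qc k (1 : pK) : R) = 1 by rewrite rmorph1.
  rewrite addr0 scale1r subKn //.
  by rewrite -ltnS prednK.
have -> : lbasis n a x = 0 by rewrite /lbasis /pbasis (negbTE nx).
by have -> : (qc k (0 : pK) : R) = 0 by [rewrite raddf0]; rewrite scale0r.
Qed.

Lemma lfree_fun_linear : linear lfree_fun.
Proof.
apply: egr_linear.
- move=> u v; rewrite -big_split; apply: eq_bigr => x _ /=.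
  by rewrite -scalerDl -[qc k _ + _]raddfD.
- move=> p u; rewrite scaler_sumr; apply: eq_bigr => x _.
  by rewrite [RHS]scalerA -[qc k p * _]rmorphM.
move=> x; rewrite pbasis_lbasis xact_lbasis.
have hx : (k.-1 - x.1 < k)%N by apply: lgen_lt.
rewrite lfree_fun_basis // scalerA -exprS; case: ltnP => h.
  by rewrite lfree_fun_basis //; lia.
have -> : (k.-1 - x.1).+1 = k by lia.
rewrite [_ ^+ k](qx_nil pK k0) scale0r /lfree_fun big1 // => y _.
by rewrite [qc k _]raddf0 scale0r.
Qed.

Lemma lfree_fun_homog i (v : egr k2 lfree) :
  homog (egr k2 lfree) i v -> homog N i (lfree_fun v).
Proof.
move=> hv; apply: homog_sum => -[j a] _ /=.
apply: homog_qc (homog_qxn _ (he a)) => n /hv -> /=.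
by rewrite /bdeg /=; have := ltn_ord j; lia.
Qed.

Definition lfree_hom : grHom (egr k2 lfree) N := GrHom lfree_fun_linear lfree_fun_homog.

Lemma lfree_homE a : lfree_hom (lgen a) = e a.
Proof. by rewrite /= lfree_fun_basis // expr0 scale1r. Qed.

Lemma lfree_hom_surj : (forall m, exists c : A -> R, m = \sum_a c a *: e a) ->
  is_surjective lfree_hom.
Proof.
move=> h m; have [c ->] := h m; exists (\sum_a c a *: lgen a).
by rewrite grfun_sum; apply: eq_bigr => a _; rewrite grfunZ lfree_homE.
Qed.

End LfreeHom.
End FreeHom.
Arguments lgen {A} d a.
Arguments lfree {A} d.

Definition egr_ob (V : mobj) : grR K k := FgGrModule (egr_fg k2 V).

Lemma lfree_projective (A : finType) (d : A -> int) : gr_projective (egr_ob (lfree d)).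
Proof.
move=> M N g f sg.
have /choice[e he] : forall a, exists e : gr_mod M, homog (gr_mod M) (d a) e /\
    gr_app g e = gr_app f (lgen d a).
  move=> a; have [m em] := sg (gr_app f (lgen d a)).
  have [m' hm' em'] : exists2 m', homog (gr_mod M) (d a) m' & gr_app g m' = gr_app g m.
    have hgm : homog (gr_mod N) (d a) (gr_app g m).
      by rewrite em; apply: (grfun_homog (f : grHom (egr k2 (lfree d)) (fg_val N)) (@lgen_homog A d a)).
    exact: homog_lift hgm.
  by exists m'; rewrite em'.
exists (lfree_hom (fun a => (he a).1)).
apply: lfree_eq => a; rewrite -[RHS](he a).2.
by rewrite -[LHS]/(gr_app g (lfree_hom (fun a => (he a).1) (lgen d a))) lfree_homE.
Qed.

End GradedModules.

Section LinearCombination.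
Context (R : pzRingType) (M : lmodType R) (A : finType) (e : A -> M).

Definition lcomb (c : A -> R) : M := \sum_a c a *: e a.

Lemma lcombD c c' : lcomb (fun a => c a + c' a) = lcomb c + lcomb c'.
Proof. by rewrite -big_split; apply: eq_bigr => a _; rewrite scalerDl. Qed.

Lemma lcomb0 : lcomb (fun=> 0) = 0.
Proof. by rewrite /lcomb big1 // => a _; rewrite scale0r. Qed.

Lemma lcombZ r c : lcomb (fun a => r * c a) = r *: lcomb c.
Proof. by rewrite scaler_sumr; apply: eq_bigr => a _; rewrite scalerA. Qed.

Lemma lcomb_basis a : lcomb (fun b => if b == a then 1 else 0) = e a.
Proof.
rewrite /lcomb (bigD1 a) //= eqxx scale1r big1 ?addr0 // => b nb.
by rewrite (negbTE nb) scale0r.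
Qed.

End LinearCombination.

Lemma lcomb_prod (R : pzRingType) (M : lmodType R) (A B : finType) (e : A * B -> M)
    (c : A * B -> R) :
  lcomb e c = \sum_a lcomb (fun b => e (a, b)) (fun b => c (a, b)).
Proof. by rewrite /lcomb pair_bigA; apply: eq_bigr => -[]. Qed.

(** * Homogeneous bases over K[y] *)

Section HomogeneousBasis.
Context (K : fieldType) (k : nat) (k2 : (2 <= k)%N).
Notation mhom := (@hom K (mx_cat K)).
Notation pK := {poly K}.
Notation R := (ringR K k).
Notation grMod := (grModule (@degR K k)).
Let k0 : (0 < k)%N. Proof. exact: ltnW. Qed.

Definition ycoef (p : pK) : R := qc k p.

Lemma ycoefD p q : ycoef (p + q) = ycoef p + ycoef q.
Proof. exact: (raddfD (qc k)). Qed.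
Lemma ycoefM p q : ycoef (p * q) = ycoef p * ycoef q.
Proof. exact: (rmorphM (qc k)). Qed.
Lemma ycoef0 : ycoef 0 = 0. Proof. exact: (raddf0 (qc k)). Qed.
Lemma ycoef1 : ycoef 1 = 1. Proof. exact: (rmorph1 (qc k)). Qed.

Context (M : grMod).

Definition bcomb (A : finType) (e : A -> M) (v : pvec K A) : M :=
  lcomb e (fun a => ycoef (v a)).

Section Comb.
Context (A : finType) (d : A -> int) (e : A -> M).

Lemma bcombD u v : bcomb e (u + v) = bcomb e u + bcomb e v.
Proof.
by rewrite /bcomb -lcombD; congr lcomb; apply/funext => a; rewrite -ycoefD.
Qed.

Lemma bcomb0 : bcomb e 0 = 0.
Proof. by rewrite /bcomb -(lcomb0 e); congr lcomb; apply/funext => a; apply: ycoef0. Qed.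

Lemma bcombZ p v : bcomb e (p *: v) = ycoef p *: bcomb e v.
Proof. by rewrite /bcomb -lcombZ; congr lcomb; apply/funext => a; rewrite -ycoefM. Qed.

Lemma bcombB u v : bcomb e (u - v) = bcomb e u - bcomb e v.
Proof. by apply: (addIr (bcomb e v)); rewrite -bcombD !subrK. Qed.

Lemma bcomb_sum (I : Type) (s : seq I) (P : pred I) (F : I -> pvec K A) :
  bcomb e (\sum_(i <- s | P i) F i) = \sum_(i <- s | P i) bcomb e (F i).
Proof. exact: (big_morph _ bcombD bcomb0). Qed.

Lemma bcomb_basis a : bcomb e (pbasis K a) = e a.
Proof.
rewrite /bcomb -[RHS]lcomb_basis; congr lcomb; apply/funext => b; rewrite /pbasis.
by case: eqP => _; [apply: ycoef1 | apply: ycoef0].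
Qed.

Hypothesis he : forall a, homog M (d a) (e a).

Lemma bcomb_homog i v : hpart d i v -> homog M i (bcomb e v).
Proof.
by move=> hv; apply: homog_sum => a _; apply: homog_qc (he a) => // n; apply: hv.
Qed.

Lemma bcomb_comp0 v : bcomb e v = 0 -> forall i, bcomb e (comp d i v) = 0.
Proof.
move=> v0 i; have [s [c [us hc ev]]] := hpart_span d v.
move: v0; rewrite ev => v0 {ev}.
have [si|si] := boolP (i \in s); last first.
  rewrite comp_sum bcomb_sum big_seq big1 // => j js.
  rewrite (comp_ne (hc j)) ?bcomb0 //.
  by apply: contraNneq si => <-.
rewrite comp_sum (bigD1_seq i) //= (comp_id (hc i)) big1 ?addr0; last first.
  by move=> j nj; apply: comp_ne (hc j) nj.
rewrite bcomb_sum in v0.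
by apply: (homog_free us (fun j => bcomb_homog (hc j)) v0).
Qed.

End Comb.

Definition bspan n := exists (A : finType) (d : A -> int) (e : A -> M),
  [/\ #|A| = n, forall a, homog M (d a) (e a) & forall m, exists v, m = bcomb e v].

Lemma bspan_ex : finitely_generated M -> exists n, bspan n.
Proof.
move=> fg; have [A [d [e [he hs]]]] := homog_generators fg.
exists #|(A * 'I_k)%type : finType|, (A * 'I_k)%type, (fun x : A * 'I_k => d x.1 + x.2%:Z),
  (fun x : A * 'I_k => (qx pK k : R) ^+ x.2 *: e x.1); split=> // [[a j]|m] /=.
  exact: homog_qxn.
have [c ->] := hs m.
exists (fun x : A * 'I_k => (c x.1 : {poly pK})`_x.2 : pK).
rewrite /bcomb lcomb_prod; apply: eq_bigr => a _.
rewrite {1}[c a](qpoly_decomp k0) scaler_suml.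
by apply: eq_bigr => j _; rewrite scalerA.
Qed.

Hypothesis y_inj : forall m : M, ycoef 'X *: m = 0 -> m = 0.

Lemma yn_inj n (m : M) : ycoef 'X^n *: m = 0 -> m = 0.
Proof.
elim: n => [|n IH]; first by rewrite expr0 ycoef1 scale1r.
by rewrite exprS ycoefM -scalerA => /y_inj.
Qed.

(* Graded Nakayama: a minimal homogeneous spanning family is a basis. *)
Lemma homog_basis : finitely_generated M ->
  exists (A : finType) (d : A -> int) (e : A -> M),
    [/\ forall a, homog M (d a) (e a), forall m, exists v, m = bcomb e v
      & forall v, bcomb e v = 0 -> v = 0].
Proof.
move=> fg; have [n0 hn0] := bspan_ex fg.
have ex : exists n, `[< bspan n >] by exists n0; apply/asboolP.
case: (ex_minnP ex) => n /asboolP[A [d [e [cA he hs]]]] min.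
exists A, d, e; split=> // v v0.
have [s [c [us hc ev]]] := hpart_span d v.
have c0 i : bcomb e (comp d i v) = 0 by apply: bcomb_comp0.
suff h i : i \in s -> c i = 0 by rewrite ev big_seq big1.
move=> si; have {}c0 : bcomb e (c i) = 0.
  rewrite -(c0 i) ev comp_sum (bigD1_seq i) //= (comp_id (hc i)) big1 ?addr0 //.
  by move=> j nj; apply: comp_ne (hc j) nj.
have {ev us s si v v0} hi := hc i; move: (c i) c0 hi => v v0 hv {c hc}.
apply/eqP; apply: contraT => nv.
have [a1 na1] : exists a, v a != 0.
  apply: contra_neqP nv => h; apply: pvecP => a; apply/eqP.
  by apply: contra_notT h => ?; exists a.
pose P a := v a != 0.
(* In a homogeneous relation the coefficient at [a] is a scalar times y^(d a - i), so a generator of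
   least degree carries the least power of y. That power divides the whole relation, and injectivity
   of y cancels it. *)
have [a0 na0 mina0] := @Order.TotalTheory.arg_minP _ _ _ a1 P d na1.
have vE a : v a = (v a : pK)`_(absz (d a - i)%R) *: 'X^(absz (d a - i)%R).
  have [h|h] := leP i (d a); first by rewrite -{1}(comp_id hv) /comp h.
  suff -> : v a = 0 by rewrite coef0 scale0r.
  by rewrite -(comp_id hv) /comp leNgt h.
pose g a : K := (v a : pK)`_(absz (d a - i)%R).
have ia0 a : v a != 0 -> i <= d a.
  by move=> na; rewrite leNgt; apply: contra na => h; rewrite -(comp_id hv) /comp leNgt h.
pose w : pvec K A := fun a => (g a *: 'X^(absz (d a - d a0)%R) : pK).
have vw : v = ('X^(absz (d a0 - i)%R) : pK) *: w.
  apply: pvecP => a; rewrite /pvE -[RHS]/(('X^(absz (d a0 - i)%R) : pK) * w a) /w.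
  rewrite -scalerAr -exprD; have [va0|na] := eqVneq (v a) 0.
    by rewrite /g va0 coef0 scale0r.
  rewrite vE; congr (_ *: 'X^ _).
  by have := mina0 a na; have := ia0 _ na0; lia.
have {}v0 : bcomb e w = 0 by apply: (@yn_inj (absz (d a0 - i)%R)); rewrite -bcombZ -vw.
have ga0 : g a0 != 0 by apply: contraNneq na0 => h; rewrite vE -/(g a0) h scale0r.
suff : (n <= n.-1)%N.
  by rewrite -cA; have : (0 < #|A|)%N by [apply/card_gt0P; exists a0]; case: #|A| => // m _; rewrite ltnn.
apply: min; apply/asboolP.
exists 'I_#|predC1 a0|, (fun i => d (enum_val i)), (fun i => e (enum_val i)).
split=> //; first by rewrite card_ord cardC1 cA.
move=> m; have [u ->] := hs m.
(* The relation [w] has a nonzero scalar at [a0], so subtracting a multiple of it removes [a0] from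
   any combination: the remaining generators already span, against minimality. *)
pose u' : pvec K A := u - ((g a0)^-1 *: (u a0 : pK) : pK) *: w.
have u'0 : u' a0 = 0.
  rewrite /u' -[LHS]/((u a0 : pK) - ((g a0)^-1 *: (u a0 : pK)) * (w a0)) /w subrr expr0.
  rewrite -scalerAl -scalerAr mulr1 scalerA mulVf // scale1r.
  by rewrite subrr.
have -> : bcomb e u = bcomb e u' by rewrite bcombB bcombZ v0 scaler0 subr0.
exists (fun i => u' (enum_val i)).
rewrite /bcomb /lcomb (bigD1 a0) //= [u' a0]u'0 ycoef0 scale0r add0r.
by rewrite -(@big_enum_val _ _ _ A (predC1 a0) (fun a => ycoef (u' a) *: e a)).
Qed.

Section Coordinates.
Context (A : finType) (d : A -> int) (e : A -> M).
Hypotheses (he : forall a, homog M (d a) (e a)) (hs : forall m, exists v, m = bcomb e v)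
  (hf : forall v, bcomb e v = 0 -> v = 0).

Lemma bcomb_inj u v : bcomb e u = bcomb e v -> u = v.
Proof. by move=> h; apply/subr0_eq/hf; rewrite bcombB h subrr. Qed.

Lemma coord_hpart i v : homog M i (bcomb e v) -> hpart d i v.
Proof.
move=> h; have [s [c [us hc ev]]] := hpart_span d v.
have ev' := etrans (congr1 (bcomb e) ev) (bcomb_sum e s xpredT c).
have := homog_component h us (fun j => bcomb_homog he (hc j)) ev'.
case: ifP => _ e0; first by rewrite (bcomb_inj e0).
by rewrite (hf e0); apply: hpart0.
Qed.

Lemma coord_matrix : exists X : mhom A A,
  [/\ mdeg d d 1 X, forall v, bcomb e (hmap d d 1 X v) = (qx pK k : R) *: bcomb e v
    & pw X k = 0].
Proof.
have /choice[p hp] : forall b, exists v, (qx pK k : R) *: e b = bcomb e v by move=> b.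
have hpp b : hpart d (d b + 1) (p b).
  by apply: coord_hpart; rewrite -hp addrC; apply: homogZ (he b); apply: degR_qx.
pose X : mhom A A := fun a b =>
  if d b + 1 <= d a then (p b a : pK)`_(absz (d a - (d b + 1))%R) else 0.
have dX : mdeg d d 1 X by move=> a b; rewrite /X; case: ifP => //; rewrite eqxx.
have Xb b : hmap d d 1 X (pbasis K b) = p b.
  apply: pvecP => a; rewrite /pvE hmap_basis /hmx /X -{2}[p b](comp_id (hpp b)) /comp.
  case: ifP => _; last by rewrite scale0r.
  by rewrite opprD addrA.
have Xx v : bcomb e (hmap d d 1 X v) = (qx pK k : R) *: bcomb e v.
  rewrite [v]pvec_basis hmap_sumv !bcomb_sum scaler_sumr; apply: eq_bigr => b _.
  by rewrite hmap_scalev Xb !bcombZ bcomb_basis -hp !scalerA mulrC.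
exists X; split=> //.
apply: (@hmap_inj _ _ _ d d k%:Z) => v; rewrite hmap0; apply: hf.
have h n : bcomb e (hmap d d n%:Z (pw X n) v) = (qx pK k : R) ^+ n *: bcomb e v.
  elim: n => [|n IH]; first by rewrite hmap_id expr0 scale1r.
  by rewrite pwS intS (hmapM v dX (mdeg_pw dX)) Xx IH exprS scalerA.
by rewrite h [_ ^+ k](qx_nil pK k0) scale0r.
Qed.

End Coordinates.

End HomogeneousBasis.

(** * Localization at y and generic freeness *)

Section LaurentCoefficients.
Context (K : fieldType).
Notation pK := {poly K}.
Notation L := (laurent K).
Notation tX := (tofrac 'X : {fraction pK}).
Implicit Types (f g : L) (p : pK).

Definition pcoefz p (z : int) : K := if z is Posz j then p`_j else 0.

Lemma pcoefzXM p n z : pcoefz ('X^n * p) (n%:Z + z) = pcoefz p z.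
Proof.
case: z => j.
  have -> : n%:Z + Posz j = (n + j)%N%:Z by lia.
  by rewrite /= coefXnM ltnNge leq_addr /= addKn.
have [h|h] := leqP j.+1 n.
  have -> : n%:Z + Negz j = (n - j.+1)%N%:Z by lia.
  by rewrite /= coefXnM; have -> : (n - j.+1 < n)%N by lia.
by have -> : n%:Z + Negz j = Negz (j - n) by lia.
Qed.

Lemma laurent_ex f : exists np : nat * pK, (f : {fraction pK}) * tX ^+ np.1 = tofrac np.2.
Proof. by have /asboolP[n [p e]] := laurent_valP f; exists (n, p). Qed.

Definition ldenom f := projT1 (cid (laurent_ex f)).
Lemma ldenomP f : (f : {fraction pK}) * tX ^+ (ldenom f).1 = tofrac (ldenom f).2.
Proof. exact: (projT2 (cid (laurent_ex f))). Qed.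

(** If f y^n = p, the coefficient of y^m in f is that of y^(n+m) in p; [lcoefE] makes it independent
    of the chosen denominator. *)
Definition lcoef f (m : int) : K := pcoefz (ldenom f).2 ((ldenom f).1%:Z + m).

Lemma lcoefE f n p m : (f : {fraction pK}) * tX ^+ n = tofrac p ->
  lcoef f m = pcoefz p (n%:Z + m).
Proof.
move=> e; rewrite /lcoef; move: (ldenomP f); case: (ldenom f) => n' p' /= e'.
have : 'X^n * p' = 'X^n' * p.
  apply/eqP; rewrite -tofrac_eq !tofracM -e -e' !tofracXn.
  by rewrite mulrCA [X in _ * X]mulrC mulrCA.
move=> h; rewrite -(pcoefzXM p' n) -(pcoefzXM p n') h; congr pcoefz.
by rewrite !addrA [n%:Z + _]addrC.
Qed.

Lemma lcoefD f g m : lcoef (f + g) m = lcoef f m + lcoef g m.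
Proof.
have ef := ldenomP f; have eg := ldenomP g.
set n := (ldenom f).1 in ef; set n' := (ldenom g).1 in eg.
set p := (ldenom f).2 in ef; set p' := (ldenom g).2 in eg.
rewrite (@lcoefE _ (n' + n) ('X^n' * p + 'X^n * p')); last first.
  rewrite tofracD !tofracM -ef -eg !tofracXn -[laurent_val _]/(laurent_val f + laurent_val g).
  by rewrite exprD mulrDl [_ * (laurent_val f * _)]mulrCA [_ * (laurent_val g * _)]mulrCA [tX ^+ n * _]mulrC.
have pD u v z : pcoefz (u + v) z = pcoefz u z + pcoefz v z.
  by case: z => j; rewrite /= ?coefD ?addr0.
rewrite pD PoszD -addrA pcoefzXM addrCA pcoefzXM.
by rewrite -(lcoefE m ef) -(lcoefE m eg).
Qed.

Lemma lcoef_tl p m : lcoef (to_laurent p) m = pcoefz p m.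
Proof. by rewrite (@lcoefE _ 0 p) ?add0r // expr0 mulr1. Qed.

Lemma lcoef0 m : lcoef 0 m = 0.
Proof. by have := lcoef_tl 0 m; rewrite raddf0 => ->; case: m => j; rewrite /= ?coef0. Qed.

Lemma lcoef_sum (I : Type) (s : seq I) (P : pred I) (F : I -> L) m :
  lcoef (\sum_(i <- s | P i) F i) m = \sum_(i <- s | P i) lcoef (F i) m.
Proof. by apply: (big_morph (lcoef^~ m)) => [x y|]; rewrite ?lcoefD ?lcoef0. Qed.

Lemma lcoef_tlM c n f m :
  lcoef (to_laurent (c *: 'X^n) * f) m = c * lcoef f (m - n%:Z).
Proof.
have ef := ldenomP f; set n' := (ldenom f).1 in ef; set p := (ldenom f).2 in ef.
rewrite (@lcoefE _ n' (c *: ('X^n * p))); last first.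
  rewrite -[laurent_val _]/(tofrac (c *: 'X^n) * laurent_val f) -!mul_polyC !tofracM -ef.
  by rewrite !mulrA.
have pZ z u : pcoefz (c *: u) z = c * pcoefz u z.
  by case: z => j; rewrite /= ?coefZ ?mulr0.
have -> : n'%:Z + m = n%:Z + (n'%:Z + (m - n%:Z)) by ring.
by rewrite pZ pcoefzXM -(lcoefE _ ef).
Qed.

Lemma tX_neq0 : tX != 0. Proof. by rewrite tofrac_eq0 polyX_eq0. Qed.

Lemma lcoef_inj f g : (forall m, lcoef f m = lcoef g m) -> f = g.
Proof.
move=> h; have ef := ldenomP f; have eg := ldenomP g.
set n := (ldenom f).1 in ef; set n' := (ldenom g).1 in eg.
set p := (ldenom f).2 in ef; set p' := (ldenom g).2 in eg.
have e : 'X^n' * p = 'X^n * p'.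
  apply/polyP => j; pose m := j%:Z - (n + n')%N%:Z.
  have := h m; rewrite (lcoefE m ef) (lcoefE m eg).
  rewrite -(pcoefzXM p n') -(pcoefzXM p' n).
  have -> : n'%:Z + (n%:Z + m) = j%:Z by rewrite /m; lia.
  by have -> : n%:Z + (n'%:Z + m) = j%:Z by rewrite /m; lia.
apply: val_inj => /=.
have t0 n2 : tX ^+ n2 != 0 by rewrite expf_neq0 // tX_neq0.
apply: (mulIf (t0 (n + n')%N)); rewrite exprD [LHS]mulrA ef [tX ^+ n * _]mulrC [RHS]mulrA eg.
by rewrite -!tofracXn -!tofracM; congr tofrac; rewrite mulrC e mulrC.
Qed.

Lemma lmon_subproof (c : K) (m : int) : tofrac c%:P * tX ^ m \in @laurent_pred K.
Proof.
apply/asboolP; case: m => n.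
  by exists 0, (c%:P * 'X^n); rewrite expr0 mulr1 tofracM tofracXn.
exists n.+1, c%:P; rewrite NegzE -exprnN -mulrA mulVf ?mulr1 //.
by rewrite expf_neq0 // tX_neq0.
Qed.
Definition lmon c m : L := Laurent (lmon_subproof c m).

Lemma lmonM c c' m m' : lmon c m * lmon c' m' = lmon (c * c') (m + m').
Proof.
apply: val_inj; rewrite -[LHS]/(laurent_val (lmon c m) * laurent_val (lmon c' m')) /=.
by rewrite polyCM tofracM expfzDr ?tX_neq0 // mulrACA.
Qed.

Lemma lmon_nat c n : lmon c n%:Z = to_laurent (c *: 'X^n).
Proof. by apply: val_inj; rewrite /= -mul_polyC tofracM tofracXn. Qed.

Lemma lcoef_lmon c m j : lcoef (lmon c m) j = if j == m then c else 0.
Proof.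
case: m => n.
  rewrite lmon_nat lcoef_tl; case: j => j //=; rewrite coefZ coefXn.
  by rewrite eqz_nat; case: eqP => _; rewrite ?mulr1 ?mulr0.
have e : (lmon c (Negz n) : {fraction pK}) * tX ^+ n.+1 = tofrac c%:P.
  rewrite /= NegzE -exprnN -mulrA mulVf ?mulr1 //.
  by rewrite expf_neq0 // tX_neq0.
rewrite (lcoefE j e); have [->|ne] := eqVneq j (Negz n).
  have -> : n.+1%:Z + Negz n = 0%:Z by lia.
  by rewrite /pcoefz coefC; exact: erefl.
have : n.+1%:Z + j != 0 by apply: contraNneq ne => h; apply/eqP; lia.
by case: (_ + _) => //= l; rewrite coefC; case: l.
Qed.

Lemma lmonD c c' m : lmon (c + c') m = lmon c m + lmon c' m.
Proof. by apply: val_inj; rewrite /= polyCD tofracD mulrDl. Qed.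

Lemma lmon0 m : lmon 0 m = 0.
Proof. by apply: val_inj; rewrite /= tofrac0 mul0r. Qed.

Lemma lmon1 : lmon 1 0 = 1.
Proof. by rewrite -[0]/(0%:Z) lmon_nat expr0 scale1r rmorph1. Qed.

Lemma laurent_sum f : exists (s : seq int), uniq s /\ forall t, uniq t -> {subset s <= t} ->
  f = \sum_(m <- t) lmon (lcoef f m) m.
Proof.
pose n := (ldenom f).1; pose p := (ldenom f).2.
pose s := [seq i%:Z - n%:Z | i <- iota 0 (size p)].
exists s; split.
  by rewrite map_inj_uniq ?iota_uniq // => i j; lia.
move=> t ut st; apply: lcoef_inj => m; rewrite lcoef_sum.
have [mt|mt] := boolP (m \in t).
  rewrite (bigD1_seq m) //= lcoef_lmon eqxx big1 ?addr0 // => j nj.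
  by rewrite lcoef_lmon eq_sym (negbTE nj).
rewrite big_seq big1 => [|j jt]; last first.
  by rewrite lcoef_lmon ifN //; apply: contraNneq mt => ->.
apply/eqP; apply: contraNT mt => h; apply: st; move: h.
rewrite /lcoef -/n -/p; case e : (n%:Z + m) => [j|j] /=; last by rewrite eqxx.
move=> h; apply/mapP; exists j; last by lia.
rewrite mem_iota /= add0n ltnNge; apply: contra h => h.
by rewrite nth_default.
Qed.

End LaurentCoefficients.

Section Localization.
Context (K : fieldType) (k : nat) (k2 : (2 <= k)%N).
Notation mhom := (@hom K (mx_cat K)).
Notation pK := {poly K}.
Notation L := (laurent K).
Notation R := (ringR K k).
Notation F := (ringF K k).
Let k0 : (0 < k)%N. Proof. exact: ltnW. Qed.

Definition lc (f : L) : F := qc k f.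
Lemma lcD f g : lc (f + g) = lc f + lc g. Proof. exact: (raddfD (qc k)). Qed.
Lemma lcM f g : lc (f * g) = lc f * lc g. Proof. exact: (rmorphM (qc k)). Qed.
Lemma lc0 : lc 0 = 0. Proof. exact: (raddf0 (qc k)). Qed.
Lemma lc1 : lc 1 = 1. Proof. exact: (rmorph1 (qc k)). Qed.
Definition xF : F := qx L k.
Definition xR : R := qx pK k.

Lemma locR_ycoef p : locR (ycoef k p) = lc (to_laurent p).
Proof. by rewrite /ycoef /qc locR_in map_polyC. Qed.

Lemma locR_x : locR xR = xF.
Proof. by rewrite /xR /qx locR_in map_polyX. Qed.

Definition loc_linear (U : lmodType R) (V : lmodType F) (f : U -> V) :=
  forall r u v, f (r *: u + v) = locR r *: f u + f v.

Lemma loc_linearP (U : lmodType R) (V : lmodType F) (f : U -> V) :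
  (forall u v, f (u + v) = f u + f v) ->
  (forall p u, f (ycoef k p *: u) = lc (to_laurent p) *: f u) ->
  (forall u, f (xR *: u) = xF *: f u) -> loc_linear f.
Proof.
move=> fD fc fx r u v; rewrite fD; congr (_ + _).
have f0 : f 0 = 0 by apply: (addIr (f 0)); rewrite -fD !add0r.
have fX n w : f (xR ^+ n *: w) = xF ^+ n *: f w.
  by elim: n => [|n IH]; rewrite ?expr0 ?scale1r // !exprS -!scalerA fx IH.
rewrite {1}[r](qpoly_decomp k0) scaler_suml (big_morph f fD f0).
have -> : locR r = \sum_(j < k) lc (to_laurent (r : {poly pK})`_j) * xF ^+ j.
  rewrite [in LHS](qpoly_decomp k0 r) rmorph_sum; apply: eq_bigr => j _.
  rewrite -[LHS]/(locR (ycoef k (r : {poly pK})`_j * xR ^+ j)) (rmorphM (@locR K k)).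
  rewrite (rmorphXn (@locR K k)); congr (_ * _); first exact: locR_ycoef.
  by congr (_ ^+ _); apply: locR_x.
rewrite scaler_suml; apply: eq_bigr => j _.
by rewrite -[qc k _]/(ycoef k _) -!scalerA fc fX.
Qed.

Section Semilinear.
Context (U : lmodType R) (V : lmodType F) (f : U -> V) (hf : loc_linear f).
Lemma loc_linear0 : f 0 = 0.
Proof. by have := hf (-1) 0 0; rewrite scaler0 addr0 rmorphN1 scaleN1r addNr. Qed.
Lemma loc_linearD u v : f (u + v) = f u + f v.
Proof. by have := hf 1 u v; rewrite scale1r rmorph1 scale1r. Qed.
Lemma loc_linearZ r u : f (r *: u) = locR r *: f u.
Proof. by have := hf r u 0; rewrite loc_linear0 !addr0. Qed.
Lemma loc_linear_lcomb (A : finType) (e : A -> U) c :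
  f (lcomb e c) = lcomb (f \o e) (fun a => locR (c a)).
Proof.
rewrite (big_morph f loc_linearD loc_linear0); apply: eq_bigr => a _.
exact: loc_linearZ.
Qed.
End Semilinear.

Context (A : finType) (d : A -> int) (X : mhom A A) (dX : mdeg d d 1 X) (nX : pw X k = 0).

Definition lvec : lmodType L := A -> L^o.
Definition tlv (v : pvec K A) : lvec := fun a => to_laurent (v a).
Definition lxact (v : lvec) : lvec :=
  fun a => \sum_b to_laurent (hmx d d 1 X a b) * (v b : L).
Definition lbasis_vec (a : A) : lvec := tlv (pbasis K a).

Lemma lvecP (u v : lvec) : (forall a, u a = v a) -> u = v.
Proof. by move=> h; apply/funext. Qed.

Lemma lxact_linear : linear lxact.
Proof.
move=> c u v; apply: lvecP => a.
rewrite -[RHS]/(c * (lxact u a : L) + lxact v a) /lxact mulr_sumr -big_split.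
by apply: eq_bigr => b _; rewrite -[(c *: u + v) b]/(c * (u b : L) + v b) mulrDr mulrCA.
Qed.

Lemma lvec_basis (v : lvec) : v = \sum_a (v a : L) *: lbasis_vec a.
Proof.
apply: lvecP => a; rewrite fct_sumE (bigD1 a) //= big1 ?addr0 => [|b nb].
  rewrite -[RHS]/((v a : L) * to_laurent (pbasis K a a)) /pbasis eqxx.
  by rewrite [to_laurent _]rmorph1 mulr1.
rewrite -[LHS]/((v b : L) * to_laurent (pbasis K b a)) /pbasis eq_sym (negbTE nb).
by rewrite [to_laurent _]raddf0 mulr0.
Qed.

Lemma lxact_tlv v : lxact (tlv v) = tlv (hmap d d 1 X v).
Proof.
apply: lvecP => a; rewrite /tlv /hmap raddf_sum; apply: eq_bigr => b _.
by rewrite -rmorphM.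
Qed.

Lemma iter_lxact_tlv n v : iter n lxact (tlv v) = tlv (hmap d d n%:Z (pw X n) v).
Proof.
elim: n => [|n IH]; first by rewrite hmap_id.
by rewrite iterS IH lxact_tlv pwS intS (hmapM v dX (mdeg_pw dX)).
Qed.

Lemma iter_lxact_linear n : linear (iter n lxact).
Proof. by elim: n => [//|n IH] c u v; rewrite !iterS IH lxact_linear. Qed.

Lemma iter_lxact_sum n (v : lvec) :
  iter n lxact v = \sum_a (v a : L) *: iter n lxact (lbasis_vec a).
Proof.
rewrite [in LHS](lvec_basis v); pose il := mk_linear (iter_lxact_linear n).
by rewrite -[LHS]/(il _) linear_sum; apply: eq_bigr => a _; rewrite -[LHS]/(il _) linearZ_LR.
Qed.

Lemma lxact_nil v : iter k lxact v = 0.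
Proof.
rewrite iter_lxact_sum big1 // => a _; rewrite iter_lxact_tlv nX hmap0.
rewrite (_ : tlv 0 = 0) ?scaler0 //; apply: lvecP => b; exact: raddf0.
Qed.

(** A concrete model of the localization at y, to which the universal property of an abstract base
    change [T] is applied. *)
Definition locmod : lmodType F := nilmod k0 lxact_linear lxact_nil.

Lemma locmod_lc (f : L) (v : locmod) : lc f *: v = (f *: (v : lvec)) :> lvec.
Proof. exact: (@nilmod_qc _ k k0 _ _ lxact_linear lxact_nil). Qed.

Lemma locmod_x (v : locmod) : xF *: v = lxact v.
Proof. exact: (@nilmod_qx _ k k0 _ _ lxact_linear lxact_nil). Qed.

Lemma locmod_xn n (v : locmod) : xF ^+ n *: v = iter n lxact v.
Proof.
elim: n v => [|n IH] v; first by rewrite expr0 scale1r.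
by rewrite exprS -scalerA IH locmod_x.
Qed.

Section GenericallyFreeUnit.
Context (M : grModule (@degR K k)) (e : A -> M).
Hypotheses (hs : forall m, exists v, m = bcomb e v) (hf : forall v, bcomb e v = 0 -> v = 0)
  (hx : forall v, bcomb e (hmap d d 1 X v) = xR *: bcomb e v).
Context (T : lmodType F) (t : M -> T) (bc : is_base_change (@locR K k) t).
Context (n : nat) (E : 'I_n -> T).
Hypothesis hE : forall m : T, exists! c : {ffun 'I_n -> F}, m = \sum_i c i *: E i.

Definition gcoord (m : M) : pvec K A := projT1 (cid (hs m)).
Lemma gcoordP m : m = bcomb e (gcoord m). Proof. exact: (projT2 (cid (hs m))). Qed.
Lemma gcoord_comb v : gcoord (bcomb e v) = v.
Proof. by apply: (bcomb_inj hf); rewrite -gcoordP. Qed.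

Definition gloc (m : M) : locmod := tlv (gcoord m).

Lemma gloc_loc_linear : loc_linear gloc.
Proof.
apply: loc_linearP.
- move=> u v; rewrite /gloc {1}(gcoordP u) {1}(gcoordP v) -bcombD gcoord_comb.
  by apply: lvecP => a; apply: (raddfD (@to_laurent K)).
- move=> p u; rewrite [RHS]locmod_lc.
  have -> : ycoef k p *: u = bcomb e (p *: gcoord u) by rewrite (bcombZ k2) -gcoordP.
  rewrite /gloc gcoord_comb.
  by apply: lvecP => a; apply: (rmorphM (@to_laurent K)).
move=> u; rewrite [RHS]locmod_x lxact_tlv; congr tlv.
have -> : xR *: u = bcomb e (hmap d d 1 X (gcoord u)) by rewrite hx -gcoordP.
exact: gcoord_comb.
Qed.

Lemma tcoord_ex (u : T) : exists c : {ffun 'I_n -> F}, u = lcomb E c.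
Proof. by have [c [h _]] := hE u; exists c. Qed.
Definition tcoord (u : T) : 'I_n -> F := projT1 (cid (tcoord_ex u)).
Lemma tcoordP u : lcomb E (tcoord u) = u.
Proof. exact/esym/(projT2 (cid (tcoord_ex u))). Qed.
Lemma tcoord_comb c : tcoord (lcomb E c) = c.
Proof.
have [c0 [_ u0]] := hE (lcomb E c).
have e1 := u0 _ (projT2 (cid (tcoord_ex (lcomb E c)))).
have e2 : c0 = finfun c.
  by apply: u0; apply: eq_bigr => i _; rewrite ffunE.
by apply/funext => i; rewrite /tcoord -e1 e2 ffunE.
Qed.

Definition xcoef j (r : F) : F := lc ((r : {poly L})`_j).
Lemma xcoefP j f r s : xcoef j (lc f * r + s) = lc f * xcoef j r + xcoef j s.
Proof.
rewrite /xcoef -lcM -(coef_qcM k0) -lcD; apply: congr1.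
exact: (coefD (lc f * r : F) s).
Qed.

Lemma coef_xFM (r : F) m l : (m <= l)%N -> (l < k)%N ->
  ((xF ^+ m * r : F) : {poly L})`_l = (r : {poly L})`_(l - m).
Proof.
elim: m l => [|m IH] l hml hl; first by rewrite expr0 mul1r subn0.
rewrite exprS -mulrA (coef_qxM k0) hl; case: l hml hl => // l hml hl.
by rewrite IH ?subSS // ltnW.
Qed.

(** In a basis of [T], the Laurent-linear map that extracts the coefficient of x^(k-1) and puts it
    back as a constant. It solves the norm equation on a free module, see [tsig_unit]. *)
Definition tsig (u : T) : T := lcomb E (fun i => xcoef k.-1 (tcoord u i)).

Lemma tsigE c : tsig (lcomb E c) = lcomb E (fun i => xcoef k.-1 (c i)).
Proof. by rewrite /tsig tcoord_comb. Qed.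

Lemma tsigP f u v : tsig (lc f *: u + v) = lc f *: tsig u + tsig v.
Proof.
rewrite -{1}(tcoordP u) -{1}(tcoordP v) -lcombZ -lcombD tsigE -lcombZ -lcombD.
by congr lcomb; apply/funext => i; apply: xcoefP.
Qed.

Lemma tsig_xn u j : (j < k)%N ->
  tsig (xF ^+ (k.-1 - j) *: u) = lcomb E (fun i => xcoef j (tcoord u i)).
Proof.
move=> hj; have hj' : (j <= k.-1)%N by rewrite -ltnS prednK.
have hk : (k.-1 < k)%N by rewrite prednK.
have := leq_subr j k.-1; have := subKn hj'; move: (k.-1 - j)%N => m em lm.
have -> : xF ^+ m *: u = lcomb E (fun i => xF ^+ m * tcoord u i).
  by rewrite lcombZ tcoordP.
rewrite tsigE; apply: (congr1 (lcomb E)); apply/funext => i; apply: (congr1 lc).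
by rewrite (coef_xFM _ lm hk) em.
Qed.

Lemma lcomb_sum (J : finType) (c : J -> 'I_n -> F) :
  \sum_j lcomb E (c j) = lcomb E (fun i => \sum_j c j i).
Proof.
by rewrite /lcomb exchange_big; apply: eq_bigr => i _; rewrite scaler_suml.
Qed.

Lemma tsig_unit u : \sum_(j < k) xF ^+ j *: tsig (xF ^+ (k.-1 - j) *: u) = u.
Proof.
transitivity (\sum_(j < k) lcomb E (fun i => xF ^+ j * xcoef j (tcoord u i))).
  by apply: eq_bigr => j _; rewrite tsig_xn // lcombZ.
rewrite lcomb_sum -[RHS]tcoordP; congr lcomb; apply/funext => i.
rewrite [RHS](qpoly_decomp k0 (tcoord u i)); apply: eq_bigr => j _; exact: mulrC.
Qed.

Lemma lcoef_hmxM m j g a c : lcoef (to_laurent (hmx d d j%:Z (pw X j) a c) * g) m =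
  pw X j a c * lcoef g (m - (d a - d c - j%:Z)).
Proof.
rewrite lcoef_tlM; have [->|h] := eqVneq (pw X j a c) 0; first by rewrite !mul0r.
have {}h : d c + j%:Z <= d a by apply: (mdeg_pw dX).
by congr (_ * lcoef g (m - _)); rewrite gez0_abs // -addrA -opprD subr_ge0.
Qed.

Lemma tsigD u v : tsig (u + v) = tsig u + tsig v.
Proof. by have := tsigP 1 u v; rewrite lc1 !scale1r. Qed.
Lemma tsig0 : tsig 0 = 0.
Proof. by apply: (addIr (tsig 0)); rewrite -tsigD !add0r. Qed.
Lemma tsigZ f u : tsig (lc f *: u) = lc f *: tsig u.
Proof. by have := tsigP f u 0; rewrite tsig0 !addr0. Qed.

Lemma t_x m v : xF ^+ m *: t (bcomb e v) = t (bcomb e (hmap d d m%:Z (pw X m) v)).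
Proof.
elim: m => [|m IH]; first by rewrite hmap_id expr0 scale1r.
rewrite pwS intS (hmapM v dX (mdeg_pw dX)) hx (loc_linearZ bc.1) -IH.
by rewrite locR_x exprS scalerA.
Qed.

Lemma t_comb v : t (bcomb e v) = lcomb (t \o e) (fun a => lc (to_laurent (v a))).
Proof.
rewrite (loc_linear_lcomb bc.1); congr lcomb; apply/funext => a.
exact: locR_ycoef.
Qed.

(** The map [tsig] is transported to a matrix [S] of Laurent polynomials that satisfies the norm
    equation. [S] need not be homogeneous, but its part of degree [1 - k] solves the same equation,
    since the norm raises degrees by [k - 1] and the identity has degree 0. *)
Lemma gen_free_unit : has_unit k X.
Proof.
have [_ /(_ locmod gloc gloc_loc_linear)[h [hh _]]] := bc.
have hb b : h (t (e b)) = lbasis_vec b.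
  by rewrite hh /gloc -[e b](bcomb_basis k2 e b) gcoord_comb.
pose S c b : L := (h (tsig (t (e b))) : lvec) c.
have hx' m b c : (h (tsig (xF ^+ m *: t (e b))) : lvec) c =
    (\sum_c' S c c' * to_laurent (hmx d d m%:Z (pw X m) c' b)).
  rewrite -[e b in LHS](bcomb_basis k2 e b) t_x t_comb.
  rewrite (big_morph _ tsigD tsig0) linear_sum fct_sumE; apply: eq_bigr => c' _.
  rewrite tsigZ linearZ_LR locmod_lc -[LHS]/(to_laurent _ * S c c') mulrC.
  by rewrite hmap_basis.
have key a b : \sum_(j < k) \sum_c \sum_c' to_laurent (hmx d d j%:Z (pw X j) a c) *
    (S c c' * to_laurent (hmx d d (k.-1 - j)%:Z (pw X (k.-1 - j)) c' b)) =
    if a == b then 1 else 0.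
  transitivity (lbasis_vec b a); last first.
    rewrite /lbasis_vec /tlv /pbasis.
    by case: eqP => _; [apply: (rmorph1 (@to_laurent K)) | apply: (raddf0 (@to_laurent K))].
  rewrite -hb -[in RHS](tsig_unit (t (e b))) linear_sum fct_sumE.
  apply: eq_bigr => j _; rewrite linearZ_LR locmod_xn iter_lxact_sum fct_sumE.
  apply: eq_bigr => c _; rewrite iter_lxact_tlv -mulr_sumr -hx'.
  by rewrite -[RHS]/(_ * to_laurent _) hmap_basis mulrC.
(* A homogeneous entry of degree [r] is a multiple of y^(d c - d c' - r); here [r = 1 - k]. *)
exists (fun c c' => lcoef (S c c') (d c - d c' + k.-1%:Z)); apply: mxP => a b.
have ek := congr1 (fun f => lcoef f (d a - d b)) (key a b).
rewrite lcoef_sum in ek; rewrite mx_idE.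
transitivity (lcoef (if a == b then 1 else 0 : L) (d a - d b)).
  rewrite -{}ek /nrm mx_sumE; apply: eq_bigr => j _; rewrite lcoef_sum mx_cmpE.
  transitivity (\sum_c \sum_c' pw X j a c * lcoef (S c c') (d c - d c' + k.-1%:Z)
      * pw X (k.-1 - j) c' b).
    rewrite exchange_big; apply: eq_bigr => c' _; rewrite mx_cmpE mulr_suml.
    by [].
  apply: eq_bigr => c _; rewrite lcoef_sum; apply: eq_bigr => c' _.
  rewrite lcoef_hmxM [S c c' * _]mulrC lcoef_hmxM -mulrA; congr (_ * _).
  rewrite mulrC; congr (_ * _); apply: congr1.
  have hj : (j <= k.-1)%N by rewrite -ltnS prednK.
  by rewrite -subzn //; lia.
have [->|nab] := eqVneq a b; first by rewrite subrr -lmon1 lcoef_lmon !eqxx.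
by rewrite lcoef0.
Qed.
End GenericallyFreeUnit.
End Localization.

(** * Free bases over K[X]/(X^k) from a unit matrix *)

Section UnitBasis.
Context (K : fieldType).
Notation mhom := (@hom K (mx_cat K)).

Definition mx_of (A B : finType) (f : mhom A B) : 'M[K]_(#|B|, #|A|) :=
  \matrix_(i, j) f (enum_val i) (enum_val j).

Lemma rank_factor (A : finType) (P : mhom A A) :
  exists (n : nat) (l : mhom ('I_n : finType) A) (l' : mhom A ('I_n : finType))
    (r : mhom A ('I_n : finType)) (r' : mhom ('I_n : finType) A),
  [/\ P = l \c r, l' \c l = idm _ & r \c r' = idm _].
Proof.
pose M := mx_of P; pose n := \rank M.
exists n, (fun a i => col_base M (enum_rank a) i), (fun i a => pinvmx (col_base M) i (enum_rank a)),
  (fun i a => row_base M i (enum_rank a)), (fun a i => pinvmx (row_base M) (enum_rank a) i).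
split; apply: mxP => b a.
- rewrite mx_cmpE; have /matrixP/(_ (enum_rank b) (enum_rank a)) := mulmx_base M.
  by rewrite mxE [RHS]mxE !enum_rankK => <-.
- rewrite mx_cmpE mx_idE sum_enum_val.
  have /matrixP/(_ b a) := mulVpmx (col_base_full M).
  rewrite !mxE => <-; by apply: eq_bigr => i _; rewrite enum_valK.
rewrite mx_cmpE mx_idE sum_enum_val.
have /matrixP/(_ b a) := mulmxVp (row_base_free M).
rewrite !mxE => <-; by apply: eq_bigr => i _; rewrite enum_valK.
Qed.

(* [chi] spans a complement of the image of X: the matrix category sees a
   module with unit element as the free K[X]/X^k-module on [chi]. *)
Lemma unit_basis (k : nat) (A : finType) (X : mhom A A) : (0 < k)%N ->
  pw X k = 0 -> has_unit k X ->
  exists (n : nat) (chi : mhom ('I_n : finType) A) (psi : nat -> mhom A ('I_n : finType)),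
  [/\ \sum_(j < k) pw X j \c chi \c psi j = idm _,
      forall j, (j < k)%N -> psi j \c chi = if j == 0 then idm _ else 0,
      psi 0 \c X = 0 & forall j, (j.+1 < k)%N -> psi j.+1 \c X = psi j].
Proof.
move=> k0 X0 [e e1].
have [n [l [l' [r [r' [P ll rr]]]]]] := rank_factor (pw X k.-1).
have Xge j : (k <= j)%N -> pw X j = 0 by move=> h; rewrite -(subnKC h) pwD X0 cmp0m.
(* [W] is a partial inverse of [X]. In the norm equation every term but the one with j = 0 has a
   factor [X] on the left; that remaining term is [e \c pw X k.-1], and [pw X k.-1 = l \c r] kills
   [idm _ - r' \c r]. *)
pose W := (\sum_(j < k) (if j == 0 :> nat then 0 else pw X j.-1 \c e \c pw X (k.-1 - j)))
  \c (idm _ - r' \c r).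
have XW : X \c W = idm _ - r' \c r.
  have -> : X \c W = (idm _ - e \c pw X k.-1) \c (idm _ - r' \c r).
    rewrite /W cmpA; congr (_ \c _); rewrite cmp_sumr -[X in _ = X - _]e1 /nrm.
    apply/eqP; rewrite eq_sym subr_eq; apply/eqP.
    move: (prednK k0); move: k.-1 => q <-; rewrite !big_ord_recl /= cmpm0 add0r cmp1m subn0 addrC; congr (_ + _).
    by apply: eq_bigr => j _; rewrite -!cmpA.
  rewrite cmpBl cmp1m -cmpA.
  have -> : pw X k.-1 \c (idm _ - r' \c r) = 0.
    by rewrite cmpBr cmpm1 P cmpA -[l \c r \c r']cmpA rr cmpm1 subrr.
  by rewrite cmpm0 subr0.
pose psi j := r \c pw W j.
(* Substituting [r' \c r = idm _ - X \c W] makes the sum telescope. *)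
have sumE : \sum_(j < k) pw X j \c r' \c psi j = idm _.
  pose F j := pw X j \c pw W j.
  transitivity (\sum_(j < k) (F j - F j.+1)).
    apply: eq_bigr => j _; rewrite /psi -cmpA [r' \c _]cmpA.
    have -> : r' \c r = idm _ - X \c W by rewrite XW opprB addrC subrK.
    by rewrite cmpBl cmp1m cmpBr /F pwSr pwS !cmpA.
  transitivity (F 0 - F k); last by rewrite /F X0 cmp0m subr0 !pw0 cmp1m.
  elim: (k) => [|m IH]; first by rewrite big_ord0 subrr.
  by rewrite big_ord_recr IH /= addrA subrK.
(* Coefficients are recovered one at a time, from the lowest: multiplication by X^(k-1-j) kills the
   higher terms and turns the power in the [j]-th into [pw X k.-1], which becomes the identity
   between [l'] and [r']. *)
have inj (B : finType) (f : nat -> mhom B ('I_n : finType)) :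
    \sum_(j < k) pw X j \c r' \c f j = 0 -> forall j, (j < k)%N -> f j = 0.
  move=> s0; elim/ltn_ind => j IH hj.
  have := congr1 (fun g => l' \c (pw X (k.-1 - j) \c g)) s0.
  rewrite !cmpm0 cmp_sumr cmp_sumr (bigD1 (Ordinal hj)) //= big1 ?addr0.
    rewrite !cmpA -[l' \c _ \c pw X j]cmpA -pwD.
    have -> : (k.-1 - j + j = k.-1)%N by rewrite subnK // -ltnS prednK.
    by rewrite P cmpA ll cmp1m rr cmp1m.
  move=> i /eqP/val_eqP/= ij.
  have [ij'|ij'] := ltnP i j; first by rewrite (IH i) ?cmpm0 //.
  rewrite !cmpA -[l' \c _ \c pw X i]cmpA -pwD Xge ?cmpm0 ?cmp0m //.
  move: ij ij' hj; lia.
have eqj (B : finType) (f g : nat -> mhom B ('I_n : finType)) :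
    \sum_(j < k) pw X j \c r' \c f j = \sum_(j < k) pw X j \c r' \c g j ->
    forall j, (j < k)%N -> f j = g j.
  move=> h j hj; apply/subr0_eq; apply: (inj B (fun j => f j - g j)) => //.
  under eq_bigr => i _ do rewrite cmpBr.
  by rewrite sumrB h subrr.
have shiftE j : (j < k)%N -> psi j \c X = if j is j'.+1 then psi j' else 0.
  apply: (eqj _ (fun j => psi j \c X) (fun j => if j is j'.+1 then psi j' else 0)).
  transitivity ((\sum_(j < k) pw X j \c r' \c psi j) \c X).
    by rewrite cmp_suml; apply: eq_bigr => i _; rewrite cmpA.
  rewrite sumE cmp1m; transitivity (X \c (\sum_(j < k) pw X j \c r' \c psi j)).
    by rewrite sumE cmpm1.
  rewrite -(prednK k0) big_ord_recr [in RHS]big_ord_recl /= cmpDr cmpm0 add0r.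
  rewrite !cmpA -pwS prednK // X0 !cmp0m addr0 cmp_sumr; apply: eq_bigr => i _.
  by rewrite /= !cmpA.
exists n, r', psi; split=> //; last 2 first.
- exact: (shiftE 0).
- by move=> j; apply: (shiftE j.+1).
apply: (eqj _ (fun j => psi j \c r') (fun j => if j == 0 then idm _ else 0)).
transitivity ((\sum_(j < k) pw X j \c r' \c psi j) \c r').
  by rewrite cmp_suml; apply: eq_bigr => i _; rewrite cmpA.
rewrite sumE cmp1m -(prednK k0) big_ord_recl /= cmp1m cmpm1 big1 ?addr0 // => i _.
by rewrite cmpm0.
Qed.
End UnitBasis.

(** * Graded freeness of the localization *)

Section FreeOverF.
Context (K : fieldType) (k : nat) (k2 : (2 <= k)%N).
Notation mhom := (@hom K (mx_cat K)).
Notation pK := {poly K}.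
Notation L := (laurent K).
Notation R := (ringR K k).
Notation F := (ringF K k).
Notation lc := (@lc K k).
Notation xF := (xF K k).
Notation lmon := (@lmon K).
Let k0 : (0 < k)%N. Proof. exact: ltnW. Qed.

Lemma lcoefB (f g : L) m : lcoef (f - g) m = lcoef f m - lcoef g m.
Proof. by apply: (addIr (lcoef g m)); rewrite -lcoefD !subrK. Qed.

Lemma degFP i (f : F) :
  degF i f <-> forall l m, m != l%:Z - i -> lcoef ((f : {poly L})`_l) m = 0.
Proof.
split=> [h l m ml|h l].
  have [c hc] := h l.
  have -> : (f : {poly L})`_l = lmon c (l%:Z - i) by apply: val_inj.
  by rewrite lcoef_lmon (negbTE ml).
exists (lcoef ((f : {poly L})`_l) (l%:Z - i)).
suff e : (f : {poly L})`_l = lmon (lcoef ((f : {poly L})`_l) (l%:Z - i)) (l%:Z - i).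
  exact: (congr1 (@laurent_val K) e).
  apply: lcoef_inj => m; rewrite lcoef_lmon.
  by have [->|/h] := eqVneq m (l%:Z - i).
Qed.

Lemma coefF_B (f g : F) l :
  ((f - g : F) : {poly L})`_l = (f : {poly L})`_l - (g : {poly L})`_l.
Proof. exact: coefB. Qed.
Lemma coefF_D (f g : F) l :
  ((f + g : F) : {poly L})`_l = (f : {poly L})`_l + (g : {poly L})`_l.
Proof. exact: coefD. Qed.

Lemma degF0 i : degF i (0 : F).
Proof. by apply/degFP => l m _; rewrite coef0 lcoef0. Qed.

Lemma degFB i (f g : F) : degF i f -> degF i g -> degF i (f - g).
Proof.
move=> /degFP hf /degFP hg; apply/degFP => l m lm.
by rewrite coefF_B lcoefB hf // hg // subrr.
Qed.

Lemma degFD i (f g : F) : degF i f -> degF i g -> degF i (f + g).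
Proof.
move=> /degFP hf /degFP hg; apply/degFP => l m lm.
by rewrite coefF_D lcoefD hf // hg // addr0.
Qed.

Lemma degF_sum i (I : Type) (s : seq I) (P : pred I) (G : I -> F) :
  (forall a, P a -> degF i (G a)) -> degF i (\sum_(a <- s | P a) G a).
Proof.
by move=> h; elim/big_ind: _ => //; [exact: degF0 | move=> *; exact: degFD].
Qed.

Lemma degF_xF i (f : F) : degF i f -> degF (i + 1) (xF * f).
Proof.
move=> /degFP hf; apply/degFP => l m lm; rewrite (coef_qxM k0).
case: ifP => _; rewrite ?lcoef0 //; case: l lm => [|l] lm; rewrite ?lcoef0 //.
by apply: hf; apply: contra_neq lm => ->; lia.
Qed.

Lemma degF_lmon i c n (f : F) : degF i f -> degF (i - n) (lc (lmon c n) * f).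
Proof.
move=> hf l; have [c' hc] := hf l; exists (c * c'); rewrite (coef_qcM k0).
have -> : (f : {poly L})`_l = lmon c' (l%:Z - i) by apply: val_inj.
by rewrite lmonM; congr (_ * _ ^ _); lia.
Qed.

Lemma degFM i j (f g : F) : degF i f -> degF j g -> degF (i + j) (f * g).
Proof.
move=> hf hg; rewrite [f](qpoly_decomp k0) mulr_suml; apply: degF_sum => l _.
have [c hc] := hf l.
have -> : (f : {poly L})`_l = lmon c (l%:Z - i) by apply: val_inj.
rewrite -mulrA (_ : i + j = j + l%:Z - (l%:Z - i)); last by lia.
apply: degF_lmon; elim: (l : nat) => [|n IH]; first by rewrite expr0 mul1r addr0.
rewrite exprS -mulrA (_ : j + n.+1%:Z = j + n%:Z + 1); last by lia.
exact: degF_xF.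
Qed.

Lemma degF1 : degF 0 (1 : F).
Proof.
move=> l; exists (l == 0)%:R; rewrite -[1 in LHS](rmorph1 (qc k)) (coef_qc k0).
case: l => [|l]; first by rewrite subrr expr0z mulr1 polyC1 tofrac1.
by rewrite polyC0 tofrac0 mul0r.
Qed.

Definition degF_part i (f : F) : F :=
  \sum_(l < k) lc (lmon (lcoef ((f : {poly L})`_l) (l%:Z - i)) (l%:Z - i)) * xF ^+ l.

Lemma degF_part_deg i f : degF i (degF_part i f).
Proof.
apply: degF_sum => l _; rewrite {1}(_ : i = l%:Z - (l%:Z - i)); last by lia.
apply: degF_lmon => j; rewrite coef_qx_exp //.
have [->|_] := eqVneq j l; last by exists 0; rewrite polyC0 tofrac0 mul0r.
by exists 1; rewrite subrr expr0z mulr1 polyC1 tofrac1.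
Qed.

Lemma degF_part_sum f : exists s : seq int, forall t, uniq t -> {subset s <= t} ->
  f = \sum_(i <- t) degF_part i f.
Proof.
have /choice[s hs] : forall l : 'I_k, exists s : seq int, forall t, uniq t ->
    {subset s <= t} -> (f : {poly L})`_l = \sum_(m <- t) lmon (lcoef ((f : {poly L})`_l) m) m.
  by move=> l; have [s [_ h]] := laurent_sum ((f : {poly L})`_l); exists s.
exists (flatten [seq [seq (nat_of_ord l)%:Z - m | m <- s l] | l <- enum 'I_k]) => t ut st.
rewrite exchange_big [LHS](qpoly_decomp k0); apply: eq_bigr => l _ /=.
rewrite -mulr_suml; congr (_ * _).
transitivity (\sum_(m <- [seq l%:Z - i | i <- t]) lc (lmon (lcoef ((f : {poly L})`_l) m) m)).
  rewrite -(big_morph lc (@lcD K k) (@lc0 K k)); apply: (congr1 lc); apply: (hs l).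
    by rewrite map_inj_uniq // => i j /=; lia.
  move=> m hm; apply/mapP; exists (l%:Z - m); last by lia.
  apply: st; apply/flattenP; exists [seq (nat_of_ord l)%:Z - m | m <- s l].
    by apply/mapP; exists l => //; rewrite mem_enum.
  exact: (map_f (fun m => (nat_of_ord l)%:Z - m)).
by rewrite big_map.
Qed.

Section FreeModule.
Context (n : nat).
Definition freeF : lmodType F := 'I_n -> F^o.
Definition freeF_homog (i : int) (v : freeF) := forall j, degF i (v j : F).

Lemma freeF_homog0 i : freeF_homog i 0. Proof. by move=> j; apply: degF0. Qed.
Lemma freeF_homogB i u v : freeF_homog i u -> freeF_homog i v -> freeF_homog i (u - v).
Proof. by move=> hu hv j; apply: degFB. Qed.
Lemma freeF_homogZ i j (a : F) v : degF i a -> freeF_homog j v -> freeF_homog (i + j) (a *: v).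
Proof. by move=> ha hv l; apply: degFM. Qed.

Lemma freeF_homog_span (v : freeF) : exists (s : seq int) (c : int -> freeF),
  [/\ uniq s, forall i, freeF_homog i (c i) & v = \sum_(i <- s) c i].
Proof.
have /choice[s hs] := fun j => degF_part_sum (v j).
exists (undup (flatten [seq s j | j <- enum 'I_n])), (fun i j => degF_part i (v j)).
split; [exact: undup_uniq | by move=> i j; apply: degF_part_deg |].
apply/funext => j; rewrite fct_sumE; apply: (hs j) => [|m hm]; first exact: undup_uniq.
rewrite mem_undup; apply/flattenP; exists (s j) => //.
by apply/mapP; exists j; rewrite ?mem_enum.
Qed.

Lemma freeF_homog_free (s : seq int) (c : int -> freeF) :
  uniq s -> (forall i, freeF_homog i (c i)) -> \sum_(i <- s) c i = 0 ->
  forall i, i \in s -> c i = 0.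
Proof.
move=> us hc c0 i si; apply/funext => j; apply: (qpolyP k0) => l hl.
apply: lcoef_inj => m.
rewrite -[(0 : freeF) j]/(0 : F) coef0 lcoef0.
have [ml|ml] := eqVneq m (l%:Z - i); last by have /degFP := hc i j; apply.
have e : (\sum_(i' <- s) (c i' j : F)) = 0.
  by have := congr1 (fun f : freeF => f j) c0; rewrite fct_sumE.
have := congr1 (fun f : F => lcoef ((f : {poly L})`_l) m) e.
rewrite coef0 lcoef0 coef_qpoly_sum lcoef_sum (bigD1_seq i) //= big1 ?addr0 // => i' ii.
by have /degFP := hc i' j; apply; apply: contra_neq ii; rewrite ml; lia.
Qed.

Definition freeF_gr : grModule (@degF K k) :=
  GrModule freeF_homog0 freeF_homogB freeF_homogZ freeF_homog_span freeF_homog_free.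

Definition freeF_basis (i : 'I_n) : freeF := fun j => if j == i then 1 else 0.

Lemma freeF_comb (c : 'I_n -> F) : \sum_i c i *: freeF_basis i = c :> freeF.
Proof.
apply/funext => j; rewrite fct_sumE (bigD1 j) //= big1 => [|i ij].
  by rewrite addr0 -[LHS]/(c j * (if j == j then 1 else 0 : F)) eqxx mulr1.
by rewrite -[LHS]/(c i * (if j == i then 1 else 0 : F)) eq_sym (negbTE ij) mulr0.
Qed.

Lemma freeF_free : graded_free n freeF_gr.
Proof.
exists (fun=> 0), freeF_basis; split=> [i j|m].
  rewrite /freeF_basis; case: eqP => _; last exact: degF0.
  exact: degF1.
exists (finfun m); split=> [|c ec].
  by rewrite -[LHS]freeF_comb; apply: eq_bigr => i _; rewrite ffunE.
by apply/ffunP => i; rewrite ffunE ec freeF_comb.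
Qed.
End FreeModule.

Section LaurentAction.
Context (U : lmodType F).

Section Def.
Context (A B : finType) (dA : A -> int) (dB : B -> int).
(** A matrix over K acts on a family of vectors, with powers of y dictated by the degrees. The
    exponents may be negative, so every matrix acts, unlike for [hmap]. *)
Definition lact (e : A -> U) (r : int) (f : mhom B A) (b : B) : U :=
  lcomb e (fun a => lc (lmon (f a b) (dA a - dB b - r))).

Lemma lact_scale (c : F) e r f b : lact (fun a => c *: e a) r f b = c *: lact e r f b.
Proof.
rewrite /lact /lcomb scaler_sumr; apply: eq_bigr => a _.
by rewrite !scalerA mulrC.
Qed.

Lemma lact_sum (J : finType) (e : J -> A -> U) r f b :
  lact (fun a => \sum_j e j a) r f b = \sum_j lact (e j) r f b.
Proof.
rewrite /lact /lcomb exchange_big; apply: eq_bigr => a _.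
by rewrite scaler_sumr.
Qed.

Lemma lactD e r f g b : lact e r (f + g) b = lact e r f b + lact e r g b.
Proof.
by rewrite -lcombD; apply: (congr1 (lcomb e)); apply/funext => a; rewrite -lcD -lmonD.
Qed.

Lemma lact0 e r b : lact e r 0 b = 0.
Proof.
rewrite -[RHS](lcomb0 e); apply: (congr1 (lcomb e)); apply/funext => a.
by rewrite mx_0E lmon0 lc0.
Qed.

Lemma lact_sumf (J : finType) e r (f : J -> mhom B A) b :
  lact e r (\sum_j f j) b = \sum_j lact e r (f j) b.
Proof.
apply: (big_morph (fun f => lact e r f b)) => [x y|]; [exact: (lactD e r x y) | exact: lact0].
Qed.
End Def.

Lemma lactM (A B C : finType) (dA : A -> int) (dB : B -> int) (dC : C -> int)
    (e : A -> U) r s (f : mhom B A) (g : mhom C B) c :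
  lact dB dC (lact dA dB e r f) s g c = lact dA dC e (r + s) (f \c g) c.
Proof.
rewrite /lact {1}/lcomb.
under eq_bigr => b _ do rewrite -lcombZ.
rewrite /lcomb exchange_big; apply: eq_bigr => a _.
rewrite -scaler_suml; congr (_ *: _).
rewrite mx_cmpE [in RHS](big_morph (fun x => lmon x _) (fun x y => lmonD x y _) (lmon0 _ _)).
rewrite (big_morph lc (@lcD K k) (@lc0 K k)); apply: eq_bigr => b _.
rewrite -(lcM k2); apply: (congr1 lc); rewrite mulrC; apply: etrans (lmonM _ _ _ _) _.
by congr lmon; lia.
Qed.

Lemma lact_id (A : finType) (d : A -> int) (e : A -> U) a : lact d d e 0 (idm _) a = e a.
Proof.
rewrite -[RHS](lcomb_basis e); apply: (congr1 (lcomb e)); apply/funext => b.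
rewrite mx_idE; case: eqP => [->|_]; last by rewrite lmon0 lc0.
by rewrite subrr subr0 lmon1 lc1.
Qed.

Lemma lact_pw (A : finType) (d : A -> int) (X : mhom A A) (e : A -> U) j a :
  (forall a, xF *: e a = lact d d e 1 X a) ->
  xF ^+ j *: e a = lact d d e j%:Z (pw X j) a.
Proof.
move=> h; elim: j => [|j IH]; first by rewrite expr0 scale1r lact_id.
rewrite exprS -scalerA IH -lact_scale pwS intS -(lactM d d d).
by have -> : (fun a => xF *: e a) = lact d d e 1 X by apply/funext.
Qed.
End LaurentAction.

Lemma lact_linear (U V : lmodType F) (h : {linear U -> V}) (A B : finType)
    (dA : A -> int) (dB : B -> int) (e : A -> U) r (f : mhom B A) b :
  h (lact dA dB e r f b) = lact dA dB (h \o e) r f b.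
Proof. by rewrite linear_sum; apply: eq_bigr => a _; rewrite linearZ_LR. Qed.

Lemma tlM (p q : pK) : to_laurent (p * q) = to_laurent p * to_laurent q.
Proof. exact: (rmorphM (@to_laurent K)). Qed.
Lemma tlD (p q : pK) : to_laurent (p + q) = to_laurent p + to_laurent q.
Proof. exact: (raddfD (@to_laurent K)). Qed.
Lemma tl0 : to_laurent (0 : pK) = 0. Proof. exact: (raddf0 (@to_laurent K)). Qed.
Lemma tl1 : to_laurent (1 : pK) = 1. Proof. exact: (rmorph1 (@to_laurent K)). Qed.
Lemma tl_sum (I : Type) (s : seq I) (P : pred I) (G : I -> pK) :
  to_laurent (\sum_(i <- s | P i) G i) = \sum_(i <- s | P i) to_laurent (G i).
Proof. exact: (big_morph _ tlD tl0). Qed.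

Lemma tl_hmx (A B : finType) (dA : A -> int) (dB : B -> int) r (f : mhom B A) a b :
  mdeg dB dA r f -> to_laurent (hmx dB dA r f a b) = lmon (f a b) (dA a - dB b - r).
Proof.
move=> hf; have [e|/hf h] := eqVneq (f a b) 0.
  by rewrite /hmx e scale0r lmon0 raddf0.
by rewrite /hmx -lmon_nat gez0_abs // -addrA -opprD subr_ge0.
Qed.

Lemma linear_ext (A : pzRingType) (U V : lmodType A) (h h' : {linear U -> V}) :
  h =1 h' -> h = h'.
Proof.
case: h => f ff; case: h' => f' ff' /= /funext e; move: ff'; rewrite -e => ff'.
congr GRing.Linear.Pack; case: ff => [[a] [b]]; case: ff' => [[a'] [b']].
by rewrite (Prop_irrelevance a a') (Prop_irrelevance b b').
Qed.

Lemma sum_shift (V : zmodType) (G : nat -> V) n : G 0 = 0 -> G n = 0 ->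
  \sum_(j < n) G j.+1 = \sum_(j < n) G j.
Proof.
move=> g0 gn; suff h m : \sum_(j < m) G j.+1 + G 0 = \sum_(j < m) G j + G m.
  by have := h n; rewrite g0 gn !addr0.
elim: m => [|m IH]; first by rewrite !big_ord0.
by rewrite !big_ord_recr /= addrAC IH.
Qed.

Lemma degF_xFn i n (f : F) : degF i f -> degF (i + n%:Z) (xF ^+ n * f).
Proof.
move=> h; elim: n => [|n IH]; first by rewrite expr0 mul1r addr0.
rewrite exprS -mulrA (_ : i + n.+1%:Z = i + n%:Z + 1); last by lia.
exact: degF_xF.
Qed.

Lemma degF_tl i j (p : pK) (f : F) : (forall n, p`_n != 0 -> i = j - n%:Z) ->
  degF j f -> degF i (lc (to_laurent p) * f).
Proof.
move=> hp hf; rewrite -[p]coefK poly_def tl_sum (big_morph lc (@lcD K k) (@lc0 K k)) mulr_suml.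
apply: degF_sum => n _; have [->|/hp ->] := eqVneq p`_n 0.
  by rewrite scale0r tl0 lc0 mul0r; apply: degF0.
by rewrite -lmon_nat; apply: degF_lmon.
Qed.

Section UnitFree.
Context (A : finType) (d : A -> int) (X : mhom A A) (dX : mdeg d d 1 X) (nX : pw X k = 0).
Context (M : grModule (@degR K k)) (e : A -> M).
Hypotheses (he : forall a, homog M (d a) (e a)).
Hypotheses (hs : forall m, exists v, m = bcomb e v) (hf : forall v, bcomb e v = 0 -> v = 0)
  (hx : forall v, bcomb e (hmap d d 1 X v) = xR K k *: bcomb e v).
Notation gcoord := (gcoord hs).

Lemma hmap_lc (U : lmodType F) (g : A -> U) v :
  (forall a, xF *: g a = lact d d g 1 X a) ->
  lcomb g (fun a => lc (to_laurent (hmap d d 1 X v a))) =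
  xF *: lcomb g (fun a => lc (to_laurent (v a))).
Proof.
move=> h; rewrite [in RHS]/lcomb scaler_sumr.
transitivity (\sum_b lcomb g (fun a => lc (to_laurent (v b)) * lc (lmon (X a b) (d a - d b - 1)))).
  rewrite /lcomb exchange_big; apply: eq_bigr => a _; rewrite -scaler_suml; congr (_ *: _).
  rewrite /hmap tl_sum (big_morph lc (@lcD K k) (@lc0 K k)); apply: eq_bigr => b _.
  by rewrite tlM (lcM k2) [LHS]mulrC (tl_hmx _ _ dX).
by apply: eq_bigr => b _; rewrite lcombZ -[lcomb g _]/(lact d d g 1 X b) -h !scalerA mulrC.
Qed.

Lemma loc_linear_x (U : lmodType F) (g : M -> U) : loc_linear g ->
  forall a, xF *: g (e a) = lact d d (g \o e) 1 X a.
Proof.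
move=> hg a; rewrite -locR_x -(loc_linearZ hg) -[e a](bcomb_basis k2 e a) -hx.
rewrite (loc_linear_lcomb hg); apply: (congr1 (lcomb _)); apply/funext => b.
by rewrite hmap_basis -(tl_hmx _ _ dX); apply: locR_ycoef.
Qed.

(** The base change is realized as the free module on the vectors [chi], all put in degree 0, which
    is possible because y is invertible. Under [t] the basis vector [a] goes to its expansion \sum_j
    x^j psi_j(a) from [unit_basis]. *)
Lemma unit_gen_free : has_unit k X -> exists n (t : M -> freeF_gr n),
  [/\ is_base_change (@locR K k) t,
      forall i m, homog M i m -> homog (freeF_gr n) i (t m)
    & graded_free n (freeF_gr n)].
Proof.
move=> /(unit_basis k0 nX)[n [chi [psi [sumE chiE psi0 psiS]]]]; exists n.
pose d0 (_ : 'I_n) : int := 0; pose E := @freeF_basis n.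
pose tb a : freeF n := \sum_(j < k) xF ^+ j *: lact d0 d E (- j%:Z) (psi j) a.
have tbx a : xF *: tb a = lact d d tb 1 X a.
  rewrite /tb lact_sum scaler_sumr.
  pose G j : freeF n := if j is j'.+1 then xF ^+ j *: lact d0 d E (- j'%:Z) (psi j') a else 0.
  transitivity (\sum_(j < k) G j.+1).
    by apply: eq_bigr => j _; rewrite /G exprS scalerA.
  transitivity (\sum_(j < k) G j).
    have Gk : G k = 0.
      have : G k.-1.+1 = xF ^+ k.-1.+1 *: lact d0 d E (- k.-1%:Z) (psi k.-1) a by [].
      have xk : xF ^+ k = 0 by apply: qx_nil.
      by rewrite prednK // xk scale0r.
    exact: sum_shift.
  apply: eq_bigr => j _; rewrite lact_scale lactM.
  case: (j : nat) (ltn_ord j) => [|j'] hj; first by rewrite psi0 lact0 scaler0.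
  have -> : - j'.+1%:Z + 1 = - j'%:Z by lia.
  by rewrite psiS.
have Etb i : lact d d0 tb 0 chi i = E i.
  rewrite /tb lact_sum.
  transitivity (\sum_(j < k) xF ^+ j *: lact d0 d0 E (- j%:Z) (psi j \c chi) i).
    by apply: eq_bigr => j _; rewrite lact_scale lactM addr0.
  rewrite (bigD1 (Ordinal k0)) //= big1 ?addr0; last first.
    move=> j nj; have {}nj : (j : nat) == 0%N = false by apply: contraNF nj => /eqP j0; apply/eqP/val_inj.
    by rewrite chiE // nj lact0 scaler0.
  by rewrite chiE // expr0 scale1r oppr0 lact_id.
pose t m : freeF n := lcomb tb (fun a => lc (to_laurent (gcoord m a))).
have ht : loc_linear t.
  apply: (loc_linearP k2).
  - move=> u v; rewrite /t -lcombD; apply: (congr1 (lcomb tb)); apply/funext => a.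
    rewrite {1}(gcoordP hs u) {1}(gcoordP hs v) -bcombD gcoord_comb // -lcD; apply: (congr1 lc); exact: tlD.
  - move=> p u; rewrite /t -lcombZ; apply: (congr1 (lcomb tb)); apply/funext => a.
    have -> : ycoef k p *: u = bcomb e (p *: gcoord u) by rewrite (bcombZ k2) -gcoordP.
    rewrite gcoord_comb // -(lcM k2); apply: (congr1 lc); exact: tlM.
  move=> u; rewrite /t -(hmap_lc _ tbx); apply: (congr1 (lcomb tb)); apply/funext => a.
  have -> : xR K k *: u = bcomb e (hmap d d 1 X (gcoord u)) by rewrite hx -gcoordP.
  by rewrite gcoord_comb.
have te a : t (e a) = tb a.
  rewrite /t -[e a](bcomb_basis k2 e a) gcoord_comb // -[RHS](lcomb_basis tb).
  apply: (congr1 (lcomb tb)); apply/funext => b; rewrite /pbasis.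
  by case: eqP => _; rewrite ?tl1 ?tl0 ?lc1 ?lc0.
have ext (U : lmodType F) (g g' : M -> U) : loc_linear g -> loc_linear g' ->
    (forall a, g (e a) = g' (e a)) -> forall m, g m = g' m.
  move=> hg hg' gg m; rewrite [m](gcoordP hs) (loc_linear_lcomb hg) (loc_linear_lcomb hg').
  by apply: eq_bigr => a _; rewrite /= gg.
exists t; split; last exact: freeF_free.
  split=> [//|U g hg].
  (* The generators have to go where [chi] combines the values of [g]; [sumE] then shows that the
     resulting map restricts to [g]. *)
  pose hc := lact d d0 (g \o e) 0 chi.
  have hlin : linear (fun v : freeF n => lcomb hc v).
    by move=> c u v; rewrite -lcombZ -lcombD.
  pose h := mk_linear hlin.
  have hE i : h (E i) = hc i by rewrite -[RHS](lcomb_basis hc).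
  have htb a : h (tb a) = g (e a).
    rewrite /tb linear_sum.
    transitivity (\sum_(j < k) lact d d (g \o e) 0 (pw X j \c chi \c psi j) a).
      apply: eq_bigr => j _; rewrite linearZ_LR lact_linear.
      have -> : h \o E = hc by apply/funext => i; rewrite -hE.
      rewrite lactM add0r -lact_scale.
      have -> : (fun a => xF ^+ j *: (g \o e) a) = lact d d (g \o e) j%:Z (pw X j).
        by apply/funext => b; apply: lact_pw; apply: loc_linear_x.
      by rewrite lactM subrr cmpA.
    by rewrite -lact_sumf sumE lact_id.
  have hsl : loc_linear (h \o t).
    by move=> r u v; rewrite -[LHS]/(lcomb hc (t _)) ht; apply: hlin.
  have hht m : h (t m) = g m by apply: (ext _ (h \o t)) => // a; rewrite -[LHS]/(h (t (e a))) te; apply: htb.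
  exists h; split=> // h' hh'.
  have hE' (l : {linear freeF n -> U}) (hl : forall m, l (t m) = g m) v :
      l v = \sum_i v i *: lact d d0 (g \o e) 0 chi i.
    rewrite -[v in LHS](freeF_comb v) linear_sum; apply: eq_bigr => i _.
    rewrite -/(E i) linearZ_LR -Etb lact_linear.
    by have -> : l \o tb = g \o e by apply/funext => a; rewrite -[LHS]/(l (tb a)) -te hl.
  have hv : (h : freeF n -> U) = h' by apply/funext => v; rewrite (hE' h hht) (hE' h' hh').
  by apply: linear_ext => v; rewrite hv.
move=> i m hm j.
rewrite -[t m]/(lcomb _ _) /lcomb fct_sumE; apply: degF_sum => a _.
have hv : hpart d i (gcoord m) by apply: (coord_hpart k2 he hf); rewrite -gcoordP.
have htb : degF (d a) (tb a j : F).
  rewrite /tb fct_sumE; apply: degF_sum => l _.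
  rewrite -[X in degF _ X]/(xF ^+ l * (lact d0 d E (- l%:Z) (psi l) a j : F)).
  rewrite /lact /lcomb freeF_comb.
  have := degF_xFn l (@degF_lmon 0 (psi l j a) (d0 j - d a - - l%:Z) 1 degF1).
  by rewrite mulr1 (_ : 0 - _ + _ = d a) // /d0; lia.
exact: degF_tl (fun n => hv a n) htb.
Qed.
End UnitFree.
End FreeOverF.

(** * Ext and the periodic resolution *)

Section LinearPencil.
Context (B : comNzRingType) (k : nat) (k0 : (0 < k)%N) (A : finType).
Notation Q := {poly %/ ('X^k : {poly B})}.
Notation mat := (A -> A -> B).

Definition qvec : lmodType Q := A -> Q^o.
Definition qcoefs (j : nat) (p : qvec) : A -> B := fun a => ((p a : Q) : {poly B})`_j.
Definition qconst (v : A -> B) : qvec := fun a => qc k (v a).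
Definition mact (t : mat) (v : A -> B) : A -> B := fun a => \sum_b t a b * v b.
Definition qact_mx (t : mat) (p : qvec) : qvec := fun a => \sum_b qc k (t a b) * (p b : Q).

Lemma qvecP (p q : qvec) : (forall j, (j < k)%N -> qcoefs j p = qcoefs j q) -> p = q.
Proof.
move=> h; apply/funext => a; apply: (qpolyP k0) => j /h e.
exact: (congr1 (fun f => f a) e).
Qed.

Lemma qact_mx_linear t : linear (qact_mx t).
Proof.
move=> c u v; apply/funext => a.
rewrite -[RHS]/(c * (qact_mx t u a : Q) + (qact_mx t v a : Q)) /qact_mx mulr_sumr -big_split.
by apply: eq_bigr => b _; rewrite -[(c *: u + v) b]/(c * (u b : Q) + v b) mulrDr mulrCA.
Qed.

Lemma iter_qact_mx_linear n t : linear (iter n (qact_mx t)).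
Proof. by elim: n => [//|n IH] c u v; rewrite !iterS IH qact_mx_linear. Qed.

Lemma linear_addD (U V : lmodType Q) (f : U -> V) : linear f -> forall u v, f (u + v) = f u + f v.
Proof. by move=> h u v; have := h 1 u v; rewrite !scale1r. Qed.
Lemma linear_at0 (U V : lmodType Q) (f : U -> V) : linear f -> f 0 = 0.
Proof. by move=> h; have := h (-1) 0 0; rewrite scaler0 addr0 scaleN1r addNr. Qed.
Lemma linear_scal (U V : lmodType Q) (f : U -> V) : linear f -> forall c u, f (c *: u) = c *: f u.
Proof. by move=> h c u; have := h c u 0; rewrite (linear_at0 h) !addr0. Qed.

Lemma qcoefs_x j p : qcoefs j (qx B k *: p) =
  if (j < k)%N then (if j is j'.+1 then qcoefs j' p else fun=> 0) else fun=> 0.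
Proof.
apply/funext => a; rewrite -[LHS]/((qx B k * (p a : Q) : Q) : {poly B})`_j (coef_qxM k0).
by case: ifP => // _; case: j.
Qed.

Lemma qcoefs_act t j p : qcoefs j (qact_mx t p) = mact t (qcoefs j p).
Proof.
apply/funext => a; rewrite /qcoefs /qact_mx coef_qpoly_sum; apply: eq_bigr => b _.
by rewrite (coef_qcM k0).
Qed.

Lemma qact_const t v : qact_mx t (qconst v) = qconst (mact t v).
Proof.
apply/funext => a; rewrite /qact_mx /qconst /mact rmorph_sum; apply: eq_bigr => b _.
by rewrite rmorphM.
Qed.

(** With [copencil] this is a matrix factorization: the product of x - t and \sum_j x^j t^(k-1-j) is
    x^k - t^k, which is 0 for nilpotent [t]. It gives a 2-periodic resolution. *)
Definition pencil t (p : qvec) : qvec := qx B k *: p - qact_mx t p.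
Definition copencil t (p : qvec) : qvec :=
  \sum_(j < k) qx B k ^+ j *: iter (k.-1 - j) (qact_mx t) p.

Lemma pencil_linear t : linear (pencil t).
Proof.
move=> c u v; rewrite /pencil qact_mx_linear scalerDr scalerBr !scalerA opprD addrACA.
by rewrite [qx B k * c]mulrC.
Qed.

Lemma copencil_linear t : linear (copencil t).
Proof.
move=> c u v; rewrite /copencil scaler_sumr -big_split; apply: eq_bigr => j _.
by rewrite /= iter_qact_mx_linear scalerDr !scalerA [_ * c]mulrC.
Qed.

Section Exactness.
Context (t : mat) (t_nil : forall v, iter k (mact t) v = fun=> 0).

Lemma qact_nil p : iter k (qact_mx t) p = 0.
Proof.
apply: qvecP => j _; have h n : qcoefs j (iter n (qact_mx t) p) = iter n (mact t) (qcoefs j p).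
  by elim: n => // n IH; rewrite !iterS qcoefs_act IH.
by rewrite h t_nil; apply/funext => a; rewrite /qcoefs coef0.
Qed.

Lemma pencil_copencil p : pencil t (copencil t p) = 0.
Proof.
pose G j : qvec := qx B k ^+ j *: iter (k - j) (qact_mx t) p.
have actD := linear_addD (qact_mx_linear t); have act0 := linear_at0 (qact_mx_linear t).
transitivity (\sum_(j < k) (G j.+1 - G j)).
  rewrite /pencil /copencil scaler_sumr (big_morph _ actD act0) -sumrB.
  apply: eq_bigr => j _; rewrite /G scalerA -exprS (linear_scal (qact_mx_linear t)) -iterS.
  have hj := ltn_ord j; rewrite (_ : (k - j.+1 = k.-1 - j)%N); last by lia.
  by rewrite (_ : (k - j = (k.-1 - j).+1)%N) //; lia.
have tel n : \sum_(j < n) (G j.+1 - G j) = G n - G 0.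
  elim: n => [|n IH]; first by rewrite big_ord0 subrr.
  by rewrite big_ord_recr IH /= addrC addrA subrK.
have Gk : G k = 0.
  rewrite /G; move: (iter _ _ _) => w.
  by have -> : qx B k ^+ k = 0 by [apply: qx_nil]; rewrite scale0r.
have G0 : G 0 = 0.
  by rewrite /G subn0; have -> : iter k (qact_mx t) p = 0 by [apply: qact_nil]; rewrite scaler0.
by rewrite tel Gk G0 subrr.
Qed.

Lemma copencil_pencil p : copencil t (pencil t p) = 0.
Proof.
rewrite -(pencil_copencil p) /pencil -[- qact_mx t p]scaleN1r addrC copencil_linear.
rewrite addrC scaleN1r; congr (_ - _).
  exact: (linear_scal (copencil_linear t)).
rewrite /copencil (big_morph _ (linear_addD (qact_mx_linear t)) (linear_at0 (qact_mx_linear t))).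
apply: eq_bigr => j _; rewrite (linear_scal (qact_mx_linear t)); congr (_ *: _).
by rewrite -iterSr -iterS.
Qed.

(** Division with remainder by the monic linear polynomial x - t: modulo its image x acts as [t], so
    every vector is congruent to a constant one. *)
Lemma pencil_div p : exists q v, p = pencil t q + qconst v.
Proof.
have pD := linear_addD (pencil_linear t); have p0 := linear_at0 (pencil_linear t).
have hx j v : exists q, qx B k ^+ j *: qconst v = pencil t q + qconst (iter j (mact t) v).
  elim: j => [|j [q IH]]; first by exists 0; rewrite p0 add0r expr0 scale1r.
  exists (qx B k *: q + qconst (iter j (mact t) v)).
  rewrite exprS -scalerA IH pD (linear_scal (pencil_linear t)) scalerDr -addrA; congr (_ + _).
  by rewrite /pencil qact_const subrK.
have cD u v : qconst (fun a => u a + v a) = qconst u + qconst v.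
  by apply/funext => a; apply: (raddfD (qc k)).
have -> : p = \sum_(j < k) qx B k ^+ j *: qconst (qcoefs j p).
  apply/funext => a; rewrite fct_sumE [LHS](qpoly_decomp k0); apply: eq_bigr => j _.
  exact: mulrC.
elim/big_rec: _ => [|j r _ [q [v ->]]].
  by exists 0, (fun=> 0); rewrite p0 add0r; apply/funext => a; apply/esym/(raddf0 (qc k)).
have [q' ->] := hx j (qcoefs j p).
by exists (q' + q), (fun a => iter j (mact t) (qcoefs j p) a + v a); rewrite pD cD addrACA.
Qed.

Lemma qcoefs_xconst i j w : (j < k)%N ->
  qcoefs i (qx B k ^+ j *: qconst w) = if i == j then w else fun=> 0.
Proof.
move=> hj; apply/funext => a.
rewrite -[LHS]/((qx B k ^+ j * qc k (w a) : Q) : {poly B})`_i mulrC (coef_qcM k0).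
by rewrite coef_qx_exp //; case: eqP; rewrite ?mulr1 ?mulr0.
Qed.

Lemma qcoefs_copencil i v : (i < k)%N ->
  qcoefs i (copencil t (qconst v)) = iter (k.-1 - i) (mact t) v.
Proof.
move=> hi.
have e n : iter n (qact_mx t) (qconst v) = qconst (iter n (mact t) v).
  by elim: n => // n IH; rewrite !iterS IH qact_const.
transitivity (qcoefs i (\sum_(j < k) qx B k ^+ j *: qconst (iter (k.-1 - j) (mact t) v))).
  by congr qcoefs; apply: eq_bigr => j _; rewrite e.
apply/funext => a; rewrite {1}/qcoefs fct_sumE coef_qpoly_sum.
transitivity (\sum_(j < k) (if i == j then iter (k.-1 - j) (mact t) v else fun=> 0) a).
  by apply: eq_bigr => j _; rewrite -(qcoefs_xconst _ _ (ltn_ord j)).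
rewrite (bigD1 (Ordinal hi)) //= eqxx big1 ?addr0 // => j ji.
by case: eqP => // ij; case/eqP: ji; apply: val_inj.
Qed.

Lemma ker_pencil p : pencil t p = 0 <-> exists q, copencil t q = p.
Proof.
split=> [|[q <-]]; last exact: pencil_copencil.
(* A vector of the kernel satisfies p_j = t p_(j+1), so it is determined by its top coefficient. *)
move=> /subr0_eq h; exists (qconst (qcoefs k.-1 p)); apply: qvecP => i hi.
rewrite qcoefs_copencil //.
have st j : (j.+1 < k)%N -> qcoefs j p = mact t (qcoefs j.+1 p).
  by move=> hj; rewrite -qcoefs_act -h qcoefs_x hj.
have [n en] : exists n, k.-1 = (i + n)%N by exists (k.-1 - i)%N; lia.
rewrite en addKn; elim: n i hi en => [|n IH] i hi en; first by rewrite addn0.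
rewrite [RHS]st; last by lia.
by rewrite iterS -(IH i.+1) ?addSnnS //; lia.
Qed.

(** After division by the pencil only a constant remains, and the top coefficient of its copencil is
    that constant. *)
Lemma ker_copencil p : copencil t p = 0 <-> exists q, pencil t q = p.
Proof.
split=> [|[q <-]]; last exact: copencil_pencil.
have [q [v ->]] := pencil_div p.
rewrite (linear_addD (copencil_linear t)) copencil_pencil add0r => h; exists q.
suff -> : v = fun=> 0.
  have -> : qconst (fun=> 0) = 0 by apply/funext => a; apply: (raddf0 (qc k)).
  by rewrite addr0.
have hk : (k.-1 < k)%N by rewrite prednK.
have := qcoefs_copencil v hk; rewrite subnn /= h => <-.
by apply/funext => a; rewrite /qcoefs coef0.
Qed.

End Exactness.

Definition dotp (f p : qvec) : Q := \sum_a (f a : Q) * p a.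
Definition mtrans (t : mat) : mat := fun a b => t b a.

Lemma dotp_act t f p : dotp f (qact_mx t p) = dotp (qact_mx (mtrans t) f) p.
Proof.
rewrite /dotp /qact_mx; under eq_bigr do rewrite mulr_sumr.
rewrite exchange_big; apply: eq_bigr => b _; rewrite mulr_suml; apply: eq_bigr => a _.
by rewrite mulrA [f a * _]mulrC.
Qed.

Lemma dotpZr c f p : dotp f (c *: p) = c * dotp f p.
Proof. by rewrite /dotp mulr_sumr; apply: eq_bigr => a _; apply: mulrCA. Qed.
Lemma dotpZl c f p : dotp (c *: f) p = c * dotp f p.
Proof. by rewrite /dotp mulr_sumr; apply: eq_bigr => a _; rewrite mulrA. Qed.
Lemma dotpDr f p q : dotp f (p + q) = dotp f p + dotp f q.
Proof. by rewrite -big_split; apply: eq_bigr => a _; apply: mulrDr. Qed.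
Lemma dotpDl f g p : dotp (f + g) p = dotp f p + dotp g p.
Proof. by rewrite -big_split; apply: eq_bigr => a _; apply: mulrDl. Qed.
Lemma dotp0r f : dotp f 0 = 0.
Proof. by rewrite /dotp big1 // => a _; apply: mulr0. Qed.
Lemma dotp0l p : dotp 0 p = 0.
Proof. by rewrite /dotp big1 // => a _; apply: mul0r. Qed.

Lemma dotp_pencil t f p : dotp f (pencil t p) = dotp (pencil (mtrans t) f) p.
Proof.
rewrite /pencil -[- _]scaleN1r -[- qact_mx _ f]scaleN1r dotpDr dotpDl !dotpZr !dotpZl.
by rewrite dotp_act.
Qed.

Lemma dotp_copencil t f p : dotp f (copencil t p) = dotp (copencil (mtrans t) f) p.
Proof.
rewrite /copencil (big_morph _ (dotpDr f) (dotp0r f)).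
rewrite (big_morph (dotp^~ p) (fun f g => dotpDl f g p) (dotp0l p)).
apply: eq_bigr => j _; rewrite dotpZr dotpZl; congr (_ * _).
elim: (_ - _)%N f p => // n IH f p.
by rewrite iterS dotp_act IH -iterSr.
Qed.

Lemma trans_nil t : (forall v, iter k (mact t) v = fun=> 0) ->
  forall v, iter k (mact (mtrans t)) v = fun=> 0.
Proof.
move=> h v; apply/funext => a.
pose dot (f g : A -> B) := \sum_a f a * g a.
have hd f g : dot f (mact t g) = dot (mact (mtrans t) f) g.
  rewrite /dot /mact; under eq_bigr do rewrite mulr_sumr.
  rewrite exchange_big; apply: eq_bigr => b _; rewrite mulr_suml; apply: eq_bigr => c _.
  by rewrite mulrA [f c * _]mulrC.
have hi n f g : dot f (iter n (mact t) g) = dot (iter n (mact (mtrans t)) f) g.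
  by elim: n f g => // n IH f g; rewrite iterS hd IH -iterSr.
have := hi k v (fun b => (b == a)%:R); rewrite h /dot big1 => [|b _]; last exact: mulr0.
rewrite (bigD1 a) //= eqxx mulr1 big1 ?addr0 => [<- //|b ba].
by rewrite (negbTE ba) mulr0.
Qed.

Definition qdelta (a : A) : qvec := fun b => if b == a then 1 else 0.

Lemma qvec_basis (p : qvec) : p = \sum_a (p a : Q) *: qdelta a.
Proof.
apply/funext => a; rewrite fct_sumE (bigD1 a) //= big1 => [|b ba].
  by rewrite addr0 -[RHS]/((p a : Q) * (if a == a then 1 else 0)) eqxx mulr1.
by rewrite -[LHS]/((p b : Q) * (if a == b then 1 else 0)) eq_sym (negbTE ba) mulr0.
Qed.

Lemma linear_dotp (f : {linear qvec -> Q^o}) p : f p = dotp (fun a => f (qdelta a)) p.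
Proof.
rewrite {1}(qvec_basis p) linear_sum; apply: eq_bigr => a _.
by rewrite linearZ_LR mulrC.
Qed.

Lemma dotp_linear f : linear (fun p : qvec => dotp f p : Q^o).
Proof. by move=> c u v; rewrite dotpDr dotpZr. Qed.

Lemma dotp_inj f : (forall p, dotp f p = 0) -> f = 0.
Proof.
move=> h; apply/funext => a; have := h (qdelta a).
rewrite /dotp (bigD1 a) //= big1 => [|b ba]; last by rewrite /qdelta (negbTE ba) mulr0.
by rewrite addr0 /qdelta eqxx mulr1.
Qed.

Lemma qvec_projective : projective_module qvec.
Proof.
move=> M N g f gs; have /choice[m hm] : forall a, exists m, g m = f (qdelta a).
  by move=> a; apply: gs.
have hl : linear (fun p : qvec => lcomb m p).
  by move=> c u v; rewrite -lcombZ -lcombD.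
exists (mk_linear hl) => p.
rewrite -[mk_linear hl p]/(lcomb m p) [in RHS](qvec_basis p) !linear_sum.
by apply: eq_bigr => a _; rewrite !linearZ_LR hm.
Qed.

Section Resolution.
Context (t : mat) (t_nil : forall v, iter k (mact t) v = fun=> 0).
Context (M : lmodType Q) (aug : {linear qvec -> M}).
Hypotheses (aug_surj : is_surjective aug) (aug_pencil : forall p, aug (pencil t p) = 0)
  (aug_const : forall v, aug (qconst v) = 0 -> forall a, v a = 0).

Definition pres_d (n : nat) : {linear qvec -> qvec} :=
  if odd n then mk_linear (copencil_linear t) else mk_linear (pencil_linear t).

Lemma pres_exact0 p : aug p = 0 <-> exists q, pres_d 0 q = p.
Proof.
split=> [|[q <-]]; last exact: aug_pencil.
have [q [v ->]] := pencil_div t p; rewrite linearD aug_pencil add0r => /aug_const v0.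
exists q; have -> : qconst v = 0; last by rewrite addr0.
by apply/funext => a; rewrite /qconst v0; apply: (raddf0 (qc k)).
Qed.

Lemma pres_exactS n p : pres_d n p = 0 <-> exists q, pres_d n.+1 q = p.
Proof.
by rewrite /pres_d /=; case: (odd n) => /=; [apply: ker_copencil | apply: ker_pencil].
Qed.

Definition pencil_resolution : projective_resolution M :=
  ProjectiveResolution (fun _ => qvec_projective) aug_surj pres_exact0 pres_exactS.

(** Dualizing the resolution transposes [t] and keeps its shape: the dual complex is that of a
    nilpotent matrix again, hence exact, and every cocycle is a coboundary. *)
Lemma pencil_ext n : ext_succ_eq0 n M Q^o.
Proof.
exists pencil_resolution => f f0; pose phi : qvec := fun a => f (qdelta a).
have tn := trans_nil t_nil.
have [psi hpsi] : exists psi : qvec, forall q, dotp phi q = dotp psi (pres_d n q).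
  have h0 q : dotp phi (pres_d n.+1 q) = 0 by rewrite -linear_dotp; apply: f0.
  move: h0; rewrite /pres_d /=; case: (odd n) => /= h0.
    have /(ker_pencil tn)[psi <-] : pencil (mtrans t) phi = 0.
      by apply: dotp_inj => q; rewrite -dotp_pencil; apply: h0.
    by exists psi => q; rewrite -dotp_copencil.
  have /(ker_copencil tn)[psi <-] : copencil (mtrans t) phi = 0.
    by apply: dotp_inj => q; rewrite -dotp_copencil; apply: h0.
  by exists psi => q; rewrite -dotp_pencil.
by exists (mk_linear (dotp_linear psi)) => p; rewrite linear_dotp; apply: hpsi.
Qed.

End Resolution.
End LinearPencil.

Section MaximalCM.
Context (K : fieldType) (k : nat) (k2 : (2 <= k)%N) (V : mobj K k).
Notation pK := {poly K}.
Notation R := (ringR K k).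
Let k0 : (0 < k)%N. Proof. exact: ltnW. Qed.

Let t : mi V -> mi V -> pK := hmx (md V) (md V) 1 (mX V).

Definition eaug (p : qvec pK k (mi V)) : emod k2 V := lcomb (fun a => pbasis K a : emod k2 V) p.

Lemma eaug_linear : linear eaug.
Proof. by move=> c u v; rewrite -lcombZ -lcombD. Qed.

Lemma eaug_const v : eaug (qconst k v) = v :> pvec K (mi V).
Proof.
rewrite [RHS]pvec_basis; apply: eq_bigr => a _; exact: emod_qc.
Qed.

Lemma egr_ext n : ext_succ_eq0 n (emod k2 V) (R^o).
Proof.
apply: (@pencil_ext pK k k0 (mi V) t _ (emod k2 V) (mk_linear eaug_linear)).
- by move=> v; exact: (@xact_nil K k V v).
- by move=> m; exists (qconst k m); apply: eaug_const.
- move=> p; rewrite -[LHS]/(eaug (pencil t p)).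
  have eD := linear_addD eaug_linear; have e0 := linear_at0 eaug_linear.
  have eZ := linear_scal eaug_linear.
  rewrite /pencil; have -> : qact_mx t p = \sum_b (p b : R) *: qconst k (fun a => t a b).
    apply/funext => a; rewrite fct_sumE; apply: eq_bigr => b _; exact: mulrC.
  rewrite -scaleN1r eD !eZ scaleN1r (big_morph eaug eD e0).
  apply/eqP; rewrite subr_eq0; apply/eqP; rewrite [eaug p]/lcomb scaler_sumr.
  apply: eq_bigr => b _; rewrite eZ !scalerA mulrC -!scalerA; congr (_ *: _).
  rewrite [LHS]emod_qx [RHS]eaug_const; apply/funext => a; exact: hmap_basis.
- move=> v h a; have := eaug_const v; rewrite [eaug _]h => <-; exact: erefl.
Qed.

Lemma egr_CM : maximal_CM (egr_ob k2 V).
Proof. exact: egr_ext. Qed.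
End MaximalCM.

(** * Separation and bases for subspaces of coordinate spaces *)

Section FiniteSubspace.
Context (K : fieldType) (P : finType) (W : (P -> K) -> Prop).
Hypotheses (W0 : W (fun=> 0))
  (WP : forall c u v, W u -> W v -> W (fun p => c * u p + v p)).

Let rowf n (M : 'M[K]_(n, #|P|)) i : P -> K := fun p => M i (enum_rank p).

(** Among matrices with rows in [W], one of largest rank spans [W]: appending a further vector of
    [W] cannot raise the rank. *)
Lemma subspace_rows : exists n (M : 'M[K]_(n, #|P|)), (forall i, W (rowf M i)) /\
  forall w, W w -> ((\row_j w (enum_val j)) <= M)%MS.
Proof.
have Wlin n (M : 'M[K]_(n, #|P|)) (c : 'I_n -> K) : (forall i, W (rowf M i)) ->
    W (fun p => \sum_i c i * M i (enum_rank p)).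
  move=> h; elim: (index_enum _) => [|i s IH].
    by rewrite (_ : (fun p => _) = fun=> 0) //; apply/funext => p; rewrite big_nil.
  rewrite (_ : (fun p => _) = fun p => c i * rowf M i p + \sum_(j <- s) c j * M j (enum_rank p)).
    exact: WP.
  by apply/funext => p; rewrite big_cons.
pose Q r := exists n (M : 'M[K]_(n, #|P|)), (forall i, W (rowf M i)) /\ \rank M = r.
have exQ : exists r, `[< Q r >].
  by exists 0%N; apply/asboolP; exists 0%N, 0; split=> [[]//|]; rewrite mxrank0.
have ubQ r : `[< Q r >] -> (r <= #|P|)%N.
  by move=> /asboolP[n [M [_ <-]]]; apply: rank_leq_col.
case: (ex_maxnP exQ ubQ) => r /asboolP[n [M [WM rM]]] rmax.
exists n, M; split=> // w Ww; set v := \row_j _.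
have WMv : forall i, W (rowf (col_mx M v) i).
  move=> i; case: (split_ordP i) => j ->.
    rewrite (_ : rowf _ _ = rowf M j) //; apply/funext => p.
    by rewrite /rowf col_mxEu.
  rewrite (_ : rowf _ _ = w) //; apply/funext => p.
  by rewrite /rowf col_mxEd mxE enum_rankK.
have /rmax : `[< Q (\rank (col_mx M v)) >] by apply/asboolP; exists (n + 1)%N, (col_mx M v).
rewrite -rM -addsmxE (geq_leqif (mxrank_leqif_sup (addsmxSl M v))).
exact: submx_trans (addsmxSr M v).
Qed.

Lemma subspace_separate f : ~ W f ->
  exists mu : P -> K, (forall w, W w -> \sum_p mu p * w p = 0) /\ \sum_p mu p * f p = 1.
Proof.
have [n [M [WM hM]]] := subspace_rows; move=> nf.
have Wsub w : ((\row_j w (enum_val j)) <= M)%MS -> W w.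
  move=> /submxP[D e].
  rewrite (_ : w = fun p => \sum_i D 0 i * M i (enum_rank p)); last first.
    apply/funext => p; have /rowP/(_ (enum_rank p)) := e.
    by rewrite !mxE enum_rankK.
  elim: (index_enum _) => [|i s IH].
    by rewrite (_ : (fun p => _) = fun=> 0) //; apply/funext => p; rewrite big_nil.
  rewrite (_ : (fun p => _) = fun p => D 0 i * rowf M i p + \sum_(j <- s) D 0 j * M j (enum_rank p)).
    exact: WP.
  by apply/funext => p; rewrite big_cons.
have : ~~ ((\row_j f (enum_val j)) <= M)%MS by apply/negP => /Wsub.
rewrite submxE => /eqP/rowP/eqfunP/forallPn ne.
have [j hj] : exists j, ((\row_j f (enum_val j)) *m cokermx M) 0 j != 0.
  by case: ne => j; rewrite [X in _ != X]mxE; exists j.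
set x := (_ *m _) 0 j in hj.
exists (fun p => x^-1 * cokermx M (enum_rank p) j); split=> [w /hM|].
  rewrite submxE => /eqP/rowP/(_ j); rewrite mxE [RHS]mxE => e.
  transitivity (x^-1 * \sum_i (\row_i w (enum_val i)) 0 i * cokermx M i j); last first.
    by rewrite e mulr0.
  rewrite sum_enum_val mulr_sumr; apply: eq_bigr => i _.
  by rewrite mxE enum_valK -mulrA [w _ * _]mulrC.
under eq_bigr do rewrite -mulrA.
rewrite -mulr_sumr sum_enum_val -[RHS](mulVf hj); congr (_ * _).
rewrite /x mxE; apply: eq_bigr => i _; rewrite enum_valK mulrC; congr (_ * _).
by rewrite mxE.
Qed.

Lemma subspace_basis : exists n (b : 'I_n -> P -> K), (forall i, W (b i)) /\
  forall w, W w -> exists c : 'I_n -> K, forall p, w p = \sum_i c i * b i p.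
Proof.
have [n [M [WM hM]]] := subspace_rows.
exists n, (rowf M); split=> // w /hM/submxP[D e]; exists (fun i => D 0 i) => p.
by have /rowP/(_ (enum_rank p)) := e; rewrite !mxE enum_rankK.
Qed.

End FiniteSubspace.

Section ExtendFromRelations.
Context (B : comNzRingType) (k : nat) (k0 : (0 < k)%N) (A : finType).
Notation Q := {poly %/ ('X^k : {poly B})}.
Context (M : lmodType Q) (e : A -> M).

(* Ext^1(M, Q) = 0, read off the presentation of M by the generators e. *)
Lemma extend_relations (psi : qvec B k A -> Q) :
  ext_succ_eq0 0 M Q^o -> (forall m, exists c, m = lcomb e c) ->
  (forall c (u v : qvec B k A), lcomb e u = 0 -> lcomb e v = 0 -> psi (c *: u + v) = c * psi u + psi v) ->
  exists phi : qvec B k A, forall u, lcomb e u = 0 -> psi u = dotp phi u.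
Proof.
move=> [P ext] hs psiP.
pose pi_ (u : qvec B k A) : M := lcomb e u.
have piL : linear pi_ by move=> c u v; rewrite /pi_ -lcombZ -lcombD.
pose pil := mk_linear piL.
have [al hal] : exists al : {linear qvec B k A -> P 0}, forall u, res_aug P (al u) = pil u.
  by apply: qvec_projective; apply: res_aug_surj.
have [be hbe] : exists be : {linear P 0 -> qvec B k A}, forall x, pil (be x) = res_aug P x.
  apply: (@res_projective _ _ P 0%N _ _ pil (res_aug P)) => m.
  by have [c ->] := hs m; exists c.
have aug_d x : res_aug P (res_d P 0 x) = 0 by exact: (proj2 (@res_exact0 _ _ P (res_d P 0 x)) (ex_intro _ x erefl)).
have be_d x : pil (be (res_d P 0 x)) = 0 by rewrite hbe.
(* The generators [e] and the resolution [P] are compared by the lifts [al] and [be]. Pulled back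
   along [be], the map [psi] becomes a 1-cocycle, hence the coboundary of some [g]. *)
have fL : linear (fun x => psi (be (res_d P 0 x)) : Q^o).
  by move=> c u v; rewrite !linearP psiP //; apply: be_d.
have psi0 : psi 0 = 0.
  have z : lcomb e (0 : qvec B k A) = 0 by apply: (linear0 pil).
  by have := psiP (-1) 0 0 z z; rewrite scaler0 addr0 mulN1r addNr.
have [g hg] : exists g : {linear P 0 -> Q^o}, forall x, mk_linear fL x = g (res_d P 0 x).
  apply: ext => x; rewrite -[LHS]/(psi (be (res_d P 0 (res_d P 1 x)))).
  have -> : res_d P 0 (res_d P 1 x) = 0 by exact: (proj2 (@res_exactS _ _ P 0%N (res_d P 1 x)) (ex_intro _ x erefl)).
  by rewrite linear0.
have gE x : res_aug P x = 0 -> g x = psi (be x) by move=> /(proj1 (@res_exact0 _ _ P x))[y <-]; rewrite -hg.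
have Kin u : pil (u - be (al u)) = 0 by rewrite linearB hbe hal subrr.
(* The extension of [psi]: the relation [u - be (al u)] is sent by [psi], and the rest is read off
   [g]. For a relation [u] the two parts add up to [psi u]. *)
have PsiL : linear (fun u => g (al u) + psi (u - be (al u)) : Q^o).
  move=> c u v.
  have -> : c *: u + v - be (al (c *: u + v)) = c *: (u - be (al u)) + (v - be (al v)).
    by rewrite (linearP al) (linearP be) opprD addrACA -scalerBr.
  rewrite (psiP _ _ _ (Kin u) (Kin v)) (linearP al) (linearP g) scalerDr.
  exact: addrACA.
exists (fun a => mk_linear PsiL (qdelta B k a)) => u u0.
rewrite -linear_dotp -[RHS]/(g (al u) + psi (u - be (al u))).
have au : res_aug P (al u) = 0 by rewrite hal.
have bu : pil (be (al u)) = 0 by rewrite hbe.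
have h := psiP 1 (be (al u)) (u - be (al u)) bu (Kin u).
by rewrite scale1r mul1r [be (al u) + _]addrC subrK in h; rewrite gE.
Qed.
End ExtendFromRelations.

(** * Injectivity of y *)

Section YInjective.
Context (K : fieldType) (k : nat) (k2 : (2 <= k)%N).
Notation pK := {poly K}.
Notation R := (ringR K k).
Let k0 : (0 < k)%N. Proof. exact: ltnW. Qed.
Context (M : grModule (@degR K k)) (A : finType) (d0 : A -> int) (e0 : A -> M).
Hypotheses (he0 : forall a, homog M (d0 a) (e0 a)) (hs0 : forall m, exists c, m = lcomb e0 c).
Hypothesis ext1 : ext_succ_eq0 0 M R^o.

Let A' : finType := (A * 'I_k)%type.
Let d (x : A') : int := d0 x.1 + x.2%:Z.
Let e (x : A') : M := (qx pK k : R) ^+ x.2 *: e0 x.1.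
Notation qv := (qvec pK k A).

Definition qv_coords (q : qv) : pvec K A' := fun x => (q x.1 : {poly pK})`_x.2.

Lemma bcomb_coords (q : qv) : bcomb e (qv_coords q) = lcomb e0 q.
Proof.
rewrite /bcomb lcomb_prod; apply: eq_bigr => a _.
rewrite [in RHS](qpoly_decomp k0 (q a)) scaler_suml.
by apply: eq_bigr => j _; rewrite scalerA.
Qed.

Lemma gen_homog x : homog M (d x) (e x).
Proof. exact: homog_qxn. Qed.

Section Degree.
Context (i : int).

Definition icoef (v : pvec K A') : A' -> K :=
  fun x => if i <= d x then (v x : pK)`_(absz (d x - i)%R) else 0.
Definition imon (w : A' -> K) : pvec K A' :=
  fun x => if i <= d x then w x *: 'X^(absz (d x - i)%R) else 0.

Lemma imonP c u v : imon (fun x => c * u x + v x) = (c%:P : pK) *: imon u + imon v.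
Proof.
apply/funext => x; rewrite -[RHS]/(c%:P * imon u x + imon v x) /imon.
by case: ifP => _; rewrite ?mulr0 ?addr0 // scalerDl mul_polyC scalerA.
Qed.

Lemma imon_icoef v : imon (icoef v) = comp d i v.
Proof. by apply/funext => x; rewrite /imon /icoef /comp; case: ifP => // ->. Qed.

Context (mu : A' -> K).
Hypothesis hmu : forall w, bcomb e (imon w) = 0 -> \sum_x mu x * w x = 0.

Definition ymu (q : qv) : K := \sum_x mu x * icoef (qv_coords q) x.
(** The quotient of each coordinate by y^(d x - i + 1), weighted by [mu]. Multiplication by y brings
    the coefficient at degree [i] into the quotient as a constant term, see [yphiX]; on relations
    that term is zero, which makes [yphi] linear over K[y] there. *)
Definition yphi (q : qv) : pK :=
  \sum_x (if i <= d x then mu x *: drop_poly (absz (d x - i)%R).+1 (qv_coords q x) else 0).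
(** The lift of [yphi] to values in R by the Frobenius form of K[x]/(x^k): the coefficient of
    x^(k-1) is [yphi], and the result is R-linear on relations. *)
Definition ypsi (q : qv) : R :=
  \sum_(j < k) (qx pK k : R) ^+ j * qc k (yphi ((qx pK k : R) ^+ (k.-1 - j) *: q)).

Lemma ymu0 (q : qv) : lcomb e0 q = 0 -> ymu q = 0.
Proof.
move=> q0; apply: hmu; rewrite imon_icoef; apply: (bcomb_comp0 k2 gen_homog).
by rewrite bcomb_coords.
Qed.

Lemma yphiD (q q' : qv) : yphi (q + q') = yphi q + yphi q'.
Proof.
rewrite -big_split; apply: eq_bigr => x _ /=; case: ifP => _; rewrite ?addr0 //.
by rewrite -scalerDr -raddfD; congr (_ *: drop_poly _ _); apply: coefD.
Qed.

Lemma yphiC c (q : qv) : yphi (qc k c%:P *: q) = c *: yphi q.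
Proof.
rewrite scaler_sumr; apply: eq_bigr => x _; case: ifP => _; rewrite ?scaler0 //.
rewrite scalerA mulrC -scalerA; congr (_ *: _).
have -> : qv_coords (qc k c%:P *: q) x = c%:P * qv_coords q x by apply: (coef_qcM k0).
by apply/polyP => n; rewrite coef_drop_poly mul_polyC !coefZ coef_drop_poly.
Qed.

Lemma yphiX (q : qv) : yphi (qc k 'X *: q) = 'X * yphi q + (ymu q)%:P.
Proof.
rewrite mulr_sumr /ymu rmorph_sum -big_split; apply: eq_bigr => x _ /=.
rewrite /icoef; case: ifP => _; last by rewrite !mulr0 addr0.
have -> : qv_coords (qc k 'X *: q) x = 'X * qv_coords q x by apply: (coef_qcM k0).
apply/polyP => n; rewrite coefD coefC coefZ coef_drop_poly coefXM addnS /= coefXM coefZ.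
by case: n => [|n] /=; rewrite ?add0r ?add0n // addr0 coef_drop_poly addnS.
Qed.

Lemma yphi_qc p (q : qv) : lcomb e0 q = 0 -> yphi (qc k p *: q) = p * yphi q.
Proof.
move=> q0; elim/poly_ind: p q q0 => [|p c IH] q q0.
  rewrite [qc k 0](raddf0 (qc k)) scale0r mul0r.
  by have := yphiC 0 0; rewrite scaler0 scale0r.
have -> : qc k (p * 'X + c%:P) *: q = qc k p *: (qc k 'X *: q) + qc k c%:P *: q.
  have hr : qc k (p * 'X + c%:P) = qc k p * qc k 'X + qc k c%:P.
    exact: etrans (raddfD (qc k) _ _) (congr1 (+%R^~ _) (rmorphM (qc k) _ _)).
  by rewrite hr scalerDl scalerA.
rewrite yphiD yphiC IH; last by rewrite lcombZ q0 scaler0.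
by rewrite yphiX ymu0 // addr0 mulrA mulrDl mul_polyC.
Qed.

Lemma ypsiD (q q' : qv) : ypsi (q + q') = ypsi q + ypsi q'.
Proof.
rewrite -big_split; apply: eq_bigr => j _ /=.
by rewrite scalerDr yphiD (raddfD (qc k)) mulrDr.
Qed.

Lemma ypsi_qc p (q : qv) : lcomb e0 q = 0 -> ypsi (qc k p *: q) = qc k p * ypsi q.
Proof.
move=> q0; rewrite mulr_sumr; apply: eq_bigr => j _.
rewrite scalerA [_ * qc k p]mulrC -scalerA yphi_qc; last by rewrite lcombZ q0 scaler0.
by rewrite (rmorphM (qc k)) mulrCA.
Qed.

Lemma ypsi_x (q : qv) : ypsi ((qx pK k : R) *: q) = qx pK k * ypsi q.
Proof.
pose G j : R := if j is j'.+1 then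
  (qx pK k : R) ^+ j * qc k (yphi ((qx pK k : R) ^+ (k.-1 - j') *: q)) else 0.
have xk : (qx pK k : R) ^+ k = 0 by apply: qx_nil.
have yphi0 : yphi 0 = 0 by have := yphiC 0 0; rewrite scaler0 scale0r.
transitivity (\sum_(j < k) G j).
  apply: eq_bigr => j _; rewrite scalerA -exprSr.
  case: (j : nat) (ltn_ord j) => [|j'] hj.
    by rewrite subn0 prednK // xk scale0r yphi0 [qc k 0](raddf0 (qc k)) mulr0.
  have -> : (k.-1 - j'.+1).+1 = (k.-1 - j')%N by lia.
  by [].
rewrite -sum_shift //; last first.
  have : G k.-1.+1 = (qx pK k : R) ^+ k.-1.+1 * qc k (yphi ((qx pK k : R) ^+ (k.-1 - k.-1) *: q)).
    by [].
  by rewrite prednK // xk mul0r.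
rewrite mulr_sumr; apply: eq_bigr => j _.
by rewrite /G exprS mulrA.
Qed.

Lemma ypsiP c (u v : qv) : lcomb e0 u = 0 -> lcomb e0 v = 0 -> ypsi (c *: u + v) = c * ypsi u + ypsi v.
Proof.
move=> u0 v0; rewrite ypsiD; congr (_ + _).
have h0 : ypsi 0 = 0 by apply: (addIr (ypsi 0)); rewrite -ypsiD !add0r.
have hX n : ypsi ((qx pK k : R) ^+ n *: u) = (qx pK k : R) ^+ n * ypsi u.
  elim: n => [|n IH]; first by rewrite !expr0 scale1r mul1r.
  by rewrite !exprS -scalerA ypsi_x IH mulrA.
rewrite {1}[c](qpoly_decomp k0) scaler_suml (big_morph _ ypsiD h0).
rewrite [in RHS](qpoly_decomp k0 c) mulr_suml; apply: eq_bigr => j _.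
by rewrite -scalerA ypsi_qc ?hX ?mulrA // lcombZ u0 scaler0.
Qed.

Lemma ypsi_top (q : qv) : (ypsi q : {poly pK})`_k.-1 = yphi q.
Proof.
rewrite coef_qpoly_sum.
have hk : (k.-1 < k)%N by rewrite prednK.
rewrite (bigD1 (Ordinal hk)) //= big1 => [|j nj].
  by rewrite addr0 mulrC (coef_qcM k0) coef_qx_exp // eqxx mulr1 subnn expr0 scale1r.
rewrite mulrC (coef_qcM k0) coef_qx_exp //; case: eqP => [jk|_]; last by rewrite mulr0.
by case/eqP: nj; apply: val_inj.
Qed.

(** At y q, the top coefficient of [ypsi] has constant term [ymu q]. But on relations [ypsi] agrees
    with a map from the whole free module, whose value at y q is divisible by y. *)
Lemma ypsi_contra (q : qv) : lcomb e0 (qc k 'X *: q) = 0 -> ymu q = 0.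
Proof.
move=> q0; have [phi hphi] := @extend_relations pK k A M e0 ypsi ext1 hs0 ypsiP.
have /(congr1 (fun r : R => ((r : {poly pK})`_k.-1)`_0)) := hphi _ q0.
rewrite ypsi_top yphiX coefD coefXM add0r coefC eqxx => ->.
by rewrite dotpZr (coef_qcM k0) coefXM.
Qed.

End Degree.

(** If [m] were not 0, some functional [mu] on the coordinates of degree [i] would vanish on
    relations and be 1 on [m], against [ypsi_contra]. *)
Lemma y_inj_homog i m : homog M i m -> (qc k 'X : R) *: m = 0 -> m = 0.
Proof.
move=> hm ym; apply: contrapT => m0; have [c ec] := hs0 m; pose q : qv := c.
have hm' : m = bcomb e (comp d i (qv_coords q)).
  have [s [c' [us hc ev]]] := hpart_span d (qv_coords q).
  have em : m = \sum_(j <- s) bcomb e (c' j).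
    by rewrite -bcomb_sum -ev bcomb_coords.
  have hcomp : comp d i (qv_coords q) = if i \in s then c' i else 0.
    rewrite ev comp_sum; case: ifP => si.
      rewrite (bigD1_seq i) //= (comp_id (hc i)) big1 ?addr0 // => j ji.
      exact: comp_ne (hc j) ji.
    rewrite big_seq big1 // => j js; apply: comp_ne (hc j) _.
    by apply: contraFneq si => <-.
  have := homog_component hm us (fun j => bcomb_homog k2 gen_homog (hc j)) em.
  by rewrite hcomp; case: ifP => _ -> //; rewrite bcomb0.
pose W (w : A' -> K) := bcomb e (imon i w) = 0.
have [mu [hmu hf]] : exists mu : A' -> K, (forall w, W w -> \sum_x mu x * w x = 0) /\
    \sum_x mu x * icoef i (qv_coords q) x = 1.
  apply: subspace_separate.
  - rewrite /W (_ : imon i _ = 0) ?bcomb0 //; apply/funext => x.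
    by rewrite /imon scale0r if_same.
  - move=> c' u v hu hv; by rewrite /W imonP bcombD (bcombZ k2) hu hv scaler0 addr0.
  - by rewrite /W imon_icoef -hm'.
have : ymu i mu q = 0.
  by apply: (ypsi_contra hmu); rewrite lcombZ -[lcomb e0 q]ec ym.
by rewrite /ymu hf => /eqP; rewrite oner_eq0.
Qed.

Lemma y_injective (m : M) : (qc k 'X : R) *: m = 0 -> m = 0.
Proof.
have [s [c [us hc ->]]] := homog_span m; rewrite scaler_sumr => h.
rewrite big_seq big1 // => i si; apply: (y_inj_homog (hc i)).
(* Multiplication by y lowers degrees by 1, so the summands are reindexed to stay homogeneous of
   their index. *)
have hd j : homog M j ((qc k 'X : R) *: c (j + 1)).
  apply: homog_qc k2 _ _ _ _ _ _ (hc (j + 1)) => n; rewrite coefX.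
  have [->|_] := eqVneq n 1%N; last by rewrite eqxx.
  by move=> _; lia.
have ut : uniq [seq j - 1 | j <- s] by rewrite map_inj_uniq // => x y; lia.
have := homog_free ut hd; rewrite big_map.
under eq_bigr do rewrite subrK.
by move=> /(_ h) /(_ (i - 1)); rewrite subrK; apply; apply: (map_f (fun j => j - 1)).
Qed.
End YInjective.

(** * Generically free MCM modules as matrices *)

Section Realization.
Context (K : fieldType) (k : nat) (k2 : (2 <= k)%N).
Notation mhom := (@hom K (mx_cat K)).
Notation mobj := (mobj K k).
Notation pK := {poly K}.
Notation R := (ringR K k).
Notation C := (MCM0 K k).
Let k0 : (0 < k)%N. Proof. exact: ltnW. Qed.

Lemma egr_bcomb (V : mobj) v : bcomb (M := egr k2 V) (fun a => pbasis K a : egr k2 V) v = v.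
Proof.
rewrite [RHS]pvec_basis; apply: eq_bigr => a _; exact: emod_qc.
Qed.

Lemma egr_generically_free (V : mobj) : generically_free (egr_ob k2 V).
Proof.
have [n [t [bc ht fr]]] := @unit_gen_free K k k2 (mi V) (md V) (mX V) (mX_deg V) (mX_nil V)
  (egr k2 V) (fun a => pbasis K a : egr k2 V) (@hpart_basis K _ (md V))
  (fun m => ex_intro _ m (esym (@egr_bcomb V m)))
  (fun v h => etrans (esym (@egr_bcomb V v)) h)
  (fun v => etrans (@egr_bcomb V _) (etrans (esym (@emod_qx K k k2 V v)) (congr1 (fun u : emod k2 V => (qx pK k : R) *: u) (esym (@egr_bcomb V v)))))
  (mX_unit V).
by exists n, (freeF_gr K k2 n), t.
Qed.

Definition rob (V : mobj) : C :=
  FullOb (conj (@egr_CM K k k2 V) (@egr_generically_free V)).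

Section MatrixOfHom.
Context (V W : mobj).
Implicit Types f g : @hom K C (rob V) (rob W).

Lemma emat_ex (f : @hom K C (rob V) (rob W)) : exists m : mhom (mi V) (mi W),
  is_mor 0 m /\ forall v, grfun (f : grHom (egr k2 V) (egr k2 W)) v = hmap (md V) (md W) 0 m v.
Proof. by have [m h e] := egr_full (f : grHom (egr k2 V) (egr k2 W)); exists m. Qed.

Definition emat f : mhom (mi V) (mi W) := projT1 (cid (emat_ex f)).
Lemma emat_mor f : is_mor 0 (emat f). Proof. exact: (projT2 (cid (emat_ex f))).1. Qed.
Lemma ematE f v :
  grfun (f : grHom (egr k2 V) (egr k2 W)) v = hmap (md V) (md W) 0 (emat f) v.
Proof. exact: (projT2 (cid (emat_ex f))).2. Qed.

Lemma emat_unique f m : (forall v, grfun (f : grHom (egr k2 V) (egr k2 W)) v =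
  hmap (md V) (md W) 0 m v) -> emat f = m.
Proof. move=> h; apply: (@hmap_inj K _ _ (md V) (md W) 0) => v.
exact: etrans (esym (ematE f v)) (h v). Qed.

Lemma emat_inj f g : emat f = emat g -> f = g.
Proof.
move=> h; apply: (@grHomP K _ _ (egr k2 V) (egr k2 W)) => v.
by rewrite !ematE h.
Qed.

Lemma emat_surj m : is_mor 0 m -> exists f, emat f = m.
Proof.
move=> hm; exists (emap k2 hm : @hom K C (rob V) (rob W)).
by apply: emat_unique => v.
Qed.

Lemma emat_lin a f g : emat (a *: f + g) = a *: emat f + emat g.
Proof.
apply: emat_unique => v; rewrite hmapP -!ematE -[X in _ = X + _]emod_qc.
have -> : qc k (a%:P : pK) = a%:A :> R; last by [].
apply: (qpolyP k0) => j _.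
rewrite (coef_qc k0) -[RHS]/((a%:P *: (1 : {poly %/ ('X^k : {poly pK})}) : {poly pK})`_j).
rewrite coefZ -[1 in RHS](rmorph1 (qc k)) (coef_qc k0).
by case: eqP; rewrite ?mulr1 ?mulr0.
Qed.
End MatrixOfHom.

Lemma ematM U V W (g : @hom K C (rob V) (rob W)) (f : @hom K C (rob U) (rob V)) :
  emat (g \c f) = emat g \c emat f.
Proof.
apply: emat_unique => v.
rewrite -[0 in RHS]addr0 (hmapM _ (emat_mor g).2 (emat_mor f).2) -!ematE.
by [].
Qed.

Lemma emat1 V : emat (idm (rob V)) = idm _.
Proof. by apply: emat_unique => v; rewrite hmap_id. Qed.

(** The isomorphism with a matrix module is kept as data: every object has a chosen chart [ch], and
    an object [rob V] also has the tautological [rob_chart V]. Both occur for the same object. *)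
Record chart (X : C) := Chart {
  cV : mobj;
  cto : @hom K C X (rob cV);
  cfrom : @hom K C (rob cV) X;
  ctoK : cto \c cfrom = idm _;
  cfromK : cfrom \c cto = idm _ }.

Definition rob_chart V : chart (rob V) :=
  Chart (cmp1m (idm (rob V))) (cmp1m (idm (rob V))).

Section Mat.
Context (X Y : C) (cx : chart X) (cy : chart Y).
Implicit Types f g : hom X Y.

Definition mat f : mhom (mi (cV cx)) (mi (cV cy)) := emat (cto cy \c f \c cfrom cx).

Lemma mat_mor f : is_mor 0 (mat f). Proof. exact: emat_mor. Qed.

Lemma mat_inj f g : mat f = mat g -> f = g.
Proof.
move=> /emat_inj h.
have e (u : hom X Y) : u = cfrom cy \c (cto cy \c u \c cfrom cx) \c cto cx.
  by rewrite -!cmpA cfromK cmpm1 cmpA cfromK cmp1m.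
by rewrite (e f) (e g) h.
Qed.

Lemma mat_surj m : is_mor 0 m -> exists f, mat f = m.
Proof.
move=> /emat_surj[f <-]; exists (cfrom cy \c f \c cto cx); congr emat.
by rewrite -!cmpA ctoK cmpm1 cmpA ctoK cmp1m.
Qed.

Lemma mat_lin a f g : mat (a *: f + g) = a *: mat f + mat g.
Proof. by rewrite /mat cmpPr cmpPl emat_lin. Qed.

Lemma mat0 : mat 0 = 0.
Proof. by have := mat_lin (-1) 0 0; rewrite scaler0 addr0 scaleN1r addNr. Qed.
Lemma matD f g : mat (f + g) = mat f + mat g.
Proof. by have := mat_lin 1 f g; rewrite !scale1r. Qed.
Lemma matN f : mat (- f) = - mat f.
Proof. by have := mat_lin (-1) f 0; rewrite mat0 !addr0 !scaleN1r. Qed.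
Lemma matB f g : mat (f - g) = mat f - mat g.
Proof. by rewrite matD matN. Qed.
Lemma mat_eq0 f : mat f = 0 -> f = 0.
Proof. by move=> h; apply: mat_inj; rewrite mat0. Qed.
End Mat.
Arguments mat {X Y} cx cy f.

Lemma matM (X Y Z : C) (cx : chart X) (cy : chart Y) (cz : chart Z) (g : hom Y Z) (f : hom X Y) :
  mat cx cz (g \c f) = mat cy cz g \c mat cx cy f.
Proof.
rewrite /mat -ematM; congr emat; rewrite -!cmpA; congr (_ \c (_ \c _)).
by rewrite !cmpA cfromK cmp1m.
Qed.

Lemma mat1 (X : C) (cx : chart X) : mat cx cx (idm X) = idm _.
Proof. by rewrite /mat cmpm1 ctoK emat1. Qed.

Lemma free_projective (A : finType) (d : A -> int) : gr_projective (full_val (rob (mfree k2 d))).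
Proof.
have -> : d = (fun a => (d a - (k.-1)%:Z) + (k.-1)%:Z) by apply/funext => a; rewrite subrK.
exact: lfree_projective.
Qed.

(** From left to right, a projective is a retract of a free module, whose identity is null by
    [mfree_null]. Conversely, a null map extends along [co_i] to the hull, which is projective. *)
Lemma ideal_null (X Y : C) (cx : chart X) (cy : chart Y) (f : hom X Y) :
  in_ideal (MCM0_ideal K k) X Y f <-> is_null 0 (mat cx cy f).
Proof.
split=> [[P [b [a [prP ef]]]]|].
  have [A [d [e [he hs]]]] := homog_generators (fg_valP P).
  pose g : @hom K (grR K k) (egr_ob k2 (lfree K k2 d)) P := lfree_hom k2 he.
  have [|s es] := prP _ _ g (idm P); first exact: lfree_hom_surj hs.
  pose b' : @hom K C (rob (lfree K k2 d)) Y := b \c g.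
  pose a' : @hom K C X (rob (lfree K k2 d)) := s \c a.
  have -> : f = b' \c a'.
    rewrite [LHS]ef -[LHS]/(b \c a) -[RHS]/(b \c g \c (s \c a)).
    by rewrite -(cmpA b g) (cmpA g s) es cmp1m.
  rewrite (matM cx (rob_chart _) cy) -[0]addr0.
  apply: is_null_l (mat_mor _ _ _) _; rewrite -[mat _ _ a']cmp1m -[0]addr0.
  by apply: is_null_r (mat_mor _ _ _); apply: mfree_null.
move=> /(conf_ext (co_conf k2 (cV cx)))[g ng eg].
have [|b eb] := @mat_surj _ _ (rob_chart (mI k2 (cV cx))) cy g.
  by apply: is_mor_eq (is_null_mor ng) _; rewrite subr0.
have [|a ea] := @mat_surj _ _ cx (rob_chart (mI k2 (cV cx))) (co_i k2 (cV cx)).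
  exact: (cf_i (co_conf k2 (cV cx))).
exists (full_val (rob (mI k2 (cV cx)))), b, a; split; first exact: free_projective.
by apply: (@mat_inj _ _ cx cy); rewrite (matM cx (rob_chart _) cy) ea eb eg.
Qed.

Lemma chart_ex (X : C) : exists _ : chart X, True.
Proof.
case: X => M [cm gf].
have fgM := fg_valP M.
have [A0 [d0 [e0 [he0 hs0]]]] := homog_generators fgM.
have yinj : forall m : gr_mod M, ycoef k 'X *: m = 0 -> m = 0.
  exact: (@y_injective K k k2 (fg_val M) A0 d0 e0 he0 hs0 (cm 0%N)).
have [A [d [e [he hs hf]]]] := homog_basis k2 yinj fgM.
have [X [dX hx nX]] := coord_matrix k2 he hs hf.
have uX : has_unit k X.
  have [n [T [t [bc _ [_ [E [_ hE]]]]]]] := gf.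
  exact: (@gen_free_unit K k k2 A d X dX nX (fg_val M) e hs hf hx T t bc n E hE).
pose V := MObj dX nX uX.
have fl : linear (fun v : egr k2 V => bcomb e v).
  apply: egr_linear => [u v|p u|a]; [exact: bcombD|exact: bcombZ|exact: hx].
pose f : grHom (egr k2 V) (fg_val M) := GrHom fl (fun i v => @bcomb_homog K k k2 _ _ _ _ he i v).
pose g0 (m : fg_val M) : egr k2 V := gcoord hs m.
have g0K m : f (g0 m) = m by exact: (esym (gcoordP hs m)).
have f_inj u v : f u = f v -> u = v by move=> h; exact: (bcomb_inj hf h).
have gl : linear g0.
  by move=> c u v; apply: f_inj; rewrite grfun_linear !g0K.
have gh i m : homog (fg_val M) i m -> homog (egr k2 V) i (g0 m).
  by move=> hm; apply: (coord_hpart k2 he hf); rewrite -gcoordP.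
pose g : grHom (fg_val M) (egr k2 V) := GrHom gl gh.
pose X0 : C := FullOb (conj cm gf).
pose gC : @hom K C X0 (rob V) := g; pose fC : @hom K C (rob V) X0 := f.
have e1 : gC \c fC = idm _.
  by apply: (@grHomP K _ _ (egr k2 V) (egr k2 V)) => v; apply: f_inj; apply: g0K.
have e2 : fC \c gC = idm _.
  by apply: (@grHomP K _ _ (fg_val M) (fg_val M)) => v; apply: g0K.
by exists (Chart e1 e2).
Qed.

Definition ch (X : C) : chart X := projT1 (cid (chart_ex X)).

End Realization.
Arguments mat {K k k2 X Y} cx cy f : rename.

(** * Trace form and Serre duality *)

Section TraceForm.
Context (K : fieldType) (k : nat) (k2 : (2 <= k)%N).
Notation mhom := (@hom K (mx_cat K)).
Notation mobj := (mobj K k).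
Implicit Types U V W : mobj.

Definition munit V : mhom (mi V) (mi V) := projT1 (cid (mX_unit V)).
Arguments munit V : clear implicits.
Lemma munitP V : nrm k (mX V) (mX V) (munit V) = idm _.
Proof. exact: projT2 (cid (mX_unit V)). Qed.

Lemma mtr_pos (A : finType) (d : A -> int) r (f : mhom A A) :
  mdeg d d r f -> 0 < r -> mtr f = 0.
Proof.
move=> df r0; rewrite /mtr big1 // => a _; apply/eqP; apply: contraTT r0 => /df.
by move=> ?; lia.
Qed.

(** Degree [k] for the norm means degree 1 for [s]. Adjointness moves the norm onto the unit and
    leaves the trace of [s], and a matrix of positive degree has zero diagonal. *)
Lemma mtr_null V (c : mhom (mi V) (mi V)) :
  is_null (V := V) (W := V) k%:Z c -> mtr (c \c munit V) = 0.
Proof.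
move=> [s ds ->]; rewrite mtr_nrm munitP cmpm1; apply: (mtr_pos ds); lia.
Qed.

(** The identity of [W] is inserted as a norm, and the norm is moved across the trace onto
    [munit V], where it becomes the identity of [V]. *)
Lemma mtr_swap V W (c : mhom (mi V) (mi W)) (g : mhom (mi W) (mi V)) :
  c \c mX V = mX W \c c -> g \c mX W = mX V \c g ->
  mtr (g \c c \c munit V) = mtr (c \c g \c munit W).
Proof.
move=> cc cg.
rewrite -[g in LHS]cmpm1 -(munitP W) (nrm_l k (mX W) (munit W) cg) -cmpA mtr_nrm.
by rewrite -(nrm_l k (mX V) (munit V) cc) munitP cmpm1 mtrC cmpA.
Qed.

Local Notation cc V W := (@conf_map K k V (mI k2 V) (mS k2 V) W (mI k2 W) (mS k2 W)
  (co_i k2 V) (co_p k2 V) (co_i k2 W) (co_p k2 W)).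
Local Notation cs W V := (@conf_map K k W (mI k2 W) (mS k2 W) (mS k2 V) (mI k2 V) V
  (co_i k2 W) (co_p k2 W) (sy_a k2 V) (sy_b k2 V)).
Local Notation ss V W := (@conf_map K k (mS k2 V) (mI k2 V) V (mS k2 W) (mI k2 W) W
  (sy_a k2 V) (sy_b k2 V) (sy_a k2 W) (sy_b k2 W)).

(** Meant for an isomorphism [f] from another model [W] onto the cosyzygy of [V]: then [h] is the
    map of cokernels from the hull sequence of [W] to the syzygy sequence of [V], that is, from
    Sigma^2 V to V shifted by [k]. *)
Definition susp_sy V W (f : mhom (mi W) (mi (mS k2 V))) (h : mhom (mi (mS k2 W)) (mi V)) :=
  is_mor (V := mS k2 W) (W := V) k%:Z h /\
  exists2 g : mhom (mi (mI k2 W)) (mi (mI k2 V)), is_mor (V := mI k2 W) (W := mI k2 V) 1 g &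
    cs W V f g h.

Lemma conf_mapB U V W U' V' W' (i : mhom (mi U) (mi V)) (p : mhom (mi V) (mi W))
    (i' : mhom (mi U') (mi V')) (p' : mhom (mi V') (mi W')) f g h f' g' h' :
  @conf_map K k U V W U' V' W' i p i' p' f g h -> @conf_map K k U V W U' V' W' i p i' p' f' g' h' ->
  conf_map i p i' p' (f - f') (g - g') (h - h').
Proof. by move=> [e1 e2] [e1' e2']; split; rewrite cmpBl cmpBr ?e1 ?e1' ?e2 ?e2'. Qed.

Lemma conf_mapM U V W U' V' W' U'' V'' W'' (i : mhom (mi U) (mi V)) (p : mhom (mi V) (mi W))
    (i' : mhom (mi U') (mi V')) (p' : mhom (mi V') (mi W'))
    (i'' : mhom (mi U'') (mi V'')) (p'' : mhom (mi V'') (mi W'')) f g h f' g' h' :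
  @conf_map K k U V W U' V' W' i p i' p' f g h -> @conf_map K k U' V' W' U'' V'' W'' i' p' i'' p'' f' g' h' ->
  @conf_map K k U V W U'' V'' W'' i p i'' p'' (f' \c f) (g' \c g) (h' \c h).
Proof.
move=> [e1 e2] [e1' e2']; split.
  by rewrite -cmpA e1 !cmpA e1'.
by rewrite -cmpA e2 !cmpA e2'.
Qed.

Lemma conf_map1 U V W (i : mhom (mi U) (mi V)) (p : mhom (mi V) (mi W)) :
  @conf_map K k U V W U V W i p i p (idm _) (idm _) (idm _).
Proof. by split; rewrite cmp1m cmpm1. Qed.

Lemma is_null0 V W r : is_null (V := V) (W := W) r 0.
Proof. by exists 0; [apply: mdeg0 | rewrite nrm0]. Qed.

Lemma is_morB V W r (f g : mhom (mi V) (mi W)) :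
  is_mor (V := V) (W := W) r f -> is_mor (V := V) (W := W) r g ->
  is_mor (V := V) (W := W) r (f - g).
Proof. by move=> hf hg; apply: is_morD => //; apply: is_morN. Qed.

Lemma susp_sy_ex V W (f : mhom (mi W) (mi (mS k2 V))) f' : mor_iso (V := W) (W := mS k2 V) f f' ->
  exists h h', [/\ susp_sy f h, is_mor (V := V) (W := mS k2 W) (- k%:Z) h',
    is_null (V := mS k2 W) (W := mS k2 W) 0 (h' \c h - idm _) &
    is_null (V := V) (W := V) 0 (h \c h' - idm _)].
Proof.
move=> [hf hf' e e'].
have cW := co_conf k2 W; have cV := sy_conf k2 V.
have [g [h [hg hh cm]]] := conf_map_ex cW cV (@mfree_null K k k2 (mi V) (md V)) hf.
have [g' [h' [hg' hh' cm']]] := conf_map_ex cV cW (@mfree_null K k k2 (mi W) (md W)) hf'.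
have hg1 : is_mor (V := mI k2 W) (W := mI k2 V) 1 g by apply: (is_mor_eq hg); lia.
have hg1' : is_mor (V := mI k2 V) (W := mI k2 W) (-1) g' by apply: (is_mor_eq hg'); lia.
have hhk : is_mor (V := mS k2 W) (W := V) k%:Z h by apply: (is_mor_eq hh); lia.
have hhk' : is_mor (V := V) (W := mS k2 W) (- k%:Z) h' by apply: (is_mor_eq hh'); lia.
exists h, h'; split=> //; first by split=> //; exists g.
  have cm2 := conf_mapB (conf_mapM cm cm') (@conf_map1 W (mI k2 W) (mS k2 W) (co_i k2 W) (co_p k2 W)).
  have := conf_map_null cW cW (@mfree_null K k k2 (mi W) (md W)) _ _ cm2.
  rewrite e subrr => /(_ 0); apply; first exact: is_null0.
  apply: is_morB; last by apply: (is_mor_eq (is_mor_id _)).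
  by apply: (is_mor_eq (is_morM hg1' hg1)).
have cm2 := conf_mapB (conf_mapM cm' cm) (@conf_map1 (mS k2 V) (mI k2 V) V (sy_a k2 V) (sy_b k2 V)).
have nn := conf_map_null cV cV (@mfree_null K k k2 (mi V) (md V)) _ _ cm2.
have := nn 0; rewrite e' subrr.
have -> : 0 + 1 - 1 + (k%:Z - 1) - (k%:Z - 1) = 0 by lia.
apply; first exact: is_null0.
apply: is_morB; last by apply: (is_mor_eq (is_mor_id _)); lia.
by apply: (is_mor_eq (is_morM hg1 hg1')); lia.
Qed.

Lemma co_map_unique V W (f : mhom (mi V) (mi W)) g h :
  is_mor (V := V) (W := W) 0 f -> is_mor (V := mI k2 V) (W := mI k2 W) 0 g ->
  cc V W f g h ->
  is_null (V := mS k2 V) (W := mS k2 W) 0 (h - co_susp (k2:=k2) f).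
Proof.
move=> hf hg cm.
have cm' : cc V W f (co_map (k2:=k2) f) (co_susp (k2:=k2) f).
  by split; [apply: co_map_i | apply: co_map_p].
have := conf_map_null (co_conf k2 V) (co_conf k2 W) (@mfree_null K k k2 (mi W) (md W)) _ _ (conf_mapB cm cm').
rewrite subrr => /(_ 0); apply; first exact: is_null0.
by apply: is_morB => //; apply: co_map_mor.
Qed.

(** Both composites are induced on cokernels by maps that agree up to a null map, so [conf_map_null]
    applies to their difference. [e] enters through its canonical lift [co_map], which respects the
    syzygy sequences. *)
Lemma susp_sy_nat V W V' W' (e : mhom (mi V) (mi V')) (f : mhom (mi W) (mi (mS k2 V))) h
    (f' : mhom (mi W') (mi (mS k2 V'))) h' (e1 : mhom (mi W) (mi W')) g2 e2 :
  is_mor (V := V) (W := V') 0 e -> susp_sy f h -> susp_sy f' h' ->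
  is_mor (V := mI k2 W) (W := mI k2 W') 0 g2 ->
  cc W W' e1 g2 e2 ->
  is_null (V := W) (W := mS k2 V') 0 (f' \c e1 - co_susp (k2:=k2) e \c f) ->
  is_null (V := mS k2 W) (W := V') k%:Z (h' \c e2 - e \c h).
Proof.
move=> he [hh [g hg cm]] [hh' [g' hg' cm']] hg2 cm2 nf.
have sy : ss V V' (co_susp (k2:=k2) e) (co_map (k2:=k2) e) e.
  by split; [apply: co_map_a | apply: co_map_b].
have := conf_map_null (co_conf k2 W) (sy_conf k2 V') (@mfree_null K k k2 (mi V') (md V')) nf _
  (conf_mapB (conf_mapM cm2 cm') (conf_mapM cm sy)).
have -> : 0 + 1 - 0 + (k%:Z - 1) - 0 = k%:Z by lia.
apply; apply: is_morB.
  by apply: (is_mor_eq (is_morM hg' hg2)).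
by apply: (is_mor_eq (is_morM (co_map_mor k2 he) hg)).
Qed.
End TraceForm.
Arguments munit {K k} V.

(** * The Frobenius structure and the stable triangulation *)

Section Frobenius.
Context (K : fieldType) (k : nat) (k2 : (2 <= k)%N).
Notation mhom := (@hom K (mx_cat K)).
Notation mobj := (mobj K k).
Notation C := (MCM0 K k).
Notation J := (MCM0_ideal K k).
Notation ch := (ch k2).
Notation rc := (rob_chart k2).
Notation vX X := (cV (ch X)).
Implicit Types X Y Z T : C.

(** Built from the chosen chart of [X]. The same holds for [cosyz], whose value then has its
    tautological chart besides its own chosen one; [change_iso] passes between charts. *)
Definition hull X : C := rob k2 (mI k2 (vX X)).
Definition cosyz X : C := rob k2 (mS k2 (vX X)).

Lemma hull_in_ex X : exists f : hom X (hull X), mat (ch X) (rc (mI k2 (vX X))) f = co_i k2 (vX X).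
Proof.
exact: (mat_surj (cx := ch X) (cy := rc (mI k2 (vX X))) (cf_i (co_conf k2 (vX X)))).
Qed.
Definition hull_in X : hom X (hull X) := projT1 (cid (hull_in_ex X)).
Lemma hull_inE X : mat (ch X) (rc (mI k2 (vX X))) (hull_in X) = co_i k2 (vX X).
Proof. exact: projT2 (cid (hull_in_ex X)). Qed.

Lemma cosyz_proj_ex X : exists f : hom (hull X) (cosyz X),
  mat (rc (mI k2 (vX X))) (rc (mS k2 (vX X))) f = co_p k2 (vX X).
Proof.
exact: (mat_surj (cx := rc (mI k2 (vX X))) (cy := rc (mS k2 (vX X)))
  (cf_p (co_conf k2 (vX X)))).
Qed.
Definition cosyz_proj X : hom (hull X) (cosyz X) := projT1 (cid (cosyz_proj_ex X)).
Lemma cosyz_projE X :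
  mat (rc (mI k2 (vX X))) (rc (mS k2 (vX X))) (cosyz_proj X) = co_p k2 (vX X).
Proof. exact: projT2 (cid (cosyz_proj_ex X)). Qed.

Lemma change_iso X (c c' : chart k2 X) :
  mor_iso (V := cV c) (W := cV c') (mat c c' (idm X)) (mat c' c (idm X)).
Proof. by split; rewrite -?matM ?cmp1m ?mat1 //; apply: mat_mor. Qed.

Lemma mcm_additive : additive_cat C.
Proof.
split.
  have d0 : mdeg (K := K) (A := 'I_0 : finType) (B := 'I_0 : finType)
    (fun _ : 'I_0 => 0) (fun _ : 'I_0 => 0) 1 0 by case.
  have n0 : pw (0 : mhom ('I_0 : finType) ('I_0 : finType)) k = 0 by apply: mxP; case.
  have u0 : has_unit k (0 : mhom ('I_0 : finType) ('I_0 : finType)).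
    by exists 0; apply: mxP; case.
  pose Z := MObj d0 n0 u0; exists (rob k2 Z).
  by apply: (@mat_inj K k k2 _ _ (rc Z) (rc Z)); apply: mxP; case.
move=> X Y; have [Z [i1 [i2 [p1 [p2 [[e1 e2 e3 e4 e5] h1 h2 h3 h4]]]]]] := msum_ex (vX X) (vX Y).
have [j1 f1] := mat_surj (cx := ch X) (cy := rc Z) h1.
have [j2 f2] := mat_surj (cx := ch Y) (cy := rc Z) h2.
have [q1 g1] := mat_surj (cx := rc Z) (cy := ch X) h3.
have [q2 g2] := mat_surj (cx := rc Z) (cy := ch Y) h4.
exists (rob k2 Z), j1, j2, q1, q2; split.
- by apply: (mat_inj (cx := ch X) (cy := ch X)); rewrite (matM _ (rc Z)) f1 g1 mat1.
- by apply: (mat_inj (cx := ch Y) (cy := ch Y)); rewrite (matM _ (rc Z)) f2 g2 mat1.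
- by apply: (mat_eq0 (cx := ch X) (cy := ch Y)); rewrite (matM _ (rc Z)) f1 g2.
- by apply: (mat_eq0 (cx := ch Y) (cy := ch X)); rewrite (matM _ (rc Z)) f2 g1.
apply: (mat_inj (cx := rc Z) (cy := rc Z)).
by rewrite matD (matM _ (ch X)) (matM _ (ch Y)) f1 f2 g1 g2 mat1.
Qed.

(** Sigma^2 is the shift by [k], so a preimage of [Y] is the cosyzygy of [Y] with degrees raised by
    [k]: the comparison matrix, of degree [k] into the shifted object, has degree 0 into [Y]. *)
Lemma cosyz_surj (Y : quot_cat J) : exists X : C, @isomorphic K (quot_cat J) (cosyz X) Y.
Proof.
pose V' := mshift k%:Z (vX Y); pose X := rob k2 (mS k2 V').
have [sh sh'] := mshift_mor k%:Z (vX Y).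
have [h [h' [[hh _] hh' n1 n2]]] := susp_sy_ex (change_iso (ch X) (rc (mS k2 V'))).
have hF : is_mor (V := mS k2 (vX X)) (W := vX Y) 0 h.
  by rewrite -[h]cmp1m; apply: (is_mor_eq (is_morM sh' hh)); lia.
have hG : is_mor (V := vX Y) (W := mS k2 (vX X)) 0 h'.
  by rewrite -[h']cmpm1; apply: (is_mor_eq (is_morM hh' sh)); lia.
have [F eF] := mat_surj (cx := rc (mS k2 (vX X))) (cy := ch Y) hF.
have [G eG] := mat_surj (cx := ch Y) (cy := rc (mS k2 (vX X))) hG.
exists X, (qm J F), (qm J G); split.
  rewrite -qmM; apply: (proj2 (qmP J (G \c F) (idm (cosyz X)))).
  by apply/(ideal_null (rc _) (rc _)); rewrite matB (matM _ (ch Y)) eF eG mat1.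
rewrite -qmM; apply: (proj2 (qmP J (F \c G) (idm (Y : C)))).
apply/(ideal_null (ch Y) (ch Y)); rewrite matB (matM _ (rc (mS k2 (vX X)))) eF eG mat1.
(* The degrees of source and target were raised by the same [k], so the bound on [s] carries
   over. *)
have [s ds e] := n2; exists s => // b a /(ds b a) /=; lia.
Qed.

Lemma mcm_frobenius : frobenius_data J hull_in cosyz_proj.
Proof.
have cf X := co_conf k2 (vX X).
split.
- move=> X; apply: (mat_eq0 (cx := ch X) (cy := rc _)).
  rewrite (matM _ (rc _)) hull_inE cosyz_projE.
  by have [] := cf_split (cf X).
- move=> T X f h; apply: (mat_eq0 (cx := ch T) (cy := ch X)).
  have := congr1 (mat (ch T) (rc _)) h; rewrite (matM _ (ch X)) hull_inE mat0 => e.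
  have [_ ri _ _] := cf_split (cf X).
  by rewrite -[LHS]cmp1m -ri -cmpA e cmpm0.
- move=> T X f h.
  have := congr1 (mat (ch T) (rc _)) h; rewrite (matM _ (rc _)) cosyz_projE mat0 => e.
  have [g hg eg] := conf_ker (cf X) (mat_mor (ch T) (rc (mI k2 (vX X))) f) e.
  have [|g' eg'] := mat_surj (cx := ch T) (cy := ch X) (m := g).
    by apply: (is_mor_eq hg).
  exists g'; apply: (mat_inj (cx := ch T) (cy := rc _)).
  by rewrite (matM _ (ch X)) hull_inE eg' -eg.
- move=> T X f h; apply: (mat_eq0 (cx := rc _) (cy := ch T)).
  have := congr1 (mat (rc _) (ch T)) h; rewrite (matM _ (rc _)) cosyz_projE mat0 => e.
  have [_ _ ps _] := cf_split (cf X).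
  by rewrite -[LHS]cmpm1 -ps cmpA e cmp0m.
- move=> T X f h.
  have := congr1 (mat (ch X) (ch T)) h; rewrite (matM _ (rc _)) hull_inE mat0 => e.
  have [g hg eg] := conf_coker (cf X) (mat_mor (rc (mI k2 (vX X))) (ch T) f) e.
  have [|g' eg'] := mat_surj (cx := rc _) (cy := ch T) (m := g).
    by apply: (is_mor_eq hg).
  exists g'; apply: (mat_inj (cx := rc _) (cy := ch T)).
  by rewrite (matM _ (rc _)) cosyz_projE eg' -eg.
- by move=> X; apply/(ideal_null (rc _) (rc _)); rewrite mat1; apply: mfree_null.
- move=> X T f /(ideal_null (ch X) (ch T)) nf.
  have [g hg eg] := conf_ext (cf X) nf.
  have [|g' eg'] := mat_surj (cx := rc _) (cy := ch T) (m := g).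
    by apply: (is_mor_eq (is_null_mor hg)).
  exists g'; apply: (mat_inj (cx := ch X) (cy := ch T)).
  by rewrite (matM _ (rc _)) hull_inE eg' -eg.
- move=> X T f /(ideal_null (ch T) (rc _)) nf.
  have [g hg eg] := conf_lift (cf X) nf.
  have [|g' eg'] := mat_surj (cx := ch T) (cy := rc _) (m := g).
    by apply: (is_mor_eq (is_null_mor hg)).
  exists g'; apply: (mat_inj (cx := ch T) (cy := rc _)).
  by rewrite (matM _ (rc _)) cosyz_projE eg' -eg.
- move=> X Y u.
  have [Z [q [v [hq hv e up]]]] := mpush_ex (cf X) (mat_mor (ch X) (ch Y) u).
  have [q' eq'] := mat_surj (cx := rc _) (cy := rc Z) hq.
  have [v' ev'] := mat_surj (cx := ch Y) (cy := rc Z) hv.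
  exists (rob k2 Z), q', v'; split.
    apply: (mat_inj (cx := ch X) (cy := rc Z)).
    by rewrite (matM _ (rc _)) (matM _ (ch Y)) hull_inE eq' ev'.
  move=> T a b hab.
  have := congr1 (mat (ch X) (ch T)) hab.
  rewrite (matM _ (rc _)) (matM _ (ch Y)) hull_inE => eab.
  have [w [[hw [w1 w2]] wu]] := up (vX T) _ _ (mat_mor (rc _) (ch T) a) (mat_mor (ch Y) (ch T) b) eab.
  have [w' ew'] := mat_surj (cx := rc Z) (cy := ch T) hw.
  exists w'; split.
    split; [apply: (mat_inj (cx := rc _) (cy := ch T)) | apply: (mat_inj (cx := ch Y) (cy := ch T))].
      by rewrite (matM _ (rc Z)) eq' ew'.
    by rewrite (matM _ (rc Z)) ev' ew'.
  move=> w2' [f1 f2]; apply: (mat_inj (cx := rc Z) (cy := ch T)); rewrite ew'; apply: wu.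
  split; first exact: (mat_mor (rc Z) (ch T) w2').
  by rewrite -f1 -f2 !(matM _ (rc Z)) eq' ev'.
- exact: mcm_additive.
exact: cosyz_surj.
Qed.

Lemma hull_projective X : gr_projective (full_val (hull X)).
Proof. exact: free_projective. Qed.

(** Exactness on elements is read off the splitting [co_r], [co_s] over K[y], after transport along
    the chosen chart. *)
Lemma hull_short_exact X : @short_exact K (ringR K k) (@degR K k) (@degR_scalar K k) _ _ _
  (hull_in X) (cosyz_proj X).
Proof.
pose V := vX X; have [pi ri ps e] := cf_split (co_conf k2 V).
have cf := co_conf k2 V.
have dr : mdeg (md (mI k2 V)) (md V) 0 (co_r k2 V) by rewrite -[0]oppr0; apply: cf_r cf.
have ds : mdeg (md (mS k2 V)) (md (mI k2 V)) 0 (co_s k2 V) by rewrite -[0]oppr0; apply: cf_s cf.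
pose G : grModule (@degR K k) := fg_val (full_val X).
pose to : G -> egr k2 V := grfun (cto (ch X) : grHom G (egr k2 V)).
pose from : egr k2 V -> G := grfun (cfrom (ch X) : grHom (egr k2 V) G).
have toK x : from (to x) = x.
  exact: (congr1 (fun f : hom X X => grfun (f : grHom G G) x) (cfromK (ch X))).
have fromK v : to (from v) = v.
  exact: (congr1 (fun f : @hom K C (rob k2 V) (rob k2 V) => grfun (f : grHom (egr k2 V) (egr k2 V)) v) (ctoK (ch X))).
have iE x : gr_app (hull_in X) x = hmap (md V) (md (mI k2 V)) 0 (co_i k2 V) (to x).
  rewrite -hull_inE -ematE /=.
  rewrite -[LHS]/(grfun (hull_in X : grHom G (egr k2 (mI k2 V))) x) -{1}(toK x).
  by [].
have pE x : gr_app (cosyz_proj X) x =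
    hmap (md (mI k2 V)) (md (mS k2 V)) 0 (co_p k2 V) x.
  by rewrite -cosyz_projE -ematE.
split.
- move=> x y; rewrite !iE => h; rewrite -(toK x) -(toK y); apply: (congr1 from).
  have := congr1 (hmap (md (mI k2 V)) (md V) 0 (co_r k2 V)) h.
  by rewrite -!(hmapM _ dr (cf_i cf).2) ri !hmap_id.
- move=> y; exists (hmap (md (mS k2 V)) (md (mI k2 V)) 0 (co_s k2 V) y).
  by rewrite pE -(hmapM _ (cf_p cf).2 ds) ps hmap_id.
move=> y; split=> [|[x <-]]; last first.
  by rewrite pE iE -(hmapM _ (cf_p cf).2 (cf_i cf).2) pi hmap0.
rewrite pE => h; exists (from (hmap (md (mI k2 V)) (md V) 0 (co_r k2 V) y)).
have e2 := hmapP (md (mI k2 V)) (md (mI k2 V)) 0 1 (co_i k2 V \c co_r k2 V)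
  (co_s k2 V \c co_p k2 V) y.
have e3 : hmap (md (mI k2 V)) (md (mI k2 V)) 0 (co_s k2 V \c co_p k2 V) y = 0.
  by have := hmapM y ds (cf_p cf).2; rewrite addr0 => ->; rewrite h hmap_at0.
rewrite scale1r e hmap_id scale1r e3 addr0 in e2.
by rewrite iE fromK -(hmapM _ (cf_i cf).2 dr) addr0 -e2.
Qed.

Definition mcm_triang := stable_triang mcm_frobenius.

Lemma mcm_stable_triangulation : is_stable_triangulation mcm_triang.
Proof.
exists hull, hull_in, cosyz_proj; split=> [X|X Y f|X Y Z u v w].
- by split; [apply: hull_projective | apply: hull_short_exact].
- have [h [g [e1 e2]]] := sig_ex mcm_frobenius f; exists g, h; split=> //.
  by apply: (stable_suspE mcm_frobenius); exists g.
by split.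
Qed.

End Frobenius.

(** * The Serre pairing and the 2-Calabi-Yau property *)

Section Serre.
Context (K : fieldType) (k : nat) (k2 : (2 <= k)%N).
Notation mhom := (@hom K (mx_cat K)).
Notation mobj := (mobj K k).
Notation C := (MCM0 K k).
Notation J := (MCM0_ideal K k).
Notation D := (stable_MCM0 K k).
Notation ch := (ch k2).
Notation rc := (rob_chart k2).
Notation vX X := (cV (ch X)).
Notation S := (cosyz k2).
Implicit Types X Y Z : C.

Lemma mtrB (A : finType) (f g : mhom A A) : mtr (f - g) = mtr f - mtr g.
Proof. by rewrite mtrD -scaleN1r mtrZ mulN1r. Qed.

Lemma is_null_eq (V W : mobj) r r' (f : mhom (mi V) (mi W)) :
  is_null (V := V) (W := W) r f -> r = r' -> is_null (V := V) (W := W) r' f.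
Proof. by move=> h <-. Qed.

(** Already the unstable Hom spaces are finite dimensional, being subspaces of spaces of scalar
    matrices. *)
Lemma mcm_hom_finite X Y : exists n (e : 'I_n -> hom X Y),
  forall f, exists c : 'I_n -> K, f = \sum_i c i *: e i.
Proof.
pose un (g : mi (vX Y) * mi (vX X) -> K) : mhom (mi (vX X)) (mi (vX Y)) := fun b a => g (b, a).
pose W g := is_mor (V := vX X) (W := vX Y) 0 (un g).
have [||n [b [hb sp]]] := @subspace_basis K _ W.
- exact: is_mor0.
- by move=> c u v hu hv; apply: is_mor_lin.
have /choice[e he] : forall i, exists f : hom X Y, mat (ch X) (ch Y) f = un (b i).
  by move=> i; apply: mat_surj (hb i).
exists n, e => f.
have [|c hc] := sp (fun p => mat (ch X) (ch Y) f p.1 p.2); first exact: mat_mor.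
exists c; apply: (mat_inj (cx := ch X) (cy := ch Y)).
have mD := matD (ch X) (ch Y).
rewrite (big_morph (mat (ch X) (ch Y)) mD (mat0 _ _)); apply: mxP => y x.
rewrite mx_sumE (hc (y, x)); apply: eq_bigr => i _.
rewrite -[c i *: e i]addr0 mat_lin mat0 addr0 he.
by [].
Qed.

Lemma stable_hom_finite : hom_finite D.
Proof.
move=> X Y; have [n [e he]] := mcm_hom_finite X Y.
exists n, (fun i => qm J (e i)) => F; have [f ->] := qmW F.
have [c ->] := he f; exists c.
rewrite (big_morph (qm J (X := X) (Y := Y)) (@qmD _ _ _ _ _) (qm0 _ _ _)).
by apply: eq_bigr => i _; rewrite -[c i *: e i]addr0 qm_lin qm0 addr0.
Qed.

Definition SS X : C := S (S X).

Lemma iota_ex X : exists h : mhom (mi (mS k2 (vX (S X)))) (mi (vX X)),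
  susp_sy (mat (ch (S X)) (rc (mS k2 (vX X))) (idm (S X))) h /\
  exists h', [/\ is_mor (V := vX X) (W := mS k2 (vX (S X))) (- k%:Z) h',
    is_null (V := mS k2 (vX (S X))) (W := mS k2 (vX (S X))) 0 (h' \c h - idm _) &
    is_null (V := vX X) (W := vX X) 0 (h \c h' - idm _)].
Proof.
have [h [h' [e1 e2 e3 e4]]] := susp_sy_ex (change_iso (ch (S X)) (rc (mS k2 (vX X)))).
by exists h; split=> //; exists h'.
Qed.

(** The comparison of Sigma^2 X with X shifted by [k], invertible up to null maps by [iota_inv]. It
    is induced by the identity of [S X], read from its chosen chart to the tautological one. *)
Definition cy_map X := projT1 (cid (iota_ex X)).
Arguments cy_map X : clear implicits.
Lemma iotaP X : susp_sy (mat (ch (S X)) (rc (mS k2 (vX X))) (idm (S X))) (cy_map X).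
Proof. exact: (projT2 (cid (iota_ex X))).1. Qed.
Lemma iota_mor X : is_mor (V := mS k2 (vX (S X))) (W := vX X) k%:Z (cy_map X).
Proof. exact: (iotaP X).1. Qed.
Lemma iota_inv X : exists h', [/\ is_mor (V := vX X) (W := mS k2 (vX (S X))) (- k%:Z) h',
    is_null (V := mS k2 (vX (S X))) (W := mS k2 (vX (S X))) 0 (h' \c cy_map X - idm _) &
    is_null (V := vX X) (W := vX X) 0 (cy_map X \c h' - idm _)].
Proof. exact: (projT2 (cid (iota_ex X))).2. Qed.

Notation m f := (mat (ch _) (ch _) f).
Notation ms X h := (mat (ch _) (rc (mS k2 (vX (S X)))) h).

Definition tau X Y (f : hom X Y) (h : hom Y (SS X)) : K :=
  mtr (cy_map X \c ms X h \c m f \c munit (vX X)).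

Lemma tau_lin X Y a (f g : hom X Y) h : tau (a *: f + g) h = a * tau f h + tau g h.
Proof. by rewrite /tau mat_lin cmpPr cmpPl mtrD mtrZ. Qed.
Lemma tau_linr X Y a (f : hom X Y) g h : tau f (a *: g + h) = a * tau f g + tau f h.
Proof. by rewrite /tau mat_lin cmpPr !cmpPl mtrD mtrZ. Qed.

Lemma mor_ih X Y (h : hom Y (SS X)) :
  is_mor (V := vX Y) (W := vX X) k%:Z (cy_map X \c ms X h).
Proof.
apply: (is_mor_eq (is_morM (iota_mor X) (mat_mor (ch Y) (rc (mS k2 (vX (S X)))) h))).
exact: addr0.
Qed.

Lemma tau_null_l X Y (f : hom X Y) h : in_ideal J X Y f -> tau f h = 0.
Proof.
move=> /(ideal_null (ch X) (ch Y)) nf; apply: (mtr_null k2).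
by apply: (is_null_eq (is_null_l (mor_ih h) nf)); rewrite addr0.
Qed.

Lemma tau_null_r X Y (f : hom X Y) h : in_ideal J Y (SS X) h -> tau f h = 0.
Proof.
move=> /(ideal_null (ch Y) (rc (mS k2 (vX (S X))))) nh; apply: (mtr_null k2).
apply: (is_null_eq (is_null_r (is_null_l (iota_mor X) nh) (mat_mor (ch X) (ch Y) f))).
by rewrite !addr0.
Qed.

(** [nrm_nondeg] tests against all [h] of degree [k]; such an [h] is realized through the stable
    inverse [i'] of the comparison map, up to a null map that the trace ignores. *)
Lemma null_of_tau_l X Y (f : hom X Y) : (forall h, tau f h = 0) -> in_ideal J X Y f.
Proof.
move=> t0; apply/(ideal_null (ch X) (ch Y)); have [cf df] := mat_mor (ch X) (ch Y) f.
apply: (nrm_nondeg (mX_nil _) (mX_nil _) (munitP (vX X)) cf) => h ch_ dh.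
have hh : is_mor (V := vX Y) (W := vX X) k%:Z h by split=> //; apply: (mdeg_eq dh); rewrite subr0.
have [i' [hi' n1 n2]] := iota_inv X.
have [|g eg] := mat_surj (cx := ch Y) (cy := rc (mS k2 (vX (S X)))) (m := i' \c h).
  by apply: (is_mor_eq (is_morM hi' hh)); rewrite addNr.
have := t0 g; rewrite /tau eg => e.
have n3 : is_null (V := vX X) (W := vX X) k%:Z ((cy_map X \c i' - idm _) \c h \c m f).
  apply: (is_null_eq (is_null_r (is_null_r n2 hh) (mat_mor (ch X) (ch Y) f))).
  by rewrite add0r addr0.
have := mtr_null k2 n3; rewrite !cmpBl cmp1m -[cy_map X \c i' \c h]cmpA => /eqP.
by rewrite mtrB e sub0r oppr_eq0 => /eqP.
Qed.

(** Here [nrm_nondeg] is applied to the matrix of [h] with the unit of [Y], so the trace has first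
    to be moved from [X] to [Y] by [mtr_swap]. *)
Lemma null_of_tau_r X Y (h : hom Y (SS X)) : (forall f : hom X Y, tau f h = 0) ->
  in_ideal J Y (SS X) h.
Proof.
move=> t0; apply/(ideal_null (ch Y) (rc (mS k2 (vX (S X))))).
set n := ms X h; have hn : is_mor (V := vX Y) (W := mS k2 (vX (S X))) 0 n.
  exact: (mat_mor (ch Y) (rc (mS k2 (vX (S X)))) h).
apply: (nrm_nondeg (mX_nil _) (mX_nil _) (munitP (vX Y)) hn.1) => g cg dg.
have hg : is_mor (V := mS k2 (vX (S X))) (W := vX Y) k%:Z g.
  by split=> //; apply: (mdeg_eq dg); rewrite subr0.
have [i' [hi' n1 n2]] := iota_inv X.
have [|f ef] := mat_surj (cx := ch X) (cy := ch Y) (m := g \c i').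
  by apply: (is_mor_eq (is_morM hg hi')); rewrite subrr.
have hin := mor_ih h.
have := t0 f; rewrite /tau ef mtr_swap; first last.
- by have [] := hin.
- by have [] := is_morM hg hi'.
move=> e.
have n3 : is_null (V := vX Y) (W := vX Y) k%:Z (g \c ((i' \c cy_map X - idm _) \c n)).
  apply: (is_null_eq (is_null_l hg (is_null_r n1 hn))).
  by rewrite !addr0.
have := mtr_null k2 n3; rewrite cmpBl cmp1m cmpBr cmpBl mtrB.
have -> : g \c (i' \c cy_map X \c n) = g \c i' \c (cy_map X \c n) by rewrite !cmpA.
by rewrite e sub0r => /eqP; rewrite oppr_eq0 => /eqP.
Qed.

Lemma tau_natl X Y Y' (f : hom X Y) (g : hom Y Y') (h : hom Y' (SS X)) :
  tau (g \c f) h = tau f (h \c g).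
Proof. by rewrite /tau (matM _ (ch Y)) (matM _ (ch Y')) !cmpA. Qed.

Notation fr := (mcm_frobenius K k2).
Notation T := (mcm_triang K k2).

(** Two ingredients: the comparison map is natural up to null maps, by [susp_sy_nat], and the trace
    form is symmetric, by [mtr_swap], which carries [e] from the right end of the product to the
    left end. *)
Lemma tau_natr X' X Y (e : hom X' X) (f : hom X Y) (h : hom Y (SS X'))
    (e1 : hom (S X') (S X)) (e2 : hom (SS X') (SS X)) :
  sig (hull_in k2) (cosyz_proj k2) e e1 -> sig (hull_in k2) (cosyz_proj k2) e1 e2 ->
  tau (f \c e) h = tau f (e2 \c h).
Proof.
have sigm Z Z' (u : hom Z Z') v : sig (hull_in k2) (cosyz_proj k2) u v ->
    exists2 g, is_mor (V := mI k2 (vX Z)) (W := mI k2 (vX Z')) 0 g &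
    @conf_map K k (vX Z) (mI k2 (vX Z)) (mS k2 (vX Z)) (vX Z') (mI k2 (vX Z')) (mS k2 (vX Z'))
      (co_i k2 (vX Z)) (co_p k2 (vX Z)) (co_i k2 (vX Z')) (co_p k2 (vX Z'))
      (m u) g (mat (rc (mS k2 (vX Z))) (rc (mS k2 (vX Z'))) v).
  move=> [g [g1 g2]]; exists (mat (rc (mI k2 (vX Z))) (rc (mI k2 (vX Z'))) g).
    exact: (mat_mor (rc (mI k2 (vX Z))) (rc (mI k2 (vX Z'))) g).
  split.
    have := congr1 (mat (ch Z) (rc (mI k2 (vX Z')))) g1.
    by rewrite (matM _ (rc (mI k2 (vX Z)))) (matM _ (ch Z')) !hull_inE.
  have := congr1 (mat (rc (mI k2 (vX Z))) (rc (mS k2 (vX Z')))) g2.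
  by rewrite (matM _ (rc (mS k2 (vX Z)))) (matM _ (rc (mI k2 (vX Z')))) !cosyz_projE.
move=> /sigm[g1 hg1 cm1] /sigm[g2 hg2 cm2].
have he : is_mor (V := vX X') (W := vX X) 0 (m e) := mat_mor (ch X') (ch X) e.
have nat : is_null (V := mS k2 (vX (S X'))) (W := vX X) k%:Z
    (cy_map X \c mat (rc (mS k2 (vX (S X')))) (rc (mS k2 (vX (S X)))) e2 - m e \c cy_map X').
  apply: (susp_sy_nat he (iotaP X') (iotaP X) hg2 cm2).
  have nn := co_map_unique he hg1 cm1.
  have eq1 : mat (ch (S X)) (rc (mS k2 (vX X))) (idm (S X)) \c m e1 =
     mat (rc (mS k2 (vX X'))) (rc (mS k2 (vX X))) e1 \c
     mat (ch (S X')) (rc (mS k2 (vX X'))) (idm (S X')).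
    by rewrite -!matM cmp1m cmpm1.
  rewrite eq1 -cmpBl.
  apply: (is_null_eq (is_null_r nn (mat_mor (ch (S X')) (rc (mS k2 (vX X'))) (idm (S X'))))).
  exact: addr0.
rewrite /tau (matM _ (ch X)) (matM _ (rc (mS k2 (vX (S X'))))).
set A := ms X' h; set E := m e; set F := m f; set E2 := mat _ _ e2 in nat *.
have hA : is_mor (V := vX Y) (W := mS k2 (vX (S X'))) 0 A :=
  mat_mor (ch Y) (rc (mS k2 (vX (S X')))) h.
have hF : is_mor (V := vX X) (W := vX Y) 0 F := mat_mor (ch X) (ch Y) f.
have n3 : is_null (V := vX X) (W := vX X) k%:Z ((cy_map X \c E2 - E \c cy_map X') \c A \c F).
  by apply: (is_null_eq (is_null_r (is_null_r nat hA) hF)); rewrite !addr0.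
have /eqP := mtr_null k2 n3; rewrite !cmpBl mtrB subr_eq0 => /eqP.
rewrite [cy_map X \c (E2 \c A)]cmpA => ->.
have hc := is_morM (is_morM (iota_mor X') hA) hF.
have := @mtr_swap K k (vX X') (vX X) E (cy_map X' \c A \c F) he.1 hc.1.
by rewrite !cmpA.
Qed.

Lemma tau_mod X Y (f f' : hom X Y) h h' :
  qm J f = qm J f' -> qm J h = qm J h' -> tau f h = tau f' h'.
Proof.
move=> /qmP jf /qmP jh.
have e1 : tau f h = tau f' h.
  have := tau_null_l h jf; rewrite -[f - f']addrC -scaleN1r tau_lin mulN1r => /eqP.
  by rewrite addrC subr_eq0 => /eqP.
rewrite e1.
have := tau_null_r f' jh; rewrite -[h - h']addrC -scaleN1r tau_linr mulN1r => /eqP.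
by rewrite addrC subr_eq0 => /eqP.
Qed.

Definition qrep (X Y : D) (F : hom X Y) : @hom K C X Y := projT1 (cid (qmW F)).
Lemma qrepP (X Y : D) (F : hom X Y) : qm J (qrep F) = F.
Proof. exact: esym (projT2 (cid (qmW F))). Qed.

Definition qtau (X Y : D) (F : hom X Y) (H : @hom K D Y (SS X)) : K^o := tau (qrep F) (qrep H).

Lemma qtauE X Y (f : hom X Y) h : qtau (qm J f) (qm J h) = tau f h.
Proof. by apply: tau_mod; rewrite qrepP. Qed.

Lemma qtau_linear (X Y : D) (F : hom X Y) : linear (qtau F).
Proof.
move=> a G H; have [f ->] := qmW F; have [g ->] := qmW G; have [h ->] := qmW H.
by rewrite -qm_lin !qtauE tau_linr.
Qed.

Definition serre_pairing (X Y : D) (F : hom X Y) : {linear @hom K D Y (SS X) -> K^o} :=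
  mk_linear (qtau_linear F).

Lemma serre_pairing_inj (X Y : D) : injective (@serre_pairing X Y).
Proof.
move=> F G; have [f ->] := qmW F; have [g ->] := qmW G => e.
apply/qmP/null_of_tau_l => h.
have := congr1 (fun l : {linear @hom K D Y (SS X) -> K^o} => l (qm J h)) e.
rewrite -[LHS]/(qtau _ _) -[RHS]/(qtau _ _) !qtauE => e'.
by rewrite -[f - g]addrC -scaleN1r tau_lin e' mulN1r addNr.
Qed.

(** [fredholm] is applied to the matrix of values of [tau] on finite spanning sets. Its hypothesis
    holds because a combination of the [b j] that pairs to zero with every [f] is null, so the
    functional kills it. *)
Lemma serre_pairing_surj (X Y : D) (l : {linear @hom K D Y (SS X) -> K^o}) :
  exists F, serre_pairing F = l.
Proof.
have [n [a ha]] := mcm_hom_finite X Y; have [p [b hb]] := mcm_hom_finite Y (SS X).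
pose sumh (c : 'I_p -> K) : @hom K C Y (SS X) := \sum_j c j *: b j.
have qsum (c : 'I_p -> K) : qm J (sumh c) = \sum_j c j *: qm J (b j).
  rewrite (big_morph (qm J (X := Y) (Y := SS X)) (@qmD _ _ _ _ _) (qm0 _ _ _)).
  by apply: eq_bigr => i _; rewrite -[c i *: b i]addr0 qm_lin qm0 addr0.
have tau0r (f : @hom K C X Y) : tau f 0 = 0 by apply: tau_null_r; apply: in_sub0.
have tauDr (f : @hom K C X Y) u v : tau f (u + v) = tau f u + tau f v.
  by have := tau_linr 1 f u v; rewrite scale1r mul1r.
have tsum (f : @hom K C X Y) c : tau f (sumh c) = \sum_j tau f (b j) * c j.
  rewrite (big_morph (tau f) (tauDr f) (tau0r f)); apply: eq_bigr => j _.
  by rewrite -[c j *: b j]addr0 tau_linr tau0r addr0 mulrC.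
have tau0l (h : @hom K C Y (SS X)) : tau 0 h = 0 by apply: tau_null_l; apply: in_sub0.
have tauDl (h : @hom K C Y (SS X)) (u v : @hom K C X Y) : tau (u + v) h = tau u h + tau v h.
  by have := tau_lin 1 u v h; rewrite scale1r mul1r.
have tsuml (c : 'I_n -> K) h : tau (\sum_i c i *: a i) h = \sum_i c i * tau (a i) h.
  rewrite (big_morph (fun f => tau f h) (tauDl h) (tau0l h)); apply: eq_bigr => j _.
  by rewrite -[c j *: a j]addr0 tau_lin tau0l addr0.
have [c mc|s hs] := @fredholm K 'I_n 'I_p (fun i j => tau (a i) (b j)) (fun j => l (qm J (b j))).
  have : in_ideal J Y (SS X) (sumh c).
    apply: null_of_tau_r => f; have [d ->] := ha f; rewrite tsuml big1 // => i _.
    by rewrite tsum mc mulr0.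
  move=> /(qm_eq0 J); rewrite qsum => e.
  have := congr1 l e; rewrite linear_sum linear0 => {2}<-.
  by apply: eq_bigr => j _; rewrite linearZ_LR mulrC.
exists (qm J (\sum_i s i *: a i)); apply: linear_ext => H.
have [h ->] := qmW H; have [d ->] := hb h.
rewrite -[LHS]/(qtau _ _) qtauE -/(sumh d) tsum qsum linear_sum.
apply: eq_bigr => j _; rewrite linearZ_LR hs tsuml mulrC.
by [].
Qed.

Lemma serre_pairing_bij (X Y : D) : bijective (@serre_pairing X Y).
Proof.
pose g l := projT1 (cid (@serre_pairing_surj X Y l)).
have gK l : serre_pairing (g l) = l by exact: (projT2 (cid (serre_pairing_surj l))).
by exists g => [F|//]; apply: serre_pairing_inj; rewrite gK.
Qed.

Lemma mcm_2CY : is_2CY_triangulated T.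
Proof.
split; [exact: stable_triangulated | exact: stable_hom_finite |].
exists serre_pairing; split; last 2 first.
- move=> X Y Y' F G H; have [f ->] := qmW F; have [g ->] := qmW G; have [h ->] := qmW H.
  rewrite -!qmM -[LHS]/(qtau _ _) -[RHS]/(qtau _ _) !qtauE; exact: tau_natl.
- move=> X' X Y E F H; have [e ->] := qmW E; have [f ->] := qmW F; have [h ->] := qmW H.
  have [e1 se1] := sig_ex fr e; have [e2 se2] := sig_ex fr e1.
  have es : fmap (susp T) (fmap (susp T) (qm J e)) = qm J e2.
    exact: etrans (congr1 (@fmap K D D (susp T) (S X') (S X)) (stable_suspE fr se1))
      (stable_suspE fr se2).
  rewrite es -!qmM.
  rewrite -[LHS]/(qtau _ _) -[RHS]/(qtau _ _) !qtauE; exact: tau_natr se1 se2.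
- move=> X Y a F G H; have [f ->] := qmW F; have [g ->] := qmW G; have [h ->] := qmW H.
  by rewrite -qm_lin -![serre_pairing _ _]/(qtau _ _) !qtauE tau_lin.
exact: serre_pairing_bij.
Qed.

End Serre.

Theorem proposition3p12 (Re : realType) (k : nat) (hk : (2 <= k)%N) :
  exists T : triangulation (stable_MCM0 Re[i]%type k),
    is_stable_triangulation T /\ is_2CY_triangulated T.
Proof.
by exists (mcm_triang _ hk); split; [apply: mcm_stable_triangulation | apply: mcm_2CY].
Qed.
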